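(* Let $A$ be a finite set and $\varphi\colon A^\omega\to\mathbb{R}$ be a continuous positionally determined payoff. Consider an oracle which, for given $u,a\in A^*$ and $v,b\in A^+$, tells whether there exists $w\in A^*$ such that $\varphi(wu(v)^\omega)>\varphi(wa(b)^\omega)$. There exists a randomized algorithm which solves the strategy synthesis problem for $\varphi$ with this oracle in expected $e^{O\left(\log m+\sqrt{n\log m}\right)}$ time for game graphs with $n$ nodes and $m$ edges. In particular, every call to the oracle in the algorithm is for words $u,v,a,b$ that are of length $O(n)$, and the expected number of the calls is $e^{O\left(\log m+\sqrt{n\log m}\right)}$.
   Context: $A^*$, $A^+$ and $A^\omega$ denote the sets of finite words, non-empty finite words and infinite words over $A$; $(v)^\omega$ is the infinite repetition of $v\in A^+$. A payoff is a bounded function $\varphi\colon A^\omega\to\mathbb{R}$. Continuity is with respect to the product topology on $A^\omega$ of the discrete topology on $A$. Strategy synthesis problem for a positionally determined payoff $\varphi$: given an $A$-labeled game graph, find an equilibrium (with respect to $\varphi$) of two positional strategies in it. Games. An $A$-labeled game graph is a tuple $G=\langle V,V_{\mathrm{Max}},V_{\mathrm{Min}},E\rangle$ of finite sets such that $V$ is the disjoint union of $V_{\mathrm{Max}}$ and $V_{\mathrm{Min}}$, $E\subseteq V\times A\times V$, and for every $s\in V$ there exist $a\in A$, $t\in V$ with $(s,a,t)\in E$. Elements of $V$ are nodes and elements of $E$ are edges. For $e=(s,a,t)\in E$ put $\mathsf{source}(e)=s$, $\mathsf{lab}(e)=a$, $\mathsf{target}(e)=t$. A path is a non-empty finite or infinite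 sequence of edges in which the target of each edge is the source of the next one; moreover, for each $s\in V$ there is a $0$-length path $\lambda_s$ with $\mathsf{source}(\lambda_s)=\mathsf{target}(\lambda_s)=s$. The source of a path of positive length is the source of its first edge, and the target of a finite path of positive length is the target of its last edge. For a path $p$, $\mathsf{lab}(p)$ is the word of labels of its edges, in order. A strategy of Max is a mapping $\sigma$ assigning to every finite path $p$ (including $0$-length paths) with $\mathsf{target}(p)\in V_{\mathrm{Max}}$ an edge whose source is $\mathsf{target}(p)$; strategies of Min are defined analogously with $V_{\mathrm{Min}}$. An infinite path $\mathcal{P}$ is consistent with a strategy of Max $\sigma$ if for every finite prefix $p$ of $\mathcal{P}$ (including the $0$-length one) with $\mathsf{target}(p)\in V_{\mathrm{Max}}$, $\sigma(p)$ is the next edge of $\mathcal{P}$ after $p$; similarly for Min. $\mathsf{Cons}(s,\sigma)$ is the set of infinite paths starting at $s$ and consistent with $\sigma$. A strategy is positional if its value on a path $p$ depends only on $\mathsf{target}(p)$. The value at $s\in V$ of a strategy of Max $\sigma$ is $\mathbf{Val}[\sigma](s)=\inf\{\varphi(\mathsf{lab}(\mathcal P)) : \mathcal P\in\mathsf{Cons}(s,\sigma)\}$, and of a strategy of Min $\tau$ is $\mathbf{Val}[\tau](s)=\sup\{\varphi(\mathsf{lab}(\mathcal P)) : \mathcal P\in\mathsf{Cons}(s,\tau)\}$. A pair $(\sigma,\tau)$ is an equilibrium (w.r.t. $\varphi$) if $\mathbf{Val}[\sigma](s)=\mathbf{Val}[\tau](s)$ for every $s\in V$. The payoff $\varphi$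 is positionally determined if every $A$-labeled game graph has an equilibrium (w.r.t. $\varphi$) consisting of two positional strategies. *)

(* Defs.v *)
From HB Require Import structures.
From mathcomp Require Import all_boot all_order all_algebra.
From mathcomp Require Import all_classical all_reals all_analysis.
Import Order.TTheory GRing.Theory Num.Theory.
Import numFieldNormedType.Exports.

Set Implicit Arguments.
Unset Strict Implicit.
Unset Printing Implicit Defensive.

Local Open Scope classical_set_scope.
Local Open Scope ring_scope.

(** * Words *)

(* As a topological space: the product of countably many copies of discrete A *)
Definition infinite_word (A : finType) : Type :=
  prod_topology (fun _ : nat => discrete_topology A).

(* A^+, as first letter and remaining letters *)
Definition nonempty_word (A : Type) : Type := (A * seq A)%type.
Definition word_of (A : Type) (v : nonempty_word A) : seq A := v.1 :: v.2.

Definition prepend (A : finType) (w : seq A) (x : infinite_word A) :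
    infinite_word A :=
  fun i => nth (x (i - size w)%N) w i.

Definition omega_power (A : finType) (v : nonempty_word A) : infinite_word A :=
  fun i => nth v.1 (word_of v) (i %% size (word_of v))%N.

(** * Games *)

Record game_graph (A : finType) := GameGraph {
  node : finType;
  max_nodes : {set node};
  edges : {set node * A * node};
  no_deadlock : forall s, exists a t, (s, a, t) \in edges
}.

Definition min_nodes (A : finType) (G : game_graph A) : {set node G} :=
  ~: max_nodes G.

Section Games.
Context {A : finType} (G : game_graph A).

(* A triple; it is an edge of G when it belongs to [edges G] *)
Definition arrow : Type := (node G * A * node G)%type.
Definition source (e : arrow) : node G := e.1.1.
Definition label (e : arrow) : A := e.1.2.
Definition target (e : arrow) : node G := e.2.

(* A finite path is given by its source s and its sequence p of edges, so that
   lambda_s is s with [::]. *)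
Fixpoint is_path (s : node G) (p : seq arrow) : bool :=
  if p is e :: p' then
    [&& e \in edges G, source e == s & is_path (target e) p']
  else true.

Definition path_target (s : node G) (p : seq arrow) : node G :=
  last s [seq target e | e <- p].

Definition is_infinite_path (P : nat -> arrow) : Prop :=
  forall k, P k \in edges G /\ target (P k) = source (P k.+1).

Definition infinite_label (P : nat -> arrow) : infinite_word A :=
  fun k => label (P k).

(* Both players are treated at once: U is the set of nodes of the player.
   Values of a strategy outside the finite paths ending in U are irrelevant. *)
Definition strategy : Type := node G -> seq arrow -> arrow.

Definition is_strategy (U : {set node G}) (sigma : strategy) : Prop :=
  forall s p, is_path s p -> path_target s p \in U ->
    sigma s p \in edges G /\ source (sigma s p) = path_target s p.

Definition positional (U : {set node G}) (sigma : strategy) : Prop :=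
  forall s p s' p', is_path s p -> is_path s' p' ->
    path_target s p \in U -> path_target s p = path_target s' p' ->
    sigma s p = sigma s' p'.

(* [mkseq P k] is the sequence of the first k edges of P. *)
Definition consistent (U : {set node G}) (s : node G) (sigma : strategy) :
    set (nat -> arrow) :=
  [set P | [/\ is_infinite_path P, source (P 0%N) = s &
     forall k, path_target s (mkseq P k) \in U -> sigma s (mkseq P k) = P k]].

Context {R : realType} (phi : infinite_word A -> R).

Definition value_max (sigma : strategy) (s : node G) : R :=
  inf [set phi (infinite_label P) | P in consistent (max_nodes G) s sigma].

Definition value_min (tau : strategy) (s : node G) : R :=
  sup [set phi (infinite_label P) | P in consistent (min_nodes G) s tau].

Definition positional_equilibrium (sigma tau : strategy) : Prop :=
  [/\ is_strategy (max_nodes G) sigma /\ positional (max_nodes G) sigma,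
      is_strategy (min_nodes G) tau /\ positional (min_nodes G) tau &
      forall s, value_max sigma s = value_min tau s].

End Games.

Definition bounded_payoff (A : finType) (R : realType)
    (phi : infinite_word A -> R) : Prop :=
  exists M : R, forall x, `|phi x| <= M.

Definition positionally_determined (A : finType) (R : realType)
    (phi : infinite_word A -> R) : Prop :=
  forall G : game_graph A, exists sigma tau : strategy G,
    positional_equilibrium phi sigma tau.

(** * Randomized oracle algorithms *)

(* The model of computation is Jones' WHILE language over binary trees (see
   "Computability and Complexity from a Programming Perspective"), extended
   with fair coin tosses and oracle calls. Each command or loop test costs one
   time unit; the expressions of a program have constant size, so this is the
   usual unit-cost measure for cons, head and tail up to a constant factor
   depending on the program. It agrees with Turing-machine time up to a
   polynomial. *)

Inductive tree := Nil | Cons of tree & tree.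

Definition hd (d : tree) : tree := if d is Cons x _ then x else Nil.
Definition tl (d : tree) : tree := if d is Cons _ y then y else Nil.

Inductive expr :=
  | Var of nat
  | ENil
  | ECons of expr & expr
  | EHd of expr
  | ETl of expr.

Inductive cmd :=
  | Skip
  | Assign of nat & expr
  | Seq of cmd & cmd
  | If of expr & cmd & cmd
  | While of expr & cmd
  | Toss of nat
  | Query of nat & expr & expr & expr & expr.

Definition store := nat -> tree.

Definition update (s : store) (x : nat) (d : tree) : store :=
  fun y => if y == x then d else s y.

Fixpoint eval (s : store) (e : expr) : tree :=
  match e with
  | Var x => s x
  | ENil => Nil
  | ECons e1 e2 => Cons (eval s e1) (eval s e2)
  | EHd e1 => hd (eval s e1)
  | ETl e1 => tl (eval s e1)
  end.

Definition truthy (d : tree) : bool := if d is Cons _ _ then true else false.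

Definition tree_of_bool (b : bool) : tree := if b then Cons Nil Nil else Nil.

(* The commands still to be executed, and the store *)
Definition config : Type := (seq cmd * store)%type.

Inductive outcome :=
  | Halted
  | Next of config
  | Coin of config & config.

Definition oracle := tree -> tree -> tree -> tree -> bool.

Definition step (O : oracle) (c : config) : outcome :=
  let: (k, s) := c in
  match k with
  | [::] => Halted
  | Skip :: k' => Next (k', s)
  | Assign x e :: k' => Next (k', update s x (eval s e))
  | Seq c1 c2 :: k' => Next ([:: c1, c2 & k'], s)
  | If e c1 c2 :: k' => Next ((if truthy (eval s e) then c1 else c2) :: k', s)
  | While e c1 :: k' =>
      Next (if truthy (eval s e) then [:: c1, While e c1 & k'] else k', s)
  | Toss x :: k' =>
      Coin (k', update s x (tree_of_bool false))
           (k', update s x (tree_of_bool true))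
  | Query x eu ev ea eb :: k' =>
      Next (k', update s x (tree_of_bool
                  (O (eval s eu) (eval s ev) (eval s ea) (eval s eb))))
  end.

Definition running (c : config) : bool := if c.1 is _ :: _ then true else false.

Definition querying (c : config) : bool :=
  if c.1 is Query _ _ _ _ _ :: _ then true else false.

(* The four arguments of the oracle call about to be made, if any *)
Definition query_args (c : config) : option (tree * tree * tree * tree) :=
  let: (k, s) := c in
  if k is Query _ eu ev ea eb :: _ then
    Some (eval s eu, eval s ev, eval s ea, eval s eb)
  else None.

(* The configurations having positive probability of being visited *)
Inductive reachable (O : oracle) (c0 : config) : config -> Prop :=
  | reachable_start : reachable O c0 c0
  | reachable_next c c' :
      reachable O c0 c -> step O c = Next c' -> reachable O c0 c'
  | reachable_coin0 c c1 c2 :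
      reachable O c0 c -> step O c = Coin c1 c2 -> reachable O c0 c1
  | reachable_coin1 c c1 c2 :
      reachable O c0 c -> step O c = Coin c1 c2 -> reachable O c0 c2.

(* The probability that, starting from c, exactly t steps can be made and
   then the current configuration satisfies P *)
Fixpoint prob_after (R : realType) (O : oracle) (P : config -> bool) (t : nat)
    (c : config) : R :=
  if t is t'.+1 then
    match step O c with
    | Halted => 0
    | Next c' => prob_after R O P t' c'
    | Coin c1 c2 => (prob_after R O P t' c1 + prob_after R O P t' c2) / 2
    end
  else (P c)%:R.

Definition expected_visits (R : realType) (O : oracle) (P : config -> bool)
    (c : config) : \bar R :=
  (\sum_(0 <= t <oo) (prob_after R O P t c)%:E)%E.

(* The expectation of the number of steps; when it is finite, the computation
   halts with probability 1. *)
Definition expected_time (R : realType) (O : oracle) (c : config) : \bar R :=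
  expected_visits R O running c.

Definition expected_queries (R : realType) (O : oracle) (c : config) : \bar R :=
  expected_visits R O querying c.

(** * Encodings *)

Definition tree_of_nat (n : nat) : tree := iter n (Cons Nil) Nil.

Definition tree_of_seq (s : seq tree) : tree := foldr Cons Nil s.

Definition tree_of_elt (T : finType) (x : T) : tree :=
  tree_of_nat (enum_rank x).

Definition tree_of_word (A : finType) (w : seq A) : tree :=
  tree_of_seq [seq tree_of_elt a | a <- w].

Definition tree_of_arrow (A : finType) (G : game_graph A) (e : arrow G) :
    tree :=
  Cons (tree_of_elt (source e))
       (Cons (tree_of_elt (label e)) (tree_of_elt (target e))).

Definition tree_of_game (A : finType) (G : game_graph A) : tree :=
  Cons (tree_of_seq [seq tree_of_bool (s \in max_nodes G) | s <- enum (node G)])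
       (tree_of_seq [seq tree_of_arrow e | e : arrow G <- enum (edges G)]).

(* The list of the edges chosen at the successive nodes. The value of a
   positional strategy at a node s is its value on the path lambda_s. *)
Definition tree_of_strategies (A : finType) (G : game_graph A)
    (sigma tau : strategy G) : tree :=
  tree_of_seq
    [seq tree_of_arrow (if s \in max_nodes G then sigma s [::] else tau s [::])
    | s <- enum (node G)].

Definition payoff_oracle (A : finType) (R : realType)
    (phi : infinite_word A -> R) : oracle :=
  fun du dv da db => `[< exists (u : seq A) (v : nonempty_word A)
                                (a : seq A) (b : nonempty_word A),
    [/\ du = tree_of_word u, dv = tree_of_word (word_of v),
        da = tree_of_word a, db = tree_of_word (word_of b) &
        exists w : seq A,
          phi (prepend (w ++ u) (omega_power v)) >
          phi (prepend (w ++ a) (omega_power b))] >].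

(* Every oracle call that can occur is for words u, a and non-empty words v, b
   all of length at most l. *)
Definition queries_bounded (A : finType) (O : oracle) (c0 : config) (l : nat) :
    Prop :=
  forall c du dv da db, reachable O c0 c ->
    query_args c = Some (du, dv, da, db) ->
    exists (u : seq A) (v : nonempty_word A) (a : seq A) (b : nonempty_word A),
      [/\ du = tree_of_word u, dv = tree_of_word (word_of v),
          da = tree_of_word a, db = tree_of_word (word_of b) &
          [/\ (size u <= l)%N, (size (word_of v) <= l)%N,
              (size a <= l)%N & (size (word_of b) <= l)%N]].

(* The input is given in variable 0, all other variables being Nil; the output
   is read in variable 0. *)
Definition start (prog : cmd) (input : tree) : config :=
  ([:: prog], fun x => if x == 0%N then input else Nil).

Definition synthesizes (A : finType) (R : realType)
    (phi : infinite_word A -> R) (prog : cmd) (G : game_graph A) : Prop :=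
  forall c, reachable (payoff_oracle phi) (start prog (tree_of_game G)) c ->
    ~~ running c ->
    exists sigma tau : strategy G,
      positional_equilibrium phi sigma tau /\
      c.2 0%N = tree_of_strategies sigma tau.

(* The bound e^{O(log m + sqrt (n log m))}, with constant C. The factor C
   matters only when m <= 1, where the logarithm vanishes: for m >= 2 it is
   absorbed by the constant in the exponent. *)
Definition subexp_bound (R : realType) (C : R) (n m : nat) : R :=
  C * expR (C * (ln m%:R + Num.sqrt (n%:R * ln m%:R))).

(* Main.v *)
(* Write x <= y for infinite words when phi(w x) <= phi(w y) for every finite
   word w; the oracle decides this preorder on ultimately periodic words.
   Positional determinacy, applied to a game in which two prefixes lead to one
   choice between x and y, makes the preorder total on the words generated by
   finite automata.  By continuity, if the value of each node on a path compares
   with the label of the next edge followed by the value of its target, then the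
   value of the source compares with the label of the whole path.  Hence
   switching a node to an edge that looks better to its owner improves all
   values weakly and one strictly, and a pair of positional strategies without
   improving edges is an equilibrium.

   Max runs the Random Facet algorithm, and Min's best responses are found by
   Random Facet as well.  Unfolded, its recursion keeps the unused edges in a
   random order, switches to the first improving one, and reshuffles the edges
   before it together with the edge given up.  For hidden dimension d and k
   unused edges the expected number of switches satisfies
     U(d,k) <= U(d,k-1) + 2 + (2/k) (U(d-1,k) + ... + U(d-min(d,k),k)),
   which is solved by (1 + 1/s)^d (s+1)^min(k,4s) (k+1)^(4s+1) for every s >= 1;
   the choice s ~ sqrt(n / log m) gives the bound. *)
Require Import Defs.
From HB Require Import structures.
From mathcomp Require Import all_boot all_order all_algebra.
From mathcomp Require Import zify ring lra.
From mathcomp Require Import all_classical all_reals all_analysis.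
Import Order.TTheory GRing.Theory Num.Theory.
Import numFieldNormedType.Exports.

Set Implicit Arguments.
Unset Strict Implicit.
Unset Printing Implicit Defensive.

Local Open Scope classical_set_scope.
Local Open Scope ring_scope.

(** A comparison of payoffs after a single prefix cannot be chained along a path, since each edge
    lengthens the prefix; this is why the preorder quantifies over all prefixes. Strategies need not
    be comparable node by node, so Random Facet is analysed for a natural-number potential with two
    properties: an improving switch raises it, and a strategy without improving switches in a set of
    edges maximizes it there.

    The programming language has no recursion, so the calls of Random Facet live on a stack: an edge
    is pushed when the call that avoids it starts. The edges behind the first improving one belong
    to calls still pending and must keep their places; hence only the edges before it are
    reshuffled.

    Min's run is randomized and may stop at different best responses. Their values are equivalent,
    so Max's improvement test does not depend on the one found. Nesting the two runs squares the
    bound on the number of switches, which the exponent absorbs.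

    Edges are drawn by repeated halving, so every run is finite whatever the coins; the price is the
    weight 2/k in the recurrence instead of the uniform 1/k. *)

Local Notation eval := Defs.eval.
Local Notation Nil := Defs.Nil.
Local Notation Cons := Defs.Cons.

(** * Expected cost of terminating computations *)

Section ExpectedCost.
Context {R : realType} (O : oracle).
Context (query_ok : tree * tree * tree * tree -> Prop) (post : store -> Prop).

(* Every run from c is finite, its halting store satisfies post, all of its
   queries satisfy query_ok, and the expected number of steps is at most r. *)
Inductive good : config -> R -> Prop :=
  | good_halt s r : 0 <= r -> post s -> good ([::], s) r
  | good_next c c' r : (forall q, query_args c = Some q -> query_ok q) ->
      step O c = Next c' -> good c' r -> good c (1 + r)
  | good_coin c c1 c2 r1 r2 :
      step O c = Coin c1 c2 -> good c1 r1 -> good c2 r2 ->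
      good c (1 + (r1 + r2) / 2)
  | good_le c r r' : r <= r' -> good c r -> good c r'.

(** By induction on the derivation: the first term is at most 1, the others are bounded through the
    premises, and a halted configuration contributes 0 because [P] implies [running]. The empty sum
    is treated apart, as [0 <= r] has to be extracted from the derivation. *)
Lemma sum_prob_after (P : config -> bool) c r T :
  (forall c', P c' -> running c') -> good c r ->
  \sum_(0 <= t < T) prob_after R O P t c <= r.
Proof.
move=> Prun gc; have [T0|T0] := posnP T.
  rewrite T0 big_nil; elim: gc => [//|c0 c' r0 _ _ _ h|c0 c1 c2 r1 r2 _ _ h1 _ h2|c0 r0 r' le _ h].
  - by rewrite addr_ge0.
  - by rewrite addr_ge0// divr_ge0// addr_ge0.
  - exact: le_trans le.
case: T T0 => [//|T _]; elim: gc T => [s r0 r0_ge0 _|c0 c' r0 _ st _ IH|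
  c0 c1 c2 r1 r2 st _ IH1 _ IH2|c0 r0 r' le _ IH] T.
- rewrite big_nat_recl// big1 ?addr0 => [|//] /=.
  by case: (P _) (Prun ([::], s)) => // /(_ isT).
- rewrite big_nat_recl//= lerD//; first by case: (P _).
  under eq_bigr do rewrite st.
  by case: T => [|T]; [rewrite big_nil; apply: le_trans (IH 0); rewrite big_nat1/=
                     | exact: IH].
- rewrite big_nat_recl//= lerD//; first by case: (P _).
  under eq_bigr do rewrite st.
  rewrite -mulr_suml ler_pM2r ?invr_gt0// big_split/= lerD//.
  + by case: T => [|T]; [rewrite big_nil; apply: le_trans (IH1 0); rewrite big_nat1/=
                     | exact: IH1].
  + by case: T => [|T]; [rewrite big_nil; apply: le_trans (IH2 0); rewrite big_nat1/=
                     | exact: IH2].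
- exact: le_trans le.
Qed.

Lemma prob_after_ge0 (P : config -> bool) t c : 0 <= prob_after R O P t c.
Proof.
elim: t c => [|t IH] c //=; case: (step O c) => // c1 c2.
by rewrite divr_ge0// addr_ge0.
Qed.

Lemma expected_visits_le (P : config -> bool) c r :
  (forall c', P c' -> running c') -> good c r ->
  (expected_visits R O P c <= r%:E)%E.
Proof.
move=> Prun gc; apply: lime_le.
  by apply: is_cvg_nneseries => t _ _; rewrite lee_fin prob_after_ge0.
by apply: nearW => T; rewrite sumEFin lee_fin; apply: sum_prob_after.
Qed.

Lemma querying_running c : querying c -> running c.
Proof. by case: c => [[]]. Qed.

(** An inversion principle. It needs induction because [good_le] may have been applied any number of
    times after the rule for the actual step. *)
Lemma good_step c r : good c r ->
  [/\ (forall c', step O c = Next c' -> exists r', good c' r'),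
      (forall c1 c2, step O c = Coin c1 c2 ->
        exists r1 r2, good c1 r1 /\ good c2 r2),
      (forall q, query_args c = Some q -> query_ok q) &
      ~~ running c -> post c.2].
Proof.
elim=> [s r0 _ Ps|c0 c' r0 qok st gc' _|c0 c1 c2 r1 r2 st g1 _ g2 _|//].
- by split.
- split=> // [c1|c1 c2|]; rewrite ?st//.
    by case=> <-; exists r0.
  by case: c0 st {qok} => [[|[]]].
- split=> [c'|c1' c2'|q|]; rewrite ?st//.
  + by case=> <- <-; exists r1, r2.
  + by case: c0 st => [[|[]]].
  + by case: c0 st => [[|[]]].
Qed.

Lemma good_reachable c0 r c : good c0 r -> reachable O c0 c ->
  exists r', good c r'.
Proof.
move=> g0; elim=> [|c1 c' _ [r1 g1] st|c1 c2 c3 _ [r1 g1] st|c1 c2 c3 _ [r1 g1] st].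
- by exists r.
- by have [+ _ _ _] := good_step g1; exact.
- by have [_ /(_ _ _ st) [r2 [r3 [? ?]]] _ _] := good_step g1; exists r2.
- by have [_ /(_ _ _ st) [r2 [r3 [? ?]]] _ _] := good_step g1; exists r3.
Qed.

End ExpectedCost.

(** * Deterministic program fragments *)

Definition block (cs : seq cmd) : cmd := foldr Seq Skip cs.
Arguments block : simpl never.

Definition foreach (x l : nat) (body : cmd) : cmd :=
  While (Var l)
    (block [:: Assign x (EHd (Var l)); Assign l (ETl (Var l)); body]).

Fixpoint modified (c : cmd) : seq nat :=
  match c with
  | Skip => [::]
  | Assign x _ | Toss x | Query x _ _ _ _ => [:: x]
  | Seq c1 c2 | If _ c1 c2 => modified c1 ++ modified c2
  | While _ c1 => modified c1
  end.

Definition same_but (X : seq nat) (s s' : store) : Prop :=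
  forall v, v \notin X -> s' v = s v.

Lemma same_but_trans X s s' s'' :
  same_but X s s' -> same_but X s' s'' -> same_but X s s''.
Proof. by move=> h h' v vX; rewrite h' ?h. Qed.

Lemma same_but_sub X Y s s' : {subset X <= Y} -> same_but X s s' -> same_but Y s s'.
Proof. by move=> XY h v vY; apply/h/(contra _ vY)/XY. Qed.

Lemma same_but_update X s s' x d :
  x \in X -> same_but X s s' -> same_but X s (update s' x d).
Proof.
by move=> xX h v vX; rewrite /update ifN ?h//; apply: contraNneq vX => ->.
Qed.

Section Exec.
Context (O : oracle) (query_ok : tree * tree * tree * tree -> Prop).

(** There is no rule for [Toss]: the behaviour of these fragments is determined by the store and the
    oracle. The last index counts steps exactly as [step] makes them. *)
Inductive exec : cmd -> store -> store -> nat -> Prop :=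
  | exec_skip s : exec Skip s s 1
  | exec_assign s x e : exec (Assign x e) s (update s x (eval s e)) 1
  | exec_seq c1 c2 s s1 s2 t1 t2 :
      exec c1 s s1 t1 -> exec c2 s1 s2 t2 ->
      exec (Seq c1 c2) s s2 (t1 + t2).+1
  | exec_if e c1 c2 s s' t :
      exec (if truthy (eval s e) then c1 else c2) s s' t ->
      exec (If e c1 c2) s s' t.+1
  | exec_while_false e c s : ~~ truthy (eval s e) -> exec (While e c) s s 1
  | exec_while_true e c s s1 s2 t1 t2 : truthy (eval s e) ->
      exec c s s1 t1 -> exec (While e c) s1 s2 t2 ->
      exec (While e c) s s2 (t1 + t2).+1
  | exec_query s x eu ev ea eb :
      query_ok (eval s eu, eval s ev, eval s ea, eval s eb) ->
      exec (Query x eu ev ea eb) s (update s x (tree_of_bool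
        (O (eval s eu) (eval s ev) (eval s ea) (eval s eb)))) 1.

Lemma exec_good (R : realType) post c s s' t k (r : R) :
  exec c s s' t -> good O query_ok post (k, s') r ->
  good O query_ok post (c :: k, s) (t%:R + r).
Proof.
move=> e; elim: e k r => {c s s' t}
  [s|s x e|c1 c2 s s1 s2 t1 t2 _ IH1 _ IH2|e c1 c2 s s' t _ IH|e c s ne|
   e c s s1 s2 t1 t2 te _ IH1 _ IH2|s x eu ev ea eb qok] k r g.
- exact: good_next g.
- exact: good_next g.
- rewrite -addn1 addnC natrD -addrA.
  apply: good_next => [//||]; first by [].
  by rewrite natrD -addrA; apply/IH1/IH2.
- rewrite -addn1 addnC natrD -addrA.
  by apply: good_next => [//||]; [by [] | exact: IH].
- by apply: good_next g; rewrite //= (negbTE ne).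
- rewrite -addn1 addnC natrD -addrA.
  apply: good_next; first by [].
    by rewrite /= te.
  by rewrite natrD -addrA; apply/IH1/IH2.
- by apply: good_next g => // q [<-].
Qed.

Lemma exec_same c s s' t : exec c s s' t -> same_but (modified c) s s'.
Proof.
elim=> {c s s' t} [s|s x e|c1 c2 s s1 s2 t1 t2 _ IH1 _ IH2|
   e c1 c2 s s' t _ IH|e c s ne|
   e c s s1 s2 t1 t2 te _ IH1 _ IH2|s x eu ev ea eb qok] v //=.
- by rewrite inE /update => /negbTE ->.
- by rewrite mem_cat negb_or => /andP[v1 v2]; rewrite IH2// IH1.
- rewrite mem_cat negb_or => /andP[v1 v2]; apply: IH.
  by case: ifP.
- by move=> vc; rewrite IH2// IH1.
- by rewrite inE /update => /negbTE ->.
Qed.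

Definition triple (s : store) (c : cmd) (t : nat) (Q : store -> Prop) : Prop :=
  exists s' t', [/\ exec c s s' t', (t' <= t)%N & Q s'].

Lemma triple_good (R : realType) post s c t Q k (r : R) :
  triple s c t Q -> (forall s', Q s' -> same_but (modified c) s s' ->
    good O query_ok post (k, s') r) ->
  good O query_ok post (c :: k, s) (t%:R + r).
Proof.
move=> [s' [t' [ex le Qs]]] h.
apply: (@good_le _ _ _ _ _ (t'%:R + r)); first by rewrite lerD2r ler_nat.
exact: exec_good ex (h _ Qs (exec_same ex)).
Qed.

Lemma triple_le s c t t' Q : (t <= t')%N -> triple s c t Q -> triple s c t' Q.
Proof.
by move=> le [s' [t1 [e l q]]]; exists s', t1; split=> //; apply: leq_trans le.
Qed.

Lemma triple_weaken s c t (Q Q' : store -> Prop) : triple s c t Q ->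
  (forall s', Q s' -> same_but (modified c) s s' -> Q' s') -> triple s c t Q'.
Proof.
by move=> [s' [t1 [e l q]]] h; exists s', t1; split=> //; exact: h q (exec_same e).
Qed.

Lemma triple_if s e c1 c2 t Q :
  triple s (if truthy (eval s e) then c1 else c2) t Q ->
  triple s (If e c1 c2) t.+1 Q.
Proof.
by move=> [s' [t' [ex le q]]]; exists s', t'.+1; split=> //; exact: exec_if.
Qed.

Lemma triple_assign s x e (Q : store -> Prop) :
  Q (update s x (eval s e)) -> triple s (Assign x e) 1 Q.
Proof. by move=> q; exists (update s x (eval s e)), 1; split=> //; constructor. Qed.

Lemma triple_skip s (Q : store -> Prop) : Q s -> triple s Skip 1 Q.
Proof. by move=> q; exists s, 1; split=> //; constructor. Qed.

Lemma block_nil s (Q : store -> Prop) : Q s -> triple s (block [::]) 1 Q.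
Proof. exact: triple_skip. Qed.

Lemma block_call s c cs t1 t2 (Q1 Q : store -> Prop) : triple s c t1 Q1 ->
  (forall s1, Q1 s1 -> same_but (modified c) s s1 -> triple s1 (block cs) t2 Q) ->
  triple s (block (c :: cs)) (t1 + t2).+1 Q.
Proof.
move=> [s1 [t1' [e1 le1 q1]]] /(_ s1 q1 (exec_same e1)) [s2 [t2' [e2 le2 q2]]].
exists s2, (t1' + t2').+1; split=> //; last by rewrite ltnS leq_add.
exact: exec_seq e1 e2.
Qed.

Lemma block_last s c t (Q : store -> Prop) :
  triple s c t Q -> triple s (block [:: c]) (t + 1).+1 Q.
Proof. by move=> h; apply: block_call h _ => s1 q _; apply: block_nil. Qed.

Lemma block_assign s x e cs t Q :
  triple (update s x (eval s e)) (block cs) t Q ->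
  triple s (block (Assign x e :: cs)) t.+2 Q.
Proof.
move=> h; rewrite -[t.+2]/(1 + t).+1.
by apply: (block_call (triple_assign (Q := eq (update s x (eval s e))) erefl))
  => _ <- _.
Qed.

Lemma triple_query s x eu ev ea eb (Q : store -> Prop) :
  query_ok (eval s eu, eval s ev, eval s ea, eval s eb) ->
  Q (update s x (tree_of_bool
        (O (eval s eu) (eval s ev) (eval s ea) (eval s eb)))) ->
  triple s (Query x eu ev ea eb) 1 Q.
Proof. by move=> qok q; eexists _, _; split; [exact: exec_query|by []|]. Qed.

Lemma while_false s e c (Q : store -> Prop) :
  ~~ truthy (eval s e) -> Q s -> triple s (While e c) 1 Q.
Proof. by move=> ne q; exists s, 1; split=> //; constructor. Qed.

Lemma while_true s e c t1 t2 (Q1 Q : store -> Prop) :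
  truthy (eval s e) -> triple s c t1 Q1 ->
  (forall s1, Q1 s1 -> same_but (modified c) s s1 -> triple s1 (While e c) t2 Q) ->
  triple s (While e c) (t1 + t2).+1 Q.
Proof.
move=> te [s1 [t1' [e1 le1 q1]]] /(_ s1 q1 (exec_same e1)) [s2 [t2' [e2 le2 q2]]].
exists s2, (t1' + t2').+1; split=> //; last by rewrite ltnS leq_add.
exact: exec_while_true e1 e2.
Qed.

(** The invariant is indexed by the part of the list still to be read. The 7 extra steps per round
    are the loop test, the two assignments and the four steps that the block itself costs. *)
Lemma foreach_triple (T : Type) (enc : T -> tree) (x l : nat) body t
    (I : seq T -> store -> Prop) (xs : seq T) s :
  x != l -> l \notin modified body ->
  (forall y ys s', same_but (modified (foreach x l body)) s s' ->
    I (y :: ys) s' ->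
    triple (update (update s' x (enc y)) l (tree_of_seq [seq enc z | z <- ys]))
      body t (I ys)) ->
  s l = tree_of_seq [seq enc z | z <- xs] -> I xs s ->
  triple s (foreach x l body) (size xs * (t + 7)).+1
    (fun s' => s' l = Nil /\ I [::] s').
Proof.
move=> x_neq_l l_notin step.
suff: forall s', same_but (modified (foreach x l body)) s s' ->
    s' l = tree_of_seq [seq enc z | z <- xs] -> I xs s' ->
    triple s' (foreach x l body) (size xs * (t + 7)).+1
    (fun s' => s' l = Nil /\ I [::] s') by apply.
elim: xs => [|y ys IH] s' ss' sl Is.
  by apply: while_false => //; rewrite /= sl.
have -> : ((size (y :: ys) * (t + 7)).+1 =
  ((t + 1).+1.+2.+2 + (size ys * (t + 7)).+1).+1)%N by rewrite /=; lia.
apply: (while_true (Q1 := fun s1 => s1 l = tree_of_seq [seq enc z | z <- ys] /\ I ys s1)).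
- by rewrite /= sl.
- apply: block_assign; apply: block_assign.
  have -> : eval s' (EHd (Var l)) = enc y by rewrite /= sl.
  have -> : eval (update s' x (enc y)) (ETl (Var l)) =
      tree_of_seq [seq enc z | z <- ys].
    by rewrite /= /update eq_sym (negbTE x_neq_l) sl.
  apply: block_call; first exact: step.
  move=> s1 Is1 sb; apply: block_nil; split=> //.
  by rewrite sb// /update eqxx.
- move=> s1 [s1l Is1] sb; apply: IH => //.
  exact: same_but_trans ss' sb.
Qed.

End Exec.

(** * The Random Facet algorithm *)

Section Weights.
Context (R : realType).

(* The i-th smallest element contributes at most y ^ i. *)
Lemma sum_rank_le (T : eqType) (q : T -> nat) (P : seq T) (y : R) :
  0 <= y < 1 ->
  \sum_(e <- P) y ^+ (count (fun e' => q e' <= q e)%N P) <= y / (1 - y).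
Proof.
move=> /andP[y0 y1].
suff H : \sum_(e <- P) y ^+ (count (fun e' => q e' <= q e)%N P) <=
    (y - y ^+ (size P).+1) / (1 - y).
  apply: le_trans H _; rewrite ler_pM2r ?invr_gt0 ?subr_gt0//.
  by rewrite gerBl exprn_ge0.
move: {2}(size P) (erefl (size P)) => n; elim: n P => [|n IH] P sP.
  by rewrite (size0nil sP) big_nil expr1 subrr mul0r.
have [m mP mmax] : exists2 m, m \in P & forall e, e \in P -> (q e <= q m)%N.
  case: P sP => [//|e0 P] _; elim: P e0 => [|e1 P IHP] e0.
    by exists e0; rewrite ?inE// => e; rewrite inE => /eqP->.
  have [m mP mmax] := IHP e1; have [le|lt] := leqP (q e0) (q m).
    exists m; first by rewrite inE mP orbT.
    by move=> e; rewrite inE => /orP[/eqP->//|/mmax].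
  exists e0; first by rewrite inE eqxx.
  move=> e; rewrite inE => /orP[/eqP->//|/mmax le]; exact: leq_trans le (ltnW lt).
have pP := perm_to_rem mP; have sP' : size (rem m P) = n by rewrite size_rem// sP.
rewrite (perm_big _ pP) big_cons /=.
have -> : count (fun e' => q e' <= q m)%N P = n.+1.
  by rewrite -sP; apply/eqP; rewrite -all_count; apply/allP => e /mmax.
have : \sum_(e <- rem m P) y ^+ (count (fun e' => q e' <= q e)%N P) <=
   (y - y ^+ n.+1) / (1 - y).
  rewrite -sP'; apply: le_trans (IH _ sP'); rewrite big_seq [leRHS]big_seq.
  apply: ler_sum => e _; rewrite ler_wiXn2l// 1?ltW//.
  by rewrite (permP pP) /= leq_addl.
have d0 : 1 - y != 0 by rewrite subr_eq0 gt_eqF.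
rewrite sP [y ^+ n.+2]exprS => le; apply: le_trans (_ : _ <= y ^+ n.+1 + (y - y ^+ n.+1) / (1 - y)) _.
  by rewrite lerD2l.
rewrite le_eqVlt; apply/orP; left; apply/eqP; move: (y ^+ n.+1) => z; by field.
Qed.

Definition facet_growth (s k : nat) : R :=
  (s.+1%:R) ^+ minn k (4 * s) * (k.+1%:R) ^+ (4 * s).+1.

Lemma facet_growth_ge1 s k : 1 <= facet_growth s k.
Proof. by rewrite /facet_growth mulr_ege1// exprn_ege1// ler1n. Qed.

(** Two regimes. While k is at most 4s, the bound [s / (s+1)] on [a] costs a factor s+1, paid by the
    first factor of [facet_growth]. Beyond 4s the bound [2s / k] is used: by Bernoulli (1 +
    1/k)^(4s) is at least 1 + 4s/k, and (1 + 4u)(1 - 2u) is at least 1 for u = s/k because 4u is at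
    most 1. The extra power in [(4 * s).+1] makes room for the additive 2. *)
Lemma facet_growth_step s k (a : R) : (0 < s)%N -> (0 < k)%N ->
  a <= s%:R / s.+1%:R -> a <= 2 * s%:R / k%:R ->
  facet_growth s k.-1 + 2 <= facet_growth s k * (1 - a).
Proof.
move=> s0; case: k => // k _ as1 ak; rewrite /facet_growth -[k.+1.-1]/k.
have s1 : 0 < s.+1%:R :> R by rewrite ltr0n.
have k1 : 0 < k.+1%:R :> R by rewrite ltr0n.
have [le|gt] := leqP k.+1 (4 * s).
  rewrite (minn_idPl (ltnW le)).
  have a1 : 1 / s.+1%:R <= 1 - a.
    have -> : 1 / s.+1%:R = 1 - s%:R / s.+1%:R :> R.
      by apply/eqP; rewrite -subr_eq0 -natr1; apply/eqP; field; rewrite natr1 gt_eqF.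
    by rewrite lerD2l lerN2.
  set A := s.+1%:R ^+ k; set Bk := k.+1%:R ^+ _; set Bk1 := k.+2%:R ^+ _.
  have A1 : 1 <= A by rewrite exprn_ege1// ler1n.
  have BB : Bk + 2 <= Bk1.
    rewrite /Bk /Bk1 -!natrX -natrD ler_nat.
    have : (0 < k.+1 ^ (4 * s))%N by rewrite expn_gt0.
    have : (k.+1 ^ (4 * s) <= k.+2 ^ (4 * s))%N by rewrite leq_exp2r; lia.
    have : (2 ^ 1 <= k.+2 ^ (4 * s))%N.
      by apply: (@leq_trans (2 ^ (4 * s))); [rewrite leq_exp2l | rewrite leq_exp2r]; lia.
    by rewrite !expnS; move: (k.+1 ^ _)%N (k.+2 ^ _)%N => u v; nia.
  have B0 : 0 <= Bk1 by rewrite exprn_ge0.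
  apply: le_trans (_ : A * (Bk + 2) <= _); first by nra.
  apply: le_trans (_ : A * Bk1 <= _); first by rewrite ler_wpM2l//; lra.
  rewrite exprS -/A; apply: le_trans (_ : s.+1%:R * A * Bk1 * (1 / s.+1%:R) <= _).
    by rewrite le_eqVlt; apply/orP; left; apply/eqP; field; rewrite gt_eqF.
  by rewrite ler_wpM2l// !mulr_ge0//; lra.
rewrite (minn_idPr _); last by rewrite -ltnS.
set A := s.+1%:R ^+ _.
have A1 : 1 <= A by rewrite exprn_ege1// ler1n.
have kp : 0 <= 1 - 2 * s%:R / k.+1%:R :> R.
  rewrite subr_ge0 ler_pdivrMr// mul1r -natrM ler_nat; lia.
have key : k.+1%:R ^+ (4 * s) <= k.+2%:R ^+ (4 * s) * (1 - 2 * s%:R / k.+1%:R) :> R.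
  have -> : k.+2%:R = k.+1%:R * (1 + k.+1%:R^-1) :> R.
    by rewrite mulrDr mulr1 mulfV ?gt_eqF// natr1.
  rewrite exprMn -[leRHS]mulrA; apply: ler_peMr; first by rewrite exprn_ge0.
  have bern : 1 + (4 * s)%:R / k.+1%:R <= (1 + k.+1%:R^-1) ^+ (4 * s) :> R.
    elim: (4 * s)%N => [|j IH]; first by rewrite mul0r addr0 expr0.
    rewrite exprSr; have i0 : 0 <= k.+1%:R^-1 :> R by rewrite invr_ge0.
    apply: le_trans (_ : (1 + j%:R / k.+1%:R) * (1 + k.+1%:R^-1) <= _).
      have : 0 <= j%:R :> R by [].
      by rewrite -natr1; move: (k.+1%:R^-1) i0 (j%:R) => u u0 v v0; nra.
    by rewrite ler_wpM2r// addr_ge0.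
  apply: le_trans (_ : (1 + (4 * s)%:R / k.+1%:R) * (1 - 2 * s%:R / k.+1%:R) <= _); last first.
    by rewrite ler_wpM2r.
  have : 4 * s%:R / k.+1%:R <= 1 :> R.
    by rewrite ler_pdivrMr// mul1r -natrM ler_nat; exact: ltnW.
  have : 0 <= s%:R / k.+1%:R :> R by rewrite divr_ge0.
  rewrite natrM -!mulrA; move: (s%:R / k.+1%:R) => u u0 u1; nra.
set Bk := k.+1%:R ^+ _ in key; set Bk1 := k.+2%:R ^+ _ in key.
have Bk2 : 2 <= Bk.
  rewrite /Bk -natrX ler_nat.
  by apply: leq_trans (_ : k.+1 ^ 1 <= _)%N; [rewrite expn1; lia | rewrite leq_exp2l; lia].
have Bk10 : 0 <= Bk1 by rewrite exprn_ge0.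
rewrite !exprS -/Bk -/Bk1.
apply: le_trans (_ : A * (k.+2%:R * Bk1) * (1 - 2 * s%:R / k.+1%:R) <= _); last first.
  apply: ler_wpM2l; last by rewrite lerD2l lerN2.
  by rewrite !mulr_ge0// (le_trans _ A1).
rewrite -!mulrA; apply: le_trans (_ : A * (k.+2%:R * Bk) <= _); last first.
  rewrite ler_wpM2l ?(le_trans _ A1)// ler_wpM2l//.
  by move: key; rewrite mulrA.
rewrite -[k.+2%:R]natr1 mulrDl mul1r mulrDr lerD2l; nra.
Qed.

End Weights.

(** One inductive step of the analysis, with [b] the contribution of the hidden dimension and [a]
    the average shrinking after the switch. The two separate copies of [B], for a draw and for a
    scan, are the 2 in [u + 2]. *)
Lemma facet_total (R : realType) (b B u v a r : R) : 1 <= b -> 0 <= B ->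
  u + 2 <= v * (1 - a) ->
  B + (b * u * B + B + r + b * v * B * a) <= b * v * B + r.
Proof.
move=> b1 B0 uv.
have h1 : b * B * (u + 2) <= b * B * (v * (1 - a)).
  by rewrite ler_wpM2l// mulr_ge0// (le_trans _ b1).
have h2 : B <= b * B by rewrite ler_peMl.
nra.
Qed.

(** * Abstract analysis of Random Facet through the hidden dimension *)

Section RandomFacet.
Context (R : realType) (X E : finType) (src : E -> X).
Local Notation strat := {ffun X -> E}.
Implicit Types (rho zeta : strat) (H : {set E}) (P L : seq E).

Definition strat_in H rho : bool := [forall x, (rho x \in H) && (src (rho x) == x)].

Definition unused H rho P : Prop :=
  uniq P /\ forall e, (e \in P) = (e \in H) && (rho (src e) != e).

Definition use rho (e : E) : strat := [ffun x => if x == src e then e else rho x].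

Lemma strat_inP H rho :
  reflect (forall x, rho x \in H /\ src (rho x) = x) (strat_in H rho).
Proof.
apply: (iffP forallP) => h x; first by have /andP[? /eqP] := h x.
by have [-> ->] := h x; rewrite eqxx.
Qed.

Lemma strat_in_sub H H' rho : H \subset H' -> strat_in H rho -> strat_in H' rho.
Proof.
move=> /fintype.subsetP sub /strat_inP h; apply/strat_inP => x.
by have [/sub ? ?] := h x.
Qed.

Lemma strat_in_use H rho e : strat_in H rho -> e \in H -> strat_in H (use rho e).
Proof.
move=> /strat_inP h eH; apply/strat_inP => x; rewrite ffunE.
by case: eqP => [->|//]; split.
Qed.

Lemma size_unused H rho P : strat_in H rho -> unused H rho P ->
  (size P + #|X| = #|H|)%N.
Proof.
move=> /strat_inP h [uP memP].
have inj : injective rho by move=> x y /(congr1 src); rewrite (h x).2 (h y).2.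
rewrite -(card_uniqP uP) -(card_codom inj) -cardUI.
rewrite [X in (_ + X)%N]eq_card0 ?addn0 => [|e]; last first.
  rewrite !inE memP; apply/negP => /andP[/andP[_ /negP ne] /codomP[x e_]].
  by apply: ne; rewrite e_ (h x).2.
apply: eq_card => e; rewrite !inE memP; apply/orP/idP.
  by case=> [/andP[]//|/codomP[x ->]]; exact: (h x).1.
move=> eH; have [<-|ne] := eqVneq (rho (src e)) e; last by left; rewrite eH.
by right; rewrite codom_f.
Qed.

Lemma unused_perm H rho P Q : perm_eq P Q -> unused H rho P -> unused H rho Q.
Proof.
move=> pq [uP mP]; split=> [|e]; first by rewrite -(perm_uniq pq).
by rewrite -(perm_mem pq).
Qed.

Lemma unused_use H rho e Q : strat_in H rho -> unused H rho (e :: Q) ->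
  unused H (use rho e) (rho (src e) :: Q).
Proof.
move=> /strat_inP v [/= /andP[eQ uQ] mQ].
have [rH rs] := v (src e).
have memQ e' : (e' \in Q) = [&& e' \in H, rho (src e') != e' & e' != e].
  have := mQ e'; rewrite inE; case: eqVneq => [->|_] /=; last by rewrite andbT.
  by rewrite (negbTE eQ) !andbF.
have /andP[eH ne] : (e \in H) && (rho (src e) != e) by rewrite -mQ inE eqxx.
split; first by rewrite /= uQ memQ rs eqxx /= andbF.
move=> e'; rewrite inE memQ ffunE.
have [se|nse] := eqVneq (src e') (src e).
  rewrite se [e == e']eq_sym; have [->|e'e] := eqVneq e' (rho (src e)).
    by rewrite rH ne.
  by [].
have -> : (e' == rho (src e)) = false by apply: contraNF nse => /eqP ->; rewrite rs.
by have -> : (e' != e) by [apply: contraNneq nse => ->]; rewrite andbT.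
Qed.

Section Analysis.
Context (Hmax : {set E}) (f : strat -> nat) (imp : strat -> E -> bool).
Hypothesis imp_lt : forall rho e, strat_in Hmax rho -> e \in Hmax ->
  imp rho e -> (f rho < f (use rho e))%N.
Hypothesis imp_opt : forall H rho, H \subset Hmax -> strat_in H rho ->
  (forall e, e \in H -> rho (src e) != e -> ~~ imp rho e) ->
  forall zeta, strat_in H zeta -> (f zeta <= f rho)%N.

(* The number of its elements is the hidden dimension of Matousek, Sharir and
   Welzl. *)
Definition free H rho : {set X} :=
  [set x | [exists zeta, [&& strat_in H zeta, f rho <= f zeta & zeta x != rho x]%N]].

Definition opt H : nat := \max_(zeta | strat_in H zeta) f zeta.

(* All strategies of H that are at least as good as the new one use every edge
   e' such that H without e' is at most as good as H without e. *)
Lemma free_use H rho rho' P e : strat_in H rho -> unused H rho P -> e \in P ->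
  strat_in (H :\ e) rho' -> f rho' = opt (H :\ e) ->
  (f rho' < f (use rho' e))%N ->
  (#|free H (use rho' e)| + count (fun e' => opt (H :\ e') <= opt (H :\ e)) P
   <= #|free H rho|)%N.
Proof.
move=> vr [uP memP] eP vr' fo flt.
have eH : e \in H by move: eP; rewrite memP => /andP[].
have vr'' : strat_in H (use rho' e).
  by apply: strat_in_use => //; apply: strat_in_sub vr'; rewrite subD1set.
have frr : (f rho <= f rho')%N.
  rewrite fo; apply: (leq_bigmax_cond (F := f)); apply/strat_inP => x.
  have [rH rs] := strat_inP _ _ vr x; rewrite !inE rH rs; split=> //.
  rewrite andbT; apply/negP => /eqP re.
  by move: eP; rewrite memP -re rs re eqxx andbF.
have forced zeta e' : strat_in H zeta -> (f (use rho' e) <= f zeta)%N ->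
    e' \in P -> (opt (H :\ e') <= opt (H :\ e))%N -> zeta (src e') = e'.
  move=> vz fz e'P le; apply/eqP/negP => /negP ne.
  have : (f zeta <= opt (H :\ e'))%N.
    apply: (leq_bigmax_cond (F := f)); apply/strat_inP => x.
    have [zH zs] := strat_inP _ _ vz x; rewrite !inE zH zs; split=> //.
    rewrite andbT; apply: contraNneq ne => <-; by rewrite zs.
  by move=> /leq_trans/(_ le); rewrite -fo leqNgt => /negP; apply; exact: leq_trans flt fz.
set Q := [seq e' <- P | (opt (H :\ e') <= opt (H :\ e))%N].
have QP e' : e' \in Q -> e' \in P /\ (opt (H :\ e') <= opt (H :\ e))%N.
  by rewrite mem_filter => /andP[].
have usrc e' : e' \in Q -> use rho' e (src e') = e'.
  by move=> /QP[e'P le]; apply: forced.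
rewrite -size_filter -/Q -(size_map src).
have uQ : uniq [seq src e' | e' <- Q].
  rewrite map_inj_in_uniq ?filter_uniq// => e1 e2 /usrc e1E /usrc e2E e12.
  by rewrite -e1E e12 e2E.
rewrite -(card_uniqP uQ) -cardUI [X in (_ + X)%N]eq_card0 ?addn0 => [|x]; last first.
  rewrite !inE; apply/negP => /andP[/existsP[zeta /and3P[vz fz /eqP ne]]].
  move=> /mapP[e' e'Q xE]; apply: ne; rewrite xE usrc//.
  by have [e'P le] := QP _ e'Q; apply: forced.
apply/subset_leq_card/fintype.subsetP => x; rewrite !inE => /orP[|/mapP[e' e'Q ->]].
  move=> /existsP[zeta /and3P[vz fz ne]]; apply/existsP.
  (* If [zeta] agrees with [rho] at [x], then the new strategy, which differs from [zeta] there, is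
     itself the witness. *)
  have [e1|ne1] := eqVneq (zeta x) (rho x).
    exists (use rho' e); rewrite vr'' -e1 eq_sym ne andbT /=.
    exact: leq_trans frr (ltnW flt).
  exists zeta; rewrite vz ne1 andbT /=.
  exact: leq_trans frr (leq_trans (ltnW flt) fz).
apply/existsP; exists (use rho' e); rewrite vr'' usrc//.
have [e'P _] := QP _ e'Q; move: e'P; rewrite memP eq_sym => /andP[_ ->].
rewrite andbT /=; exact: leq_trans frr (ltnW flt).
Qed.

(** The machine is kept abstract so that the analysis serves both players. [ShufC rho P L] describes
    states with pool [P] still to be ordered and stack [L], [ScanC rho L] those about to look for an
    improving edge in [L], and [B] bounds the cost of one draw or one scan. *)
Context (C : Type) (G : C -> R -> Prop) (B : R) (s : nat).
Context (ShufC : strat -> seq E -> seq E -> C -> Prop).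
Context (ScanC : strat -> seq E -> C -> Prop).
Hypothesis G_le : forall c r r', r <= r' -> G c r -> G c r'.
Hypothesis B0 : 0 <= B.
Hypothesis s_gt0 : (0 < s)%N.
Hypothesis shuf_nil : forall rho L c r, ShufC rho [::] L c ->
  (forall c', ScanC rho L c' -> G c' r) -> G c (B + r).
Hypothesis shuf_cons : forall rho P L c (cost : E -> R),
  uniq P -> P != [::] -> ShufC rho P L c ->
  (forall e Q c', e \in P -> perm_eq (e :: Q) P -> ShufC rho Q (e :: L) c' ->
    G c' (cost e)) ->
  exists w : E -> R, [/\ forall e, e \in P -> 0 <= w e,
    \sum_(e <- P) w e = 1,
    forall j e, (2 ^ j <= size P)%N -> e \in P -> w e <= (2 ^+ j)^-1 &
    G c (B + \sum_(e <- P) w e * cost e)].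
Hypothesis scan_found : forall rho P e L c r, ScanC rho (P ++ e :: L) c ->
  ~~ has (imp rho) P -> imp rho e ->
  (forall c', ShufC (use rho e) (rho (src e) :: rev P) L c' -> G c' r) ->
  G c (B + r).

Local Notation x := (s.+1%:R / s%:R : R).
Local Notation y := (s%:R / s.+1%:R : R).

(** Outer induction on the pool size, inner induction on the hidden dimension. The stack [L] of
    pending calls is arbitrary, and the last premise is their continuation: it takes over once the
    edges of the present call contain no improving one. *)
Theorem random_facet H rho P L c r : H \subset Hmax -> strat_in H rho ->
  unused H rho P -> ShufC rho P L c ->
  (forall rho' P' c', strat_in H rho' -> unused H rho' P' ->
    ~~ has (imp rho') P' -> ScanC rho' (P' ++ L) c' -> G c' r) ->
  G c (x ^+ #|free H rho| * facet_growth R s (size P) * B + r).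
Proof.
have sR : 0 < s%:R :> R by rewrite ltr0n.
have s1R : 0 < s.+1%:R :> R by rewrite ltr0n.
have x1 : 1 <= x by rewrite ler_pdivlMr// mul1r ler_nat.
have y0 : 0 <= y by rewrite divr_ge0.
have y1 : y < 1 by rewrite ltr_pdivrMr// mul1r ltr_nat.
have ysum : y / (1 - y) = s%:R.
  have -> : 1 - y = s.+1%:R^-1.
    by rewrite -natr1; field; rewrite natr1 gt_eqF.
  by rewrite invrK mulfVK// gt_eqF.
have xy : x * y = 1 by rewrite mulrA mulfVK ?gt_eqF// mulfV ?gt_eqF.
move: {2}(size P) (erefl (size P)) => k.
elim: k H rho P L c r => [|k IHk] H rho P L c r.
  move=> /size0nil -> Hsub vr uP sh final; apply: (@G_le _ (B + r)).
    rewrite lerD2r ler_peMl// mulr_ege1// ?exprn_ege1//; exact: facet_growth_ge1.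
  by apply: shuf_nil sh _ => c' sc; apply: (final rho [::]).
move: {2}#|free H rho| (leqnn #|free H rho|) => d.
elim/ltn_ind: d rho P L c r => d IHd rho P L c r led sP Hsub vr uP sh final.
have [uniqP memP] := uP.
pose i e := count (fun e' => opt (H :\ e') <= opt (H :\ e))%N P.
pose base := x ^+ #|free H rho|.
have base1 : 1 <= base by exact: exprn_ege1.
pose g := facet_growth R s.
have g1 j : 1 <= g j by exact: facet_growth_ge1.
(* The cost when [e] is drawn: the call without [e], then one scan, then a restart whose hidden
   dimension has dropped by at least [i e]. As [x * y = 1], that drop multiplies the bound by
   [y ^+ i e]. *)
pose cost e := base * g k * B + (base * y ^+ i e * g k.+1 * B + B + r).
have [|e Q c' eP pQ sh'|w [w0 w1 wj Gw]] := shuf_cons (cost := cost) uniqP _ sh.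
- by rewrite -size_eq0 sP.
- have eH : e \in H by move: eP; rewrite memP => /andP[].
  have He : H :\ e \subset Hmax by rewrite (fintype.subset_trans _ Hsub)// subD1set.
  have vre : strat_in (H :\ e) rho.
    apply/strat_inP => z; have [rH rs] := strat_inP _ _ vr z.
    rewrite !inE rH rs; split=> //; rewrite andbT; apply/negP => /eqP re.
    by move: eP; rewrite memP -re rs re eqxx andbF.
  have uQ : unused (H :\ e) rho Q.
    have uQ : uniq (e :: Q) by rewrite (perm_uniq pQ).
    split=> [|e']; first by case/andP: uQ.
    rewrite !inE; have := perm_mem pQ e'; rewrite inE memP.
    have [->|ne] /= := eqVneq e' e; last by move=> <-.
    by case/andP: uQ => /negbTE ->.
  have freeS : (#|free (H :\ e) rho| <= #|free H rho|)%N.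
    apply/subset_leq_card/fintype.subsetP => z; rewrite !inE => /existsP[zeta /and3P[vz ? ?]].
    apply/existsP; exists zeta; apply/and3P; split=> //.
    by apply: strat_in_sub vz; rewrite subD1set.
  have sQ : size Q = k by have := perm_size pQ; rewrite sP => -[].
  pose r' := base * y ^+ i e * g k.+1 * B + B + r.
  apply: (@G_le _ (x ^+ #|free (H :\ e) rho| * g (size Q) * B + r')).
    rewrite sQ lerD2r ler_wpM2r// ler_wpM2r//; first exact: le_trans (g1 k).
    exact: ler_weXn2l.
  apply: IHk sh' _ => // rho' P' c'' vr' uP' noimp scan'.
  have pos : 0 <= base * y ^+ i e * g k.+1 * B.
    by rewrite !mulr_ge0// ?exprn_ge0 ?(le_trans _ base1)// (le_trans _ (g1 _)).
  have vr'H : strat_in H rho' by apply: strat_in_sub vr'; rewrite subD1set.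
  have ue : unused H rho' (e :: P').
    have [uniqP' memP'] := uP'; split.
      by rewrite /= uniqP' memP' !inE eqxx.
    move=> e'; rewrite inE memP' !inE; have [->|//] := eqVneq e' e.
    rewrite eH; apply/esym/negP => /eqP e1.
    by have [] := strat_inP _ _ vr' (src e); rewrite e1 !inE eqxx.
  have [ie|ne] := boolP (imp rho' e); last first.
    apply: (@G_le _ r); first by rewrite /r'; move: pos B0; lra.
    apply: (final rho' (rcons P' e)) => //; last first.
    - by rewrite cat_rcons.
    - by rewrite has_rcons negb_or ne.
    by apply: unused_perm ue; rewrite perm_sym perm_rcons.
  have fo : f rho' = opt (H :\ e).
    apply/eqP; rewrite eqn_leq; apply/andP; split.
      exact: (leq_bigmax_cond (F := f)).
    apply/bigmax_leqP => zeta vz; apply: (imp_opt He vr') => // e' e'H ne.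
    by move: noimp; apply: contra => ie'; apply/hasP; exists e' => //; rewrite uP'.2 e'H.
  have flt : (f rho' < f (use rho' e))%N.
    by apply: imp_lt => //; [exact: strat_in_sub vr'H | exact: (fintype.subsetP Hsub)].
  have dim := free_use vr uP eP vr' fo flt; rewrite -/(i e) in dim.
  have i1 : (0 < i e)%N by rewrite /i -has_count; apply/hasP; exists e.
  apply: (@G_le _ (B + (x ^+ #|free H (use rho' e)| * g k.+1 * B + r))).
    have b0 : x ^+ #|free H (use rho' e)| <= base * y ^+ i e.
      rewrite /base -(subnK dim) !exprD -!mulrA -exprMn xy expr1n mulr1.
      by apply: ler_peMl; [apply: exprn_ge0; apply: le_trans x1 | exact: exprn_ege1].
    have : x ^+ #|free H (use rho' e)| * g k.+1 * B <= base * y ^+ i e * g k.+1 * B.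
      by rewrite ler_wpM2r// ler_wpM2r// (le_trans _ (g1 _)).
    by rewrite /r'; move: (_ * B) (_ * B) => u v; lra.
  apply: scan_found scan' noimp ie _ => c3 sh3.
  have vu : strat_in H (use rho' e) by apply: strat_in_use.
  have uu : unused H (use rho' e) (rho' (src e) :: rev P').
    by apply: unused_perm (unused_use vr'H ue); rewrite perm_cons perm_sym perm_rev.
  (* The pool size is the same for all strategies of [H], namely the number of edges of [H] minus
     the number of nodes. *)
  have su : size (rho' (src e) :: rev P') = k.+1.
    apply/eqP; rewrite -(eqn_add2r #|X|) (size_unused vu uu) -sP.
    by rewrite (size_unused vr uP).
  have lt : (#|free H (use rho' e)| < d)%N.
    apply: leq_trans led; apply: leq_trans dim.
    by rewrite -[X in (X < _)%N]addn0 ltn_add2l.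
  by rewrite -su; apply: (IHd _ lt _ _ _ _ _ (leqnn _)) sh3 _.
- apply: G_le Gw; rewrite sP -/(g k.+1).
  have -> : \sum_(e <- P) w e * cost e = base * g k * B + B + r +
      base * g k.+1 * B * \sum_(e <- P) w e * y ^+ i e.
    transitivity (\sum_(e <- P) (w e * (base * g k * B + B + r) +
        base * g k.+1 * B * (w e * y ^+ i e))).
      by apply: eq_bigr => e _; rewrite /cost; ring.
    by rewrite big_split /= -mulr_suml w1 mul1r -mulr_sumr.
  set a := \sum_(e <- P) _.
  have iP e : e \in P -> (0 < i e)%N by rewrite /i -has_count => eP; apply/hasP; exists e.
  (* Every [i e] is at least 1, as [e] counts itself, so the average is at most [y]. *)
  have a1 : a <= y.
    have yE : y = \sum_(e <- P) w e * y by rewrite -mulr_suml w1 mul1r.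
    rewrite [leRHS]yE /a big_seq [leRHS]big_seq.
    apply: ler_sum => e eP; rewrite ler_wpM2l ?w0//.
    by rewrite -[leRHS]expr1 ler_wiXn2l// ?ltW// iP.
  (* Each weight is at most [2 / k.+1], and the powers of [y] sum to at most [y / (1 - y) = s]. *)
  have a2 : a <= 2 * s%:R / k.+1%:R.
    pose j := trunc_log 2 (size P).
    have /andP[j1 j2] : (2 ^ j <= size P < 2 ^ j.+1)%N.
      by apply/andP; split; [apply: trunc_logP | apply: trunc_log_ltn]; rewrite // sP.
    apply: le_trans (_ : (2 ^+ j)^-1 * s%:R <= _).
      rewrite -ysum /a; apply: le_trans (_ : (2 ^+ j)^-1 * \sum_(e <- P) y ^+ i e <= _).
        rewrite mulr_sumr big_seq [leRHS]big_seq; apply: ler_sum => e eP.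
        by rewrite ler_wpM2r ?exprn_ge0// wj.
      by rewrite ler_wpM2l ?invr_ge0 ?exprn_ge0// /i (sum_rank_le (fun e => opt (H :\ e)))// y0.
    rewrite mulrAC ler_wpM2r// ler_pdivlMr ?ltr0n// mulrC ler_pdivrMr ?exprn_gt0//.
    by rewrite -natrX -natrM ler_nat -sP -expnS ltnW.
  have step := facet_growth_step s_gt0 (ltn0Sn k) a1 a2; rewrite -/(g k.+1) -/(g k) in step.
  by apply: facet_total step.
Qed.

End Analysis.
End RandomFacet.

(** * The program *)

Local Notation vIO := 0%N.
Local Notation vFlags := 1%N.
Local Notation vRho := 2%N.
Local Notation vPool := 3%N.
Local Notation vStack := 4%N.
Local Notation vLoop := 5%N.
Local Notation vSave := 6%N.
Local Notation vMinPool := 7%N.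
Local Notation vIdx := 9%N.
Local Notation vLst := 10%N.
Local Notation vItem := 11%N.
Local Notation vAcc := 12%N.
Local Notation vEq1 := 13%N.
Local Notation vEq2 := 14%N.
Local Notation vEq := 15%N.
Local Notation vCur := 16%N.
Local Notation vStep := 17%N.
Local Notation vU := 18%N.
Local Notation vV := 19%N.
Local Notation vUrev := 20%N.
Local Notation vVrev := 21%N.
Local Notation vCount := 22%N.
Local Notation vTick := 23%N.
Local Notation vBase := 24%N.
Local Notation vGo := 25%N.
Local Notation vEdge := 26%N.
Local Notation vRes := 27%N.
Local Notation vU0 := 28%N.
Local Notation vV0 := 29%N.
Local Notation vScan := 30%N.
Local Notation vPick := 31%N.
Local Notation vLeft := 32%N.
Local Notation vHalf0 := 33%N.
Local Notation vHalf1 := 34%N.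
Local Notation vTmp := 35%N.
Local Notation vCoin := 36%N.
Local Notation vInit := 37%N.

Definition etrue : expr := ECons ENil ENil.

Definition reverse_onto (src dst : nat) : cmd :=
  foreach vItem src (Assign dst (ECons (Var vItem) (Var dst))).

(* Moves the first vIdx elements of vLst, reversed, to vAcc. *)
Definition seek : cmd :=
  block [:: Assign vAcc ENil;
    foreach vItem vIdx
      (block [:: Assign vAcc (ECons (EHd (Var vLst)) (Var vAcc));
                 Assign vLst (ETl (Var vLst))])].

Definition test_equal : cmd :=
  block [:: Assign vEq etrue;
    foreach vItem vEq1
      (block [:: If (Var vEq2) Skip (Assign vEq ENil);
                 Assign vEq2 (ETl (Var vEq2))]);
    If (Var vEq2) (Assign vEq ENil) Skip].

Definition advance : cmd :=
  block [:: Assign vIdx (Var vCur); Assign vLst (Var vRho); seek;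
    Assign vStep (EHd (Var vLst)); Assign vCur (ETl (ETl (Var vStep)))].

Definition step_label : expr := EHd (ETl (Var vStep)).

(* The play from vCur is the word vU followed by the repetition of vV. *)
Definition compute_play : cmd :=
  block [:: Assign vUrev ENil; Assign vCount (Var vRho);
    foreach vTick vCount
      (block [:: advance; Assign vUrev (ECons step_label (Var vUrev))]);
    Assign vBase (Var vCur); Assign vVrev ENil; Assign vGo etrue;
    While (Var vGo)
      (block [:: advance; Assign vVrev (ECons step_label (Var vVrev));
        Assign vEq1 (Var vCur); Assign vEq2 (Var vBase); test_equal;
        If (Var vEq) (Assign vGo ENil) Skip]);
    Assign vU ENil; reverse_onto vUrev vU;
    Assign vV ENil; reverse_onto vVrev vV].

Definition test_edge : cmd :=
  block [:: Assign vCur (EHd (Var vEdge)); compute_play;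
    Assign vU0 (Var vU); Assign vV0 (Var vV);
    Assign vCur (ETl (ETl (Var vEdge))); compute_play;
    Assign vU (ECons (EHd (ETl (Var vEdge))) (Var vU));
    Assign vIdx (EHd (Var vEdge)); Assign vLst (Var vFlags); seek;
    If (EHd (Var vLst))
      (Query vRes (Var vU) (Var vV) (Var vU0) (Var vV0))
      (Query vRes (Var vU0) (Var vV0) (Var vU) (Var vV))].

Definition replace_found : cmd :=
  block [:: Assign vLst (ECons (Var vEdge) (ETl (Var vLst)));
    reverse_onto vAcc vLst; Assign vRho (Var vLst)].

Definition scan : cmd :=
  block [:: Assign vScan (Var vStack); Assign vStack ENil;
    Assign vLoop ENil;
    While (Var vScan)
      (block [:: Assign vEdge (EHd (Var vScan));
        Assign vScan (ETl (Var vScan)); test_edge;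
        If (Var vRes)
          (block [:: Assign vIdx (EHd (Var vEdge));
            Assign vLst (Var vRho); seek;
            Assign vPool (ECons (EHd (Var vLst)) (Var vPool));
            replace_found; Assign vStack (Var vScan);
            Assign vScan ENil; Assign vLoop etrue])
          (Assign vPool (ECons (Var vEdge) (Var vPool)))])].

(** Exchanging the halves after each element deals the elements out alternately, so the lengths
    differ by at most one without any counting. *)
Definition halve : cmd :=
  block [:: Assign vHalf0 ENil; Assign vHalf1 ENil;
    foreach vItem vPick
      (block [:: Assign vTmp (ECons (Var vItem) (Var vHalf0));
        Assign vHalf0 (Var vHalf1); Assign vHalf1 (Var vTmp)])].

Definition keep_half : cmd :=
  block [:: If (Var vCoin)
      (block [:: Assign vPick (Var vHalf0); Assign vHalf0 (Var vHalf1)])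
      (Assign vPick (Var vHalf1));
    reverse_onto vHalf0 vLeft].

(* Each of the k candidates survives with probability at most
   2 ^ - floor(log2 k) < 2 / k, and no rejection sampling is needed. *)
Definition pick : cmd :=
  While (ETl (Var vPick)) (block [:: halve; Toss vCoin; keep_half]).

Definition shuffle : cmd :=
  While (Var vPool)
    (block [:: Assign vPick (Var vPool); Assign vLeft ENil; pick;
      Assign vStack (ECons (EHd (Var vPick)) (Var vStack));
      Assign vPool (Var vLeft)]).

(** For Min, [evaluate] does nothing, since the joint strategy in the store is what its edges are
    tested against. For Max it must first bring in a best response. *)
Definition improve (evaluate : cmd) : cmd :=
  While (Var vLoop) (block [:: shuffle; evaluate; scan]).

(* Both players use the registers vPool, vStack and vLoop: those of Max are
   saved during the computation of a best response of Min. *)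
Definition best_response : cmd :=
  block [:: Assign vSave (Var vStack); Assign vPool (Var vMinPool);
    Assign vStack ENil; Assign vLoop etrue; improve Skip;
    Assign vMinPool (Var vPool); Assign vPool ENil;
    Assign vStack (Var vSave)].

(** [vRho] starts as a list of empty slots. The first listed edge of each node fills its slot, and
    every later one goes to the pool of the owner of its source. *)
Definition initialize : cmd :=
  block [:: Assign vFlags (EHd (Var vIO)); Assign vInit (Var vFlags);
    foreach vItem vInit (Assign vRho (ECons ENil (Var vRho)));
    Assign vInit (ETl (Var vIO));
    foreach vEdge vInit
      (block [:: Assign vIdx (EHd (Var vEdge)); Assign vLst (Var vRho); seek;
        If (EHd (Var vLst))
          (block [:: Assign vIdx (EHd (Var vEdge)); Assign vLst (Var vFlags);
            seek;
            If (EHd (Var vLst))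
              (Assign vPool (ECons (Var vEdge) (Var vPool)))
              (Assign vMinPool (ECons (Var vEdge) (Var vMinPool)))])
          replace_found])].

Definition synthesis_program : cmd :=
  block [:: initialize; Assign vLoop etrue;
    improve best_response; Assign vIO (Var vRho)].

(** * Correctness and cost of the program fragments *)

Section Fragments.
Context (O : oracle) (query_ok : tree * tree * tree * tree -> Prop).
Local Notation triple := (triple O query_ok).

Lemma reverse_onto_triple s (src dst : nat) ts us :
  src != vItem -> dst != vItem -> src != dst ->
  s src = tree_of_seq ts -> s dst = tree_of_seq us ->
  triple s (reverse_onto src dst) (size ts * 8).+1
    (fun s' => s' dst = tree_of_seq (catrev ts us)).
Proof.
move=> si di sd ssrc sdst.
apply: (triple_weaken (foreach_triple (enc := id) (xs := ts) (t := 1)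
  (I := fun ys s' => exists2 vs, s' dst = tree_of_seq vs & catrev ys vs = catrev ts us)
  _ _ _ _ _)).
- by rewrite eq_sym.
- by rewrite /= inE.
- move=> y ys s' _ [vs s'd e]; apply: triple_assign.
  have ds : (dst == src) = false by rewrite eq_sym (negbTE sd).
  have is_ : (vItem == src) = false by rewrite eq_sym (negbTE si).
  exists (y :: vs) => //; rewrite /= /update eqxx ds is_ (negbTE di) eqxx.
  by rewrite s'd.
- by rewrite map_id.
- by exists us.
- by move=> s' [_ [vs -> <-]].
Qed.

(** A numeral is also the list of that many units, so [foreach] doubles as a counting loop. *)
Lemma tree_of_natE i : tree_of_nat i = tree_of_seq [seq Nil | _ <- nseq i tt].
Proof. by elim: i => //= i ->. Qed.

Lemma seek_triple s i ts :
  s vIdx = tree_of_nat i -> s vLst = tree_of_seq ts -> (i <= size ts)%N ->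
  triple s seek (i * 12 + 5)
    (fun s' => s' vLst = tree_of_seq (drop i ts) /\
               s' vAcc = tree_of_seq (rev (take i ts))).
Proof.
move=> si sl le; eapply triple_le; last first.
eapply block_assign; eapply block_call.
- have := foreach_triple (O := O) (query_ok := query_ok) (x := vItem) (l := vIdx) (enc := fun _ => Nil) (xs := nseq i tt) (t := 5)
   (body := block [:: Assign vAcc (ECons (EHd (Var vLst)) (Var vAcc));
                 Assign vLst (ETl (Var vLst))])
   (s := update s vAcc Nil)
   (I := fun ys s' => exists pre post, [/\ ts = pre ++ post, (size pre + size ys = i)%N,
     s' vLst = tree_of_seq post & s' vAcc = tree_of_seq (rev pre)]).
  rewrite size_nseq; apply => //.
  + move=> y ys s' _ [pre [post [tsE szE s'l s'a]]].
    case: post => [|d post] in tsE s'l.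
      move: le; rewrite tsE cats0 -szE /=; lia.
    apply: block_assign; apply: block_assign; apply: block_nil.
    exists (rcons pre d), post; rewrite /update /= s'l s'a /= size_rcons rev_rcons.
    by split; rewrite ?cat_rcons// -szE /= addnS.
  + by rewrite -tree_of_natE.
  + by exists [::], ts.
- move=> s1 [_ [pre [post [-> szE e e']]]] _; eapply block_nil.
  by rewrite e e'; rewrite addn0 in szE; rewrite drop_size_cat// take_size_cat.
- lia.
Qed.

Lemma test_equal_triple s i j :
  s vEq1 = tree_of_nat i -> s vEq2 = tree_of_nat j ->
  triple s test_equal (i * 13 + 8) (fun s' => s' vEq = tree_of_bool (i == j)).
Proof.
move=> s1 s2; eapply triple_le; last first.
eapply block_assign; eapply block_call.
- have := foreach_triple (O := O) (query_ok := query_ok) (x := vItem)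
   (l := vEq1) (enc := fun _ => Nil) (xs := nseq i tt) (t := 6)
   (body := block [:: If (Var vEq2) Skip (Assign vEq ENil);
                 Assign vEq2 (ETl (Var vEq2))])
   (s := update s vEq (eval s etrue))
   (* After k rounds [vEq2] holds the truncated difference j - k and [vEq] tells whether k is at
      most j; what is left of [vEq2] at the end detects i < j. *)
   (I := fun ys s' => s' vEq2 = tree_of_nat (j - (i - size ys)) /\
      s' vEq = tree_of_bool (i - size ys <= j)%N /\ (size ys <= i)%N).
  rewrite size_nseq; apply => //.
  + move=> y ys s' _ /=; set k := (i - (size ys).+1)%N => -[e2 [e le]].
    have kE : (i - size ys = k.+1)%N by rewrite /k; lia.
    rewrite kE.
    apply: (@block_call _ _ _ _ _ 2 3 (fun s'' =>
      s'' vEq2 = tree_of_nat (j - k) /\ s'' vEq = tree_of_bool (k < j)%N)).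
      apply: triple_if; rewrite /= /update /= e2.
      case: (ltnP k j) => [lt|ge].
        rewrite -(subnSK lt) /=; apply: triple_skip => /=.
        by rewrite e2 e (ltnW lt) -(subnSK lt).
      have jk : (j - k = 0)%N by lia.
      by rewrite jk; apply: triple_assign; rewrite /update /= e2 jk.
    move=> s1' [e2' e'] _; apply: block_assign; apply: block_nil.
    rewrite /update /= e2' e'; split; last by split=> //; lia.
    by rewrite subnS; case: (j - k)%N.
  + by rewrite -tree_of_natE.
  + by rewrite /update /= subnn subn0 leqnn.
- move=> s3 [_ [/= e2 [e _]]] _; eapply (@block_last _ _ _ _ 2).
  apply: triple_if; rewrite /= e2 subn0.
  case: (ltnP i j) => [lt|ge].
    rewrite -(subnSK lt) /=; apply: triple_assign.
    by rewrite /update /= (ltn_eqF lt).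
  rewrite (eqP ge); apply: triple_skip; rewrite e subn0; congr tree_of_bool; lia.
- lia.
Qed.

Definition order_of (A : finType) (G : game_graph A) : nat := #|node G|.

Section Plays.
Context (A : finType) (G : game_graph A) (rho : node G -> arrow G).
Local Notation N := (order_of G).

Definition tree_of_joint : tree :=
  tree_of_seq [seq tree_of_arrow (rho x) | x <- enum (node G)].

Definition next (x : node G) : node G := target (rho x).
Definition out (x : node G) : A := label (rho x).

Lemma hd_drop_enum (g : node G -> tree) x :
  hd (tree_of_seq (drop (enum_rank x) [seq g y | y <- enum (node G)])) = g x.
Proof.
rewrite (drop_nth Nil) /=; last by rewrite size_map -cardE ltn_ord.
by rewrite (nth_map x) ?nth_enum_rank// -cardE ltn_ord.
Qed.

Lemma enum_rank_lt (x : node G) : (enum_rank x < N)%N.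
Proof. exact: ltn_ord. Qed.

Lemma size_enum_nodes : size (enum (node G)) = N.
Proof. by rewrite -cardE. Qed.

Lemma enum_rank_size (T : Type) (g : node G -> T) (x : node G) :
  (enum_rank x <= size [seq g y | y <- enum (node G)])%N.
Proof. by rewrite size_map -cardE ltnW// ltn_ord. Qed.

Lemma advance_triple s x :
  s vCur = tree_of_elt x -> s vRho = tree_of_joint ->
  triple s advance (12 * N + 20) (fun s' => s' vCur = tree_of_elt (next x) /\
    s' vStep = tree_of_arrow (rho x)).
Proof.
move=> sx sr; eapply triple_le; last first.
eapply block_assign; eapply block_assign; eapply block_call.
- apply: seek_triple; [exact: sx | exact: sr | exact: enum_rank_size].
- move=> s1 [l1 _] _; eapply block_assign; eapply block_assign; eapply block_nil.
  by rewrite /update /= l1 hd_drop_enum.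
- by have := enum_rank_lt x; lia.
Qed.

(** An orbit has at most N distinct points, so N steps outlast the part before the cycle. *)
Lemma iter_period (x : node G) : exists p, [&& 0 < p <= N &
  iter p next (iter N next x) == iter N next x]%N.
Proof.
have /trajectP[i lti e] := looping_order next x.
have leN : (order next x <= N)%N by apply: max_card.
exists (order next x - i)%N; apply/andP; split; first by lia.
rewrite -iterD (_ : _ + N = (N - i) + order next x)%N; last by lia.
by rewrite iterD e -iterD subnK//; lia.
Qed.

Lemma loop_triple s b p :
  (0 < p)%N -> iter p next b = b ->
  (forall q, (0 < q < p)%N -> iter q next b != b) ->
  s vCur = tree_of_elt b -> s vBase = tree_of_elt b -> s vVrev = Nil ->
  s vGo = eval s etrue -> s vRho = tree_of_joint ->
  triple s (While (Var vGo)
      (block [:: advance; Assign vVrev (ECons step_label (Var vVrev));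
        Assign vEq1 (Var vCur); Assign vEq2 (Var vBase); test_equal;
        If (Var vEq) (Assign vGo ENil) Skip]))
    (p * (25 * N + 45) + 1) (fun s' => s' vVrev =
      tree_of_seq (rev (mkseq (fun i => tree_of_elt (out (iter i next b))) p))).
Proof.
move=> p0 pb pmin.
set g := fun i => tree_of_elt (out (iter i next b)).
suff H k : forall s, (k <= p)%N -> s vCur = tree_of_elt (iter k next b) ->
   s vBase = tree_of_elt b -> s vVrev = tree_of_seq (rev (mkseq g k)) ->
   s vGo = tree_of_bool (k < p)%N -> s vRho = tree_of_joint ->
  triple s (While (Var vGo)
      (block [:: advance; Assign vVrev (ECons step_label (Var vVrev));
        Assign vEq1 (Var vCur); Assign vEq2 (Var vBase); test_equal;
        If (Var vEq) (Assign vGo ENil) Skip]))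
    ((p - k) * (25 * N + 45) + 1) (fun s' => s' vVrev =
      tree_of_seq (rev (mkseq g p))).
  by move=> c bs r go sr; have := H 0 s; rewrite subn0 p0; apply.
move: {2}(p - k)%N (erefl (p - k)%N) => d; elim: d k => [|d IH] k dE {}s lekp c bs r go sr.
  have kE : k = p by lia.
  by rewrite dE mul0n; apply: while_false; rewrite /= ?go ?r kE ?ltnn.
have ltkp : (k < p)%N by lia.
rewrite ltkp in go; apply: (@triple_le _ _ _ _ ((25 * N + 44) + (d * (25 * N + 45) + 1)).+1).
  by rewrite dE mulSn; lia.
apply: (@while_true _ _ _ _ _ _ _ (fun s1 => [/\ s1 vCur = tree_of_elt (iter k.+1 next b),
   s1 vBase = tree_of_elt b, s1 vVrev = tree_of_seq (rev (mkseq g k.+1)) &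
   s1 vGo = tree_of_bool (k.+1 < p)%N])).
- by rewrite /= go.
- eapply triple_le; last first.
  eapply block_call; first exact: advance_triple c sr.
  move=> s1 [c1 st1] sb1; eapply block_assign; eapply block_assign; eapply block_assign.
  eapply block_call.
    apply: (test_equal_triple (i := enum_rank (iter k.+1 next b)) (j := enum_rank b)).
      by rewrite /update /= c1.
    by rewrite /update /= sb1 ?bs.
  move=> s2 eq2 sb2; eapply (@block_last _ _ _ _ 2).
  have c2 : s2 vCur = tree_of_elt (iter k.+1 next b) by rewrite sb2//.
  have b2 : s2 vBase = tree_of_elt b by rewrite sb2// /update /= sb1.
  have v2 : s2 vVrev = tree_of_seq (rev (mkseq g k.+1)).
    by rewrite sb2// /update /= st1 sb1// r mkseqS rev_rcons.
  have g2 : s2 vGo = tree_of_bool true by rewrite sb2// /update /= sb1.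
  apply: triple_if; rewrite /= eq2.
  have -> : (enum_rank (iter k.+1 next b) == enum_rank b :> nat) = (k.+1 == p).
    rewrite (inj_eq val_inj) (inj_eq enum_rank_inj).
    have [e|ne] := eqVneq k.+1 p; first by rewrite e pb eqxx.
    by apply/negbTE/pmin; lia.
  case: eqP => [e|ne] /=.
    by apply: triple_assign; split; [exact: c2|exact: b2|exact: v2|rewrite e ltnn].
  by apply: triple_skip; split=> //; rewrite g2; congr tree_of_bool; lia.
  by have := enum_rank_lt (iter k.+1 next b); lia.
- move=> s1 [c1 b1 v1 g1] sb1; have dE' : (p - k.+1)%N = d by lia.
  by rewrite -dE'; apply: IH => //; rewrite sb1.
Qed.

Definition stem (x : node G) : seq A := mkseq (fun i => out (iter i next x)) N.

Definition cycle_word (x : node G) (w : seq A) : Prop :=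
  let b := iter N next x in
  exists p, [/\ (0 < p <= N)%N, iter p next b = b &
    w = mkseq (fun i => out (iter i next b)) p].

Lemma compute_play_triple s x :
  s vCur = tree_of_elt x -> s vRho = tree_of_joint ->
  triple s compute_play (100 * N ^ 2 + 100 * N + 50) (fun s' =>
    s' vU = tree_of_word (stem x) /\
    exists2 w, cycle_word x w & s' vV = tree_of_word w).
Proof.
move=> sx sr.
pose b := iter N next x.
have [p /andP[/andP[p0 pN] /eqP pb] pmin] := ex_minnP (iter_period x).
eapply triple_le; last first.
eapply block_assign; eapply block_assign; eapply block_call.
  apply: (foreach_triple (enc := fun y => tree_of_arrow (rho y)) (xs := enum (node G))
   (t := 12 * N + 24)
   (I := fun ys s' => [/\ (size ys <= N)%N,
     s' vCur = tree_of_elt (iter (N - size ys) next x),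
     s' vUrev = tree_of_seq (rev (mkseq (fun i => tree_of_elt (out (iter i next x))) (N - size ys))) &
     s' vRho = tree_of_joint])) => //=.
  - move=> y ys s' _ [le c r rr]; eapply triple_le; last first.
    eapply block_call.
      by apply: (@advance_triple _ (iter (N - (size ys).+1) next x)) => //; rewrite /update /=.
    move=> s1 [c1 st1] sb1; eapply block_assign; eapply block_nil.
    split; first by lia.
    + by rewrite -(subnSK le) /update /= c1.
    + by rewrite -(subnSK le) mkseqS rev_rcons /update /= st1 sb1// /update /= r.
    + by rewrite /update /= sb1.
    lia.
  - by rewrite size_enum_nodes subnn /update /=; split.
move=> s1 [_ [_ c1 r1 rr1]] _; rewrite /= subn0 in c1 r1.
eapply block_assign; eapply block_assign; eapply block_assign.
eapply block_call.
  apply: (@loop_triple _ b p) => //.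
  move=> q /andP[q0 qp]; apply/negP => qb.
  by have := pmin q; rewrite q0 qb /=; lia.
move=> s2 v2 sb2; eapply block_assign; eapply block_call.
  apply: (reverse_onto_triple (ts := rev (mkseq (fun i => tree_of_elt (out (iter i next x))) N)) (us := [::])) => //.
  by rewrite /update /= sb2.
move=> s3 u3 sb3; eapply block_assign; eapply block_last.
apply: triple_weaken.
  apply: (reverse_onto_triple (ts := rev (mkseq (fun i => tree_of_elt (out (iter i next b))) p)) (us := [::])) => //.
  by rewrite /update /= sb3// /update /=.
move=> s4 v4 sb4; split.
  by rewrite sb4// /update /= u3 -/(rev _) revK /tree_of_word /stem /mkseq -map_comp.
exists (mkseq (fun i => out (iter i next b)) p); first by exists p; rewrite p0.
by rewrite v4 -/(rev _) revK /tree_of_word /mkseq -map_comp.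
rewrite size_enum_nodes !size_rev !size_mkseq.
move: p pN {p0 pb pmin} => p pN.
have : (p * (25 * N + 45) <= N * (25 * N + 45))%N by rewrite leq_mul2r pN orbT.
move: pN; nia.
Qed.

End Plays.

(** * Testing, scanning and drawing edges *)

Section Search.
Context (A : finType) (G : game_graph A).
Local Notation N := (order_of G).
Local Notation joint := {ffun node G -> arrow G}.
Implicit Types (rho : joint) (e : arrow G).

Local Notation switch := (use (@source _ G)).

Definition tree_of_flags : tree :=
  tree_of_seq [seq tree_of_bool (x \in max_nodes G) | x <- enum (node G)].

Definition tree_of_arrows (p : seq (arrow G)) : tree :=
  tree_of_seq [seq tree_of_arrow e | e <- p].

Context (improving : joint -> arrow G -> bool).

(** The order of the arguments reflects the owner: the word through [e] should be able to exceed the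
    current one for Max, and to fall below it for Min. *)
Definition oracle_decides : Prop := forall rho e w w',
  cycle_word rho (source e) w -> cycle_word rho (target e) w' ->
  let u := tree_of_word (stem rho (source e)) in
  let u' := tree_of_word (label e :: stem rho (target e)) in
  let v := tree_of_word w in
  let v' := tree_of_word w' in
  let q := if source e \in max_nodes G then (u', v', u, v) else (u, v, u', v') in
  query_ok q /\ O q.1.1.1 q.1.1.2 q.1.2 q.2 = improving rho e.

Hypothesis decides : oracle_decides.

Lemma test_edge_triple s rho e :
  s vEdge = tree_of_arrow e -> s vRho = tree_of_joint rho ->
  s vFlags = tree_of_flags ->
  triple s test_edge (300 * N ^ 2 + 300 * N + 200)
    (fun s' => s' vRes = tree_of_bool (improving rho e)).
Proof.
move=> se sr sf; eapply triple_le; last first.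
eapply block_assign; eapply block_call.
  apply: (@compute_play_triple _ _ rho _ (source e)); rewrite /update //=.
  by rewrite se.
move=> s1 [u1 [w cw v1]] sb1.
eapply block_assign; eapply block_assign; eapply block_assign; eapply block_call.
  apply: (@compute_play_triple _ _ rho _ (target e)); rewrite /update //=.
    by rewrite sb1// /update /= se.
  by rewrite sb1.
move=> s2 [u2 [w' cw' v2]] sb2.
eapply block_assign; eapply block_assign; eapply block_assign; eapply block_call.
  apply: (seek_triple (i := enum_rank (source e))).
  - by rewrite /update /= sb2// /update /= sb1// /update /= se.
  - by rewrite /update /= sb2// /update /= sb1// /update /= sf.
  - exact: enum_rank_size.
move=> s3 [l3 _] sb3; eapply (@block_last _ _ _ _ 2).
have eU : s3 vU = tree_of_word (label e :: stem rho (target e)).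
  by rewrite sb3// /update /= sb2// /update /= sb1// /update /= se u2.
have eV : s3 vV = tree_of_word w' by rewrite sb3// /update /= v2.
have eU0 : s3 vU0 = tree_of_word (stem rho (source e)).
  by rewrite sb3// /update /= sb2// /update /= u1.
have eV0 : s3 vV0 = tree_of_word w by rewrite sb3// /update /= sb2// /update /= v1.
have dec := decides cw cw'.
apply: triple_if; rewrite /= l3 hd_drop_enum; move: dec.
case: (source e \in _) => -[/= qok ans].
  by apply: triple_query; rewrite /= eU eV eU0 eV0// /update /= ans.
by apply: triple_query; rewrite /= eU eV eU0 eV0// /update /= ans.
have := enum_rank_lt (source e); lia.
Qed.

Lemma replace_enum (g : node G -> tree) (x : node G) d :
  catrev (rev (take (enum_rank x) [seq g y | y <- enum (node G)]))
    (d :: drop (enum_rank x).+1 [seq g y | y <- enum (node G)]) =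
  [seq (if y == x then d else g y) | y <- enum (node G)].
Proof.
rewrite catrevE revK.
have lt : (enum_rank x < size [seq g y | y <- enum (node G)])%N.
  by rewrite size_map -cardE ltn_ord.
apply: (@eq_from_nth _ Nil).
  by rewrite size_cat /= size_take size_drop lt subnSK// subnKC ?(ltnW lt)// !size_map.
move=> i; rewrite size_cat /= size_take size_drop lt subnSK// subnKC ?(ltnW lt)// size_map => ilt.
rewrite (nth_map x)// nth_cat size_take lt.
have -> : (nth x (enum (node G)) i == x) = (i == enum_rank x :> nat).
  rewrite -{2}(nth_enum_rank x x) nth_uniq ?enum_uniq// -cardE; exact: ltn_ord.
case: ltngtP => [ltix|gtix|->].
- by rewrite nth_take// (nth_map x).
- by rewrite -(subnSK gtix) /= nth_drop subnKC// (nth_map x).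
- by rewrite subnn.
Qed.

Lemma replace_found_triple s (g : node G -> tree) (x : node G) :
  s vLst = tree_of_seq (drop (enum_rank x) [seq g y | y <- enum (node G)]) ->
  s vAcc = tree_of_seq (rev (take (enum_rank x) [seq g y | y <- enum (node G)])) ->
  triple s replace_found (8 * N + 20) (fun s' => s' vRho =
    tree_of_seq [seq (if y == x then s vEdge else g y) | y <- enum (node G)]).
Proof.
move=> sl sa; eapply triple_le; last first.
eapply block_assign; eapply block_call.
  apply: (reverse_onto_triple
    (ts := rev (take (enum_rank x) [seq g y | y <- enum (node G)]))
    (us := s vEdge :: drop (enum_rank x).+1 [seq g y | y <- enum (node G)])) => //.
  rewrite /update /= sl (drop_nth Nil)//.
  by rewrite size_map -cardE ltn_ord.
move=> s1 l1 _; eapply block_assign; eapply block_nil.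
by rewrite /update /= l1 replace_enum.
rewrite size_rev size_take size_map -cardE ltn_ord.
have := enum_rank_lt x; lia.
Qed.

Lemma switch_tree rho e :
  tree_of_joint (switch rho e) = tree_of_seq
    [seq (if y == source e then tree_of_arrow e else tree_of_arrow (rho y))
       | y <- enum (node G)].
Proof.
by congr tree_of_seq; apply: eq_map => y; rewrite ffunE; case: ifP.
Qed.

Definition scan_found (rho : joint) (P L : seq (arrow G)) (s : store) : Prop :=
  exists p e r, [/\ L = p ++ e :: r, ~~ has (improving rho) p,
    improving rho e & [/\ s vRho = tree_of_joint (switch rho e),
    s vPool = tree_of_arrows (rho (source e) :: catrev p P),
    s vStack = tree_of_arrows r & truthy (s vLoop)]].

Definition scan_exhausted (rho : joint) (P L : seq (arrow G)) (s : store) :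
    Prop :=
  [/\ ~~ has (improving rho) L, s vRho = tree_of_joint rho,
    s vPool = tree_of_arrows (catrev L P), s vStack = Nil & s vLoop = Nil].

Lemma scan_triple s rho P L :
  s vPool = tree_of_arrows P -> s vStack = tree_of_arrows L ->
  s vRho = tree_of_joint rho -> s vFlags = tree_of_flags ->
  triple s scan (size L * (300 * N ^ 2 + 400 * N + 300) + 10) (fun s' =>
    scan_found rho P L s' \/ scan_exhausted rho P L s').
Proof.
move=> sp sl sr sf; eapply triple_le; last first.
eapply block_assign; eapply block_assign; eapply block_assign; eapply (@block_last _ _ _ _ (size L * (300 * N ^ 2 + 400 * N + 300) + 1)).
- set s1 := (update _ vLoop _).
  have p1 : s1 vPool = tree_of_arrows P by [].
  have l1 : s1 vScan = tree_of_arrows L by [].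
  have r1 : s1 vRho = tree_of_joint rho by [].
  have f1 : s1 vFlags = tree_of_flags by [].
  have t1 : s1 vStack = Nil by [].
  have g1 : s1 vLoop = Nil by [].
  move: s1 p1 l1 r1 f1 t1 g1 => {s sp sl sr sf}s1 p1 l1 r1 f1 t1 g1.
  elim: L s1 P p1 l1 r1 f1 t1 g1 => [|e L IH] s P p1 l1 r1 f1 t1 g1.
    by apply: while_false; [rewrite /= l1 | right].
  apply: (@triple_le _ _ _ _ ((300 * N ^ 2 + 400 * N + 299) +
      (size L * (300 * N ^ 2 + 400 * N + 300) + 1)).+1).
    by rewrite /= mulSn; lia.
  apply: (@while_true _ _ _ _ _ _ _ (fun s' => [/\ s' vFlags = tree_of_flags,
     improving rho e & [/\ s' vRho = tree_of_joint (switch rho e),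
       s' vPool = tree_of_arrows (rho (source e) :: P),
       s' vStack = tree_of_arrows L, truthy (s' vLoop) & s' vScan = Nil]]
    \/ [/\ s' vFlags = tree_of_flags, ~~ improving rho e &
      [/\ s' vRho = tree_of_joint rho, s' vPool = tree_of_arrows (e :: P),
        s' vScan = tree_of_arrows L, s' vStack = Nil & s' vLoop = Nil]])).
  + by rewrite /= l1.
  + eapply triple_le; last first.
    eapply block_assign; eapply block_assign; eapply block_call.
      by apply: (@test_edge_triple _ rho e); rewrite /update //= l1.
    move=> s2 i2 sb2; eapply (@block_last _ _ _ _ (100 * N + 80)).
    have {}e2 : s2 vEdge = tree_of_arrow e by rewrite sb2// /update /= l1.
    have {}p2 : s2 vPool = tree_of_arrows P by rewrite sb2.
    have sc2 : s2 vScan = tree_of_arrows L by rewrite sb2// /update /= l1.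
    have {}r2 : s2 vRho = tree_of_joint rho by rewrite sb2.
    have {}f2 : s2 vFlags = tree_of_flags by rewrite sb2.
    have {}t2 : s2 vStack = Nil by rewrite sb2.
    have {}g2 : s2 vLoop = Nil by rewrite sb2.
    have [imp|nimp] := boolP (improving rho e); last first.
      apply: (@triple_le _ _ _ _ 2); first by lia.
      apply: triple_if; rewrite /= i2 (negbTE nimp) /=; apply: triple_assign.
      by right; rewrite /update /= e2 p2.
    apply: (@triple_le _ _ _ _ (100 * N + 79).+1); first by lia.
    apply: triple_if; rewrite /= i2 imp /=; eapply triple_le; last first.
    eapply block_assign; eapply block_assign; eapply block_call.
      apply: (@seek_triple _ (enum_rank (source e)) _).
      - by rewrite /update /= e2.
      - by rewrite /update /= r2.
      - exact: enum_rank_size.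
    move=> s3 [l3 a3] sb3; eapply block_assign; eapply block_call.
      exact: (@replace_found_triple _ (fun x => tree_of_arrow (rho x)) (source e)).
    move=> s4 r4 sb4; eapply block_assign; eapply block_assign; eapply block_assign.
    eapply block_nil; left; rewrite /update /= r4 switch_tree.
    rewrite /update /= !sb4// /update /= l3.
    rewrite (hd_drop_enum (fun x => tree_of_arrow (rho x))) !sb3// /update /=.
    by rewrite e2 p2 f2 sc2.
    by have := enum_rank_lt (source e); lia.
    by lia.
  + move=> s2 [[f2 imp [r2 p2 t2 g2 sc2]]|[f2 nimp [r2 p2 sc2 t2 g2]]] _.
      apply: (@triple_le _ _ _ _ 1); first by lia.
      apply: while_false; first by rewrite /= sc2.
      by left; exists [::], e, L.
    apply: (triple_weaken (IH _ _ p2 sc2 r2 f2 t2 g2)) => s3 + _.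
    case=> [[p [e' [r [-> np ie' [? ? ? ?]]]]]|[nh ? ? ? ?]].
      by left; exists (e :: p), e', r; split=> //=; rewrite negb_or nimp.
    by right; split=> //=; rewrite negb_or nimp.
- lia.
Qed.

Local Notation arrow := (arrow G).

Lemma halve_triple s (Q : seq arrow) : s vPick = tree_of_arrows Q ->
  triple s halve (size Q * 14 + 10) (fun s' => exists Q0 Q1,
    [/\ perm_eq (Q0 ++ Q1) Q, (size Q0 <= size Q1 <= (size Q0).+1)%N,
      s' vHalf0 = tree_of_arrows Q0 & s' vHalf1 = tree_of_arrows Q1]).
Proof.
move=> sq; eapply triple_le; last first.
eapply block_assign; eapply block_assign; eapply block_call.
  apply: (foreach_triple (enc := @tree_of_arrow A G) (xs := Q) (t := 7)
   (I := fun ys s' => exists Q0 Q1,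
    [/\ perm_eq (Q0 ++ Q1 ++ ys) Q, (size Q0 <= size Q1 <= (size Q0).+1)%N,
      s' vHalf0 = tree_of_arrows Q0 & s' vHalf1 = tree_of_arrows Q1])) => //=.
  - move=> y ys s' _ [Q0 [Q1 [pq szq h0 h1]]].
    eapply block_assign; eapply block_assign; eapply block_assign; eapply block_nil.
    exists Q1, (y :: Q0); rewrite /update /= h0 h1; split=> //; last by lia.
    apply/seq.permP => a; have := seq.permP pq a.
    by rewrite !count_cat /= count_cat; lia.
  - by exists [::], [::].
move=> s1 [_ [Q0 [Q1 [pq szq h0 h1]]]] _; eapply block_nil.
by exists Q0, Q1; rewrite cats0 in pq.
lia.
Qed.

Lemma keep_half_triple s (Q0 Q1 X : seq arrow) :
  s vHalf0 = tree_of_arrows Q0 -> s vHalf1 = tree_of_arrows Q1 ->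
  s vLeft = tree_of_arrows X ->
  let b := truthy (s vCoin) in
  triple s keep_half (8 * (size Q0 + size Q1) + 20) (fun s' =>
    s' vPick = tree_of_arrows (if b then Q0 else Q1) /\
    s' vLeft = tree_of_arrows (catrev (if b then Q1 else Q0) X)).
Proof.
move=> h0 h1 l b.
have catE p q : catrev [seq tree_of_arrow e | e : arrow <- p] [seq tree_of_arrow e | e : arrow <- q]
    = [seq tree_of_arrow e | e <- catrev p q].
  by elim: p q => //= x p IH q; rewrite -IH.
eapply triple_le; last first.
eapply (@block_call _ _ _ _ _ 6 _ (fun s' => [/\ s' vPick = tree_of_arrows (if b then Q0 else Q1),
   s' vHalf0 = tree_of_arrows (if b then Q1 else Q0) & s' vLeft = tree_of_arrows X])).
  apply: triple_if; rewrite /= -/b; case: b.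
    by apply: block_assign; apply: block_assign; apply: block_nil; rewrite /update /= h0 h1.
  by apply: (@triple_le _ _ _ _ 1) => //; apply: triple_assign; rewrite /update /= h0 h1.
move=> s1 [p1 h01 l1] _; eapply block_last; apply: triple_weaken.
  by apply: (reverse_onto_triple _ _ _ h01 l1).
move=> s2 l2 sb2; rewrite sb2//; split=> //.
by rewrite l2 catE.
by rewrite size_map; case: b; lia.
Qed.

Section Random.
Context (R : realType) (post : store -> Prop).
Local Notation good := (good O query_ok post).
Implicit Types (r : R) (k : seq cmd).

Lemma good_block_cons c cs k s r :
  good (c :: block cs :: k, s) r -> good (block (c :: cs) :: k, s) (1 + r).
Proof. exact: good_next. Qed.

Lemma good_block_nil k s r : good (k, s) r -> good (block [::] :: k, s) (1 + r).
Proof. exact: good_next. Qed.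

Lemma good_skip k s r : good (k, s) r -> good (Skip :: k, s) (1 + r).
Proof. exact: good_next. Qed.

Lemma good_assign x (e : expr) k s r :
  good (k, update s x (eval s e)) r -> good (Assign x e :: k, s) (1 + r).
Proof. exact: good_next. Qed.

Lemma good_while_true (e : expr) c k s r : truthy (eval s e) ->
  good (c :: While e c :: k, s) r -> good (While e c :: k, s) (1 + r).
Proof. by move=> te; apply: good_next => //=; rewrite te. Qed.

Lemma good_while_false (e : expr) c k s r : ~~ truthy (eval s e) ->
  good (k, s) r -> good (While e c :: k, s) (1 + r).
Proof. by move=> te; apply: good_next => //=; rewrite (negbTE te). Qed.

(** The halves of an odd list differ in size, so the weights are not uniform; only the bound
    [2 ^- j] is kept. The linear cost is a geometric sum: a round costs at most [100 * size Q], and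
    the two continuations average to another [100 * size Q]. *)
Lemma pick_good (Q X : seq arrow) s k (cost : arrow -> R) :
  uniq Q -> Q != [::] ->
  s vPick = tree_of_arrows Q -> s vLeft = tree_of_arrows X ->
  (forall e Y s', e \in Q -> perm_eq (e :: Y) (Q ++ X) ->
    s' vPick = tree_of_arrows [:: e] -> s' vLeft = tree_of_arrows Y ->
    same_but (modified pick) s s' -> good (k, s') (cost e)) ->
  exists w : arrow -> R, [/\ forall e, e \in Q -> 0 <= w e,
    \sum_(e <- Q) w e = 1,
    forall j e, (2 ^ j <= size Q)%N -> e \in Q -> w e <= (2 ^+ j)^-1 &
    good (pick :: k, s) ((200 * size Q)%:R + \sum_(e <- Q) w e * cost e)].
Proof.
have [n] := ubnP (size Q); elim: n => // n IH in Q X s *; rewrite ltnS => szn.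
move=> uQ Qn sp sl H.
case: Q => [//|e1 [|e2 Q]] in szn uQ Qn sp sl H *.
  exists (fun=> 1); split=> //.
  - by rewrite big_seq1.
  - move=> [|j] e le; first by rewrite expr0 invr1.
    have : (0 < 2 ^ j)%N by rewrite expn_gt0.
    by move: le; rewrite expnS /=; lia.
  - rewrite big_seq1 mul1r; apply: (@good_le _ _ _ _ _ (1 + cost e1)).
      by rewrite lerD2r ler1n.
    apply: good_while_false; first by rewrite /= sp.
    by apply: (H e1 X); rewrite ?inE ?eqxx.
set Q' := [:: e1, e2 & Q] in szn uQ Qn sp sl H *.
have q2 : (2 <= size Q')%N by [].
have [s1 [t1 [ex1 le1 [Q0 [Q1 [pq szq h0 h1]]]]]] := halve_triple sp.
have sz : (size Q0 + size Q1 = size Q')%N by rewrite -size_cat (perm_size pq).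
have [lt0 lt1 gt0 gt1] : [/\ size Q0 < n, size Q1 < n, 0 < size Q0 & 0 < size Q1]%N.
  move: szn q2 szq; rewrite -sz; move: (size Q0) (size Q1) => a b le lt ab.
  by split; lia.
have uQ01 : uniq (Q0 ++ Q1) by rewrite (perm_uniq pq).
have s1l : s1 vLeft = tree_of_arrows X by rewrite (exec_same ex1).
pose half b := if b then Q0 else Q1.
have halfQ b e : e \in half b -> e \in Q'.
  by rewrite -(perm_mem pq) mem_cat /half; case: b => ->; rewrite ?orbT.
have branch b : exists w : arrow -> R, [/\ forall e, e \in half b -> 0 <= w e,
    \sum_(e <- half b) w e = 1,
    forall j e, (2 ^ j <= size (half b))%N -> e \in half b -> w e <= (2 ^+ j)^-1 &
    good (block [:: keep_half] :: pick :: k, update s1 vCoin (tree_of_bool b))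
    ((8 * size Q' + 22)%:R +
    ((200 * size (half b))%:R + \sum_(e <- half b) w e * cost e))].
  have [s2 [t2 [ex2 le2 [p2 l2]]]] :=
    @keep_half_triple (update s1 vCoin (tree_of_bool b)) Q0 Q1 X h0 h1 s1l.
  have bE : truthy (update s1 vCoin (tree_of_bool b) vCoin) = b by case: (b).
  rewrite bE -/(half b) in p2 l2.
  have [|||||w [w0 w1 wj g]] := IH (half b) (catrev (half (~~ b)) X) s2 _ _ _ p2.
  - by rewrite /half; case: (b).
  - by move: uQ01; rewrite cat_uniq /half => /and3P[]; case: (b).
  - by rewrite -size_eq0 -lt0n /half; case: (b).
  - by rewrite l2 /half; case: (b).
  - move=> e Y s' eb pY p' l' sb; apply: (H e Y s') => //; first exact: halfQ eb.
      rewrite (perm_trans pY)// catrevE catA perm_cat2r.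
      have : perm_eq (half b ++ half (~~ b)) Q'.
        by rewrite /half; case: (b) => //=; rewrite perm_catC.
      by apply: perm_trans; rewrite perm_cat2l perm_rev.
    apply: same_but_trans sb.
    have sub1 : {subset modified halve <= modified pick} by apply/allP.
    have sub2 : {subset modified keep_half <= modified pick} by apply/allP.
    apply: same_but_trans (same_but_sub sub2 (exec_same ex2)).
    by apply: same_but_update => //; exact: same_but_sub sub1 (exec_same ex1).
  - exists w; split=> //; apply: good_le; last first.
      by apply: good_block_cons; apply: exec_good ex2 _; apply: good_block_nil g.
    have : (t2 + 2)%:R <= (8 * size Q' + 22)%:R :> R.
      by rewrite ler_nat -sz; move: le2; move: (_ * _)%N => x; lia.
    rewrite natrD; move: (_ * _ + 22)%N => x; move: (\sum_(_ <- _) _) => y.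
    by move: (_ * _)%N => z; lra.
have [w0 [w0p w0s w0j g0]] := branch true.
have [w1 [w1p w1s w1j g1]] := branch false.
have in1 e : e \in Q1 -> (e \in Q0) = false.
  move=> e1'; move: uQ01; rewrite cat_uniq => /and3P[_ /hasPn /(_ _ e1') /negbTE//].
(* An element survives this round with probability 1/2 and then competes within its own half. *)
pose w e := (if e \in Q0 then w0 e else w1 e) / 2.
have sumw (f : arrow -> R) : \sum_(e <- Q') w e * f e =
    (\sum_(e <- Q0) w0 e * f e + \sum_(e <- Q1) w1 e * f e) / 2.
  rewrite -(perm_big _ pq) big_cat /= mulrDl !mulr_suml; congr (_ + _).
    by apply: eq_big_seq => e eQ; rewrite /w eQ; lra.
  by apply: eq_big_seq => e eQ; rewrite /w in1//; lra.
exists w; split.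
- move=> e; rewrite -(perm_mem pq) mem_cat /w; case: ifP => [eQ _|_ eQ].
    by rewrite divr_ge0// w0p.
  by rewrite divr_ge0// w1p.
- have := sumw (fun=> 1).
  under eq_bigr do rewrite mulr1.
  under [X in (X + _) / _]eq_bigr do rewrite mulr1.
  under [X in (_ + X) / _]eq_bigr do rewrite mulr1.
  by move=> ->; rewrite w0s w1s; lra.
- move=> [|j] e lej; rewrite -(perm_mem pq) mem_cat /w => eQ.
    rewrite expr0 invr1.
    case: ifP eQ => [eQ _|_ /= eQ].
      by have := w0j 0 e gt0 eQ; rewrite expr0 invr1; lra.
    by have := w1j 0 e gt1 eQ; rewrite expr0 invr1; lra.
  rewrite exprSr invfM ler_pM2r ?invr_gt0//.
  (* The smaller half has at least floor(size / 2) elements, hence at least [2 ^ j] when the whole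
     has [2 ^ j.+1]. *)
  have [jle0 jle1] : (2 ^ j <= size Q0 /\ 2 ^ j <= size Q1)%N.
    move: lej szq; rewrite -sz expnS.
    by move: (size Q0) (size Q1) => a b; lia.
  by case: ifP eQ => [eQ _|_ /= eQ]; [apply: w0j | apply: w1j].
- rewrite sumw; apply: good_le; last first.
    apply: good_while_true; first by rewrite /= sp.
    apply: good_block_cons; apply: exec_good ex1 _; apply: good_block_cons.
    exact: good_coin g1 g0.
  have : (200 * size (half true))%:R + (200 * size (half false))%:R =
      (200 * size Q')%:R :> R by rewrite -natrD -mulnDr sz.
  have : (t1 + 4 + (8 * size Q' + 22))%:R <= (100 * size Q')%:R :> R.
    by rewrite ler_nat; move: le1 q2; move: (size Q') => q; lia.
  have -> : (200 * size Q')%:R = (100 * size Q')%:R + (100 * size Q')%:R :> R.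
    by rewrite -natrD -mulnDl.
  rewrite [(t1 + 4 + _)%:R]natrD natrD.
  move: (8 * _ + 22)%N (100 * _)%N (200 * size (half true))%N
    (200 * size (half false))%N (\sum_(_ <- Q0) _) (\sum_(_ <- Q1) _) => x y z z' v v'.
  lra.
Qed.

Lemma shuffle_done s k r : s vPool = Nil -> good (k, s) r ->
  good (shuffle :: k, s) (1 + r).
Proof. by move=> sp; apply: good_while_false; rewrite /= sp. Qed.

Lemma shuffle_good (P L : seq arrow) s k (cost : arrow -> R) :
  uniq P -> P != [::] ->
  s vPool = tree_of_arrows P -> s vStack = tree_of_arrows L ->
  (forall e Y s', e \in P -> perm_eq (e :: Y) P ->
    s' vPool = tree_of_arrows Y -> s' vStack = tree_of_arrows (e :: L) ->
    same_but (modified shuffle) s s' -> good (shuffle :: k, s') (cost e)) ->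
  exists w : arrow -> R, [/\ forall e, e \in P -> 0 <= w e,
    \sum_(e <- P) w e = 1,
    forall j e, (2 ^ j <= size P)%N -> e \in P -> w e <= (2 ^+ j)^-1 &
    good (shuffle :: k, s) ((200 * size P + 20)%:R + \sum_(e <- P) w e * cost e)].
Proof.
move=> uP Pn sp sl H.
pose s1 := update (update s vPick (s vPool)) vLeft Nil.
pose rest := block [:: Assign vStack (ECons (EHd (Var vPick)) (Var vStack));
      Assign vPool (Var vLeft)].
have [|||w [w0 w1 wj g]] := @pick_good P [::] s1 [:: rest, shuffle & k]
    (fun e => 5 + cost e) uP Pn.
- by rewrite /s1 /update /= sp.
- by [].
- move=> e Y s2 eP; rewrite cats0 => pY p2 l2 sb2.
  apply: good_le; last first.
    apply: good_block_cons; apply: good_assign.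
    apply: good_block_cons; apply: good_assign.
    apply: good_block_nil; apply: (H e Y) => //.
    + by rewrite /update /= p2 sb2// /s1 /update /= sl.
    have sub : {subset modified pick <= modified shuffle} by apply/allP.
    do 2 (apply: same_but_update => //).
    apply: same_but_trans (same_but_sub sub sb2).
    by do 2 (apply: same_but_update => //).
  by lra.
- exists w; split=> //; apply: good_le; last first.
    apply: good_while_true.
      by rewrite /= sp; case: (P) Pn.
    apply: good_block_cons; apply: good_assign.
    apply: good_block_cons; apply: good_assign.
    apply: good_block_cons; exact: g.
  have -> : \sum_(e <- P) w e * (5 + cost e) = 5 + \sum_(e <- P) w e * cost e.
    under eq_bigr do rewrite mulrDr.
    by rewrite big_split /= -mulr_suml w1 mul1r.
  rewrite natrD; move: (200 * _)%N (\sum_(_ <- _) _) => x y; lra.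
Qed.

End Random.

End Search.

End Fragments.

(** * Words and prefix monotonicity *)

Section Words.
Context (A : finType).
Implicit Types (x y z : infinite_word A) (u w : seq A).

Lemma prepend_nil z : prepend [::] z = z.
Proof. by apply/funext => i; rewrite /prepend /= nth_nil subn0. Qed.

Lemma prepend_cat u w z : prepend (u ++ w) z = prepend u (prepend w z).
Proof.
apply/funext => i; rewrite /prepend size_cat nth_cat subnDA.
case: ltnP => // le; first by apply: set_nth_default.
by rewrite [RHS]nth_default.
Qed.

Lemma prepend_cons a u z : prepend (a :: u) z = prepend [:: a] (prepend u z).
Proof. exact: (prepend_cat [:: a]). Qed.

Lemma prepend1 x a z : x 0%N = a -> (forall i, x i.+1 = z i) -> prepend [:: a] z = x.
Proof. by move=> x0 xS; apply/funext => -[|i] //=; rewrite /prepend /= nth_nil subn1 xS. Qed.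

(** Ultimately periodic words, presented by a finite automaton without input: this form can be
    copied directly into a game graph. *)
Definition regular x : Prop :=
  exists (Q : finType) (q : Q) (nxt : Q -> Q) (o : Q -> A),
    forall k, x k = o (iter k nxt q).

Lemma regular_prepend1 a x : regular x -> regular (prepend [:: a] x).
Proof.
move=> [Q [q [nxt [lab xE]]]].
exists (option Q), None, (fun p => Some (oapp nxt q p)), (oapp lab a).
move=> [|k] //; rewrite /prepend /= nth_nil subn1 xE /=.
have iterE : iter k (fun p => Some (oapp nxt q p)) None =
    if k is k'.+1 then Some (iter k' nxt q) else None.
  by elim: k => //= k ->; case: k.
by rewrite iterE; case: k iterE.
Qed.

Context {R : realType} (phi : infinite_word A -> R).

Definition below x y : Prop :=
  forall w, phi (prepend w x) <= phi (prepend w y).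

Lemma below_refl x : below x x.
Proof. by []. Qed.

Lemma below_trans y x z : below x y -> below y z -> below x z.
Proof. by move=> xy yz w; apply: le_trans (xy w) (yz w). Qed.

Lemma below_prepend u x y : below x y -> below (prepend u x) (prepend u y).
Proof. by move=> xy w; rewrite -!prepend_cat. Qed.

Lemma not_below x y : ~ below x y <->
  exists w, phi (prepend w x) > phi (prepend w y).
Proof.
split=> [/existsNP[w]|[w lt]]; first by move=> /negP; rewrite -ltNge; exists w.
by move=> /(_ w); rewrite leNgt lt.
Qed.

Hypothesis phi_continuous : continuous phi.

Lemma continuous_limit x (z : nat -> infinite_word A) :
  (forall k i, (i < k)%N -> z k i = x i) -> phi \o z @ \oo --> phi x.
Proof.
move=> agree; apply: (@continuous_cvg _ _ _ eventually _ z phi x).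
  exact: phi_continuous.
(* Convergence in the product is coordinatewise, and each coordinate of [z k] is eventually that of
   [x]. *)
apply/cvg_sup => i U; rewrite nbhsE => -[B [[C oC CB] Bx] BU].
exists i.+1 => // k /= ik; apply: BU; rewrite -CB /= in Bx *.
by rewrite agree.
Qed.

Lemma below_limit x (z : nat -> infinite_word A) y :
  (forall k i, (i < k)%N -> z k i = x i) ->
  ((forall k, below y (z k)) -> below y x) /\
  ((forall k, below (z k) y) -> below x y).
Proof.
move=> agree.
have lim w : phi \o (fun k => prepend w (z k)) @ \oo --> phi (prepend w x).
  apply: continuous_limit => k i ik; rewrite /prepend.
  have [lt|ge] := ltnP i (size w); first exact: set_nth_default.
  by rewrite !nth_default// agree//; lia.
split=> h w; have cv := cvgP _ (lim w).
  rewrite -(cvg_lim _ (lim w))//; apply: limr_ge => //.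
  by apply: nearW => k; apply: h.
rewrite -(cvg_lim _ (lim w))//; apply: limr_le => //.
by apply: nearW => k; apply: h.
Qed.

End Words.

Section Paths.
Context (A : finType) (G : game_graph A).
Implicit Types (rho : node G -> arrow G) (P : nat -> arrow G).

Definition valid rho : Prop :=
  forall x, rho x \in edges G /\ source (rho x) = x.

Definition value rho (x : node G) : infinite_word A :=
  fun k => out rho (iter k (next rho) x).

Definition play rho (x : node G) : nat -> arrow G :=
  fun k => rho (iter k (next rho) x).

Lemma value_step rho x : value rho x = prepend [:: out rho x] (value rho (next rho x)).
Proof.
apply/esym/prepend1 => // i; by rewrite /value iterSr.
Qed.

Lemma regular_value rho x : regular (value rho x).
Proof. by exists (node G), x, (next rho), (out rho). Qed.

Lemma play_path rho x : valid rho -> is_infinite_path (play rho x).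
Proof.
move=> v k; split; first exact: (v _).1.
by rewrite /play (v _).2 iterS.
Qed.

Lemma play_source rho x : valid rho -> source (play rho x 0) = x.
Proof. by move=> v; exact: (v _).2. Qed.

Lemma is_path_rcons s p (e : arrow G) : is_path s (rcons p e) =
  [&& is_path s p, e \in edges G & source e == path_target s p].
Proof.
elim: p s => [|e' p IH] s /=; first by rewrite andbT.
by rewrite IH -!andbA.
Qed.

Lemma mkseq_path P s k : is_infinite_path P -> source (P 0%N) = s ->
  is_path s (mkseq P k) /\ path_target s (mkseq P k) = source (P k).
Proof.
move=> ip s0; elim: k => [|k [IH1 IH2]]; first by split.
rewrite mkseqS is_path_rcons IH1 IH2 eqxx (ip k).1; split=> //.
by rewrite /path_target map_rcons last_rcons (ip k).2.
Qed.

Lemma positional_consistent (U : {set node G}) (sigma : strategy G) s P :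
  is_infinite_path P -> source (P 0%N) = s -> positional U sigma ->
  consistent U s sigma P <->
  forall k, source (P k) \in U -> P k = sigma (source (P k)) [::].
Proof.
move=> ip s0 pos.
have E k : source (P k) \in U -> sigma s (mkseq P k) = sigma (source (P k)) [::].
  by have [pk tk] := mkseq_path k ip s0 => kU; apply: pos => //; rewrite tk.
split=> [[_ _ h] k kU|h]; first by rewrite -E// h// (mkseq_path k ip s0).2.
by split=> // k; rewrite (mkseq_path k ip s0).2 => kU; rewrite E// -h.
Qed.

End Paths.

(** * Totality of the preorder from positional determinacy *)

Section Monotone.
Context (A : finType) {R : realType} (phi : infinite_word A -> R).
Hypothesis phi_bounded : bounded_payoff phi.
Hypothesis phi_determined : positionally_determined phi.

Section Gadget.
Context (Q : bool -> finType) (q : forall b, Q b) (nxt : forall b, Q b -> Q b).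
Context (o : forall b, Q b -> A) (w : bool -> seq A).

Local Notation N := (maxn (size (w true)) (size (w false))).
Local Notation state := (bool * 'I_N.+1 + (Q true + Q false))%type.
Local Notation vertex := (option state).

Definition word_state b (p : Q b) : vertex :=
  match b return Q b -> vertex with
  | true => fun p => Some (inr (inl p))
  | false => fun p => Some (inr (inr p))
  end p.

(* In (b, i) the last i + 1 letters of w b remain to be read. *)
Definition state_step (v : state) : A * vertex :=
  match v with
  | inl (b, i) => (nth (o (q b)) (rev (w b)) i,
                   if nat_of_ord i is j.+1 then Some (inl (b, inord j)) else None)
  | inr (inl p) => (o p, word_state (nxt p))
  | inr (inr p) => (o p, word_state (nxt p))
  end.

Definition branch b : vertex * A * vertex := (None, o (q b), word_state (nxt (q b))).

Definition choose b (v : vertex) : vertex * A * vertex :=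
  if v is Some t then (v, (state_step t).1, (state_step t).2) else branch b.

(** Only at [None] does the edge depend on [b], so [None] is the one node with a choice. *)
Definition gadget_edges : {set vertex * A * vertex} :=
  [set choose b v | b : bool, v : vertex].

Lemma gadget_no_deadlock (v : vertex) : exists a t, (v, a, t) \in gadget_edges.
Proof.
exists (choose true v).1.2, (choose true v).2.
have -> : (v, (choose true v).1.2, (choose true v).2) = choose true v.
  by case: v.
exact: imset2_f.
Qed.

(** Two chains spell [w true] and [w false] and meet at [None], where one of two automata is
    entered. Max owns every node, so an equilibrium is a positional optimization by Max. *)
Definition gadget : game_graph A := GameGraph [set: _] gadget_no_deadlock.

Definition prefix_start b : vertex :=
  if size (w b) is i.+1 then Some (inl (b, inord i)) else None.

Lemma choose_valid b : @valid A gadget (choose b).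
Proof. by move=> v; split; [exact: imset2_f | case: v]. Qed.

Lemma choose_unique b (e : arrow gadget) : e \in edges gadget ->
  (source e = None -> e = branch b) -> e = choose b (source e).
Proof.
move=> /imset2P[b' v _ _ ->]; case: v => [t|] //=.
by move=> /(_ erefl) ->.
Qed.

Lemma value_word_state c b (p : Q b) :
  @value A gadget (choose c) (word_state p) = fun k => o (iter k (@nxt b) p).
Proof.
have nextE (p' : Q b) : @next A gadget (choose c) (word_state p') = word_state (nxt p').
  by case: b p p'.
have outE (p' : Q b) : @out A gadget (choose c) (word_state p') = o p'.
  by case: b p p' {nextE}.
apply/funext => k; rewrite /value.
have -> : iter k (@next A gadget (choose c)) (word_state p) = word_state (iter k (@nxt b) p).
  by elim: k => //= k ->.
exact: outE.
Qed.

Lemma value_branch b : @value A gadget (choose b) None = fun k => o (iter k (@nxt b) (q b)).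
Proof.
rewrite value_step -[next _ _]/(word_state (nxt (q b))) value_word_state.
by apply: prepend1 => // i; rewrite iterSr.
Qed.

Lemma value_prefix c b : @value A gadget (choose c) (prefix_start b) =
  prepend (w b) (@value A gadget (choose c) None).
Proof.
have H i : (i < size (w b))%N ->
   @value A gadget (choose c) (Some (inl (b, inord i))) =
   prepend (drop (size (w b) - i.+1) (w b)) (@value A gadget (choose c) None).
  elim: i => [|i IH] lt.
    have i0 : (inord 0 : 'I_N.+1) = 0%N :> nat by rewrite inordK.
    rewrite value_step /next /out /label /= /target /= i0.
    rewrite (drop_nth (o (q b))) ?subn1; last by lia.
    rewrite drop_oversize; last by lia.
    by rewrite nth_rev// subn1.
  have iE : (inord i.+1 : 'I_N.+1) = i.+1 :> nat.
    by rewrite inordK// ltnS (leq_trans (ltnW lt))//; case: (b); rewrite ?leq_maxl ?leq_maxr.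
  rewrite value_step /next /out /label /= /target /= iE IH ?(ltnW lt)//.
  rewrite [in RHS](drop_nth (o (q b))); last by lia.
  rewrite subnSK// [RHS]prepend_cons; congr (prepend [:: _] _).
  by rewrite nth_rev.
rewrite /prefix_start; case E : (size (w b)) => [|i].
  by rewrite (size0nil E) prepend_nil.
by rewrite H ?E// subnn drop0.
Qed.

(** A positional strategy chooses the same [c] at [None] after either prefix, and optimality from
    both starting nodes makes this choice best after both. *)
Lemma gadget_monotone (x : bool -> infinite_word A) :
  (forall b k, x b k = o (iter k (@nxt b) (q b))) ->
  exists c, forall b b', phi (prepend (w b) (x b')) <= phi (prepend (w b) (x c)).
Proof.
move=> xE.
have vx b : @value A gadget (choose b) None = x b.
  by rewrite value_branch; apply/funext => k; rewrite xE.
have [sigma [tau [[sS sP] [tS tP] eq]]] := phi_determined gadget.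
have [M bM] := phi_bounded.
have lbd (S : set (nat -> arrow gadget)) :
    has_lbound [set phi (infinite_label P) | P in S].
  by exists (- M) => _ [P _ <-]; have := bM (infinite_label P); rewrite ler_norml => /andP[].
have ubd (S : set (nat -> arrow gadget)) :
    has_ubound [set phi (infinite_label P) | P in S].
  by exists M => _ [P _ <-]; have := bM (infinite_label P); rewrite ler_norml => /andP[].
have [c cE] : exists c, sigma None [::] = branch c.
  have [] := sS None [::] isT _; first by rewrite inE.
  move=> /imset2P[b' v _ _ ->]; case: v => [t //|] _; by exists b'.
have sE v : sigma v [::] = choose c v.
  have [] := sS v [::] isT _; first by rewrite inE.
  rewrite -[path_target v [::]]/v => eE sv.
  by apply: etrans (@choose_unique c _ eE _) _; rewrite sv// => ->.
exists c => b b'; rewrite -!vx -!value_prefix.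
have cons1 : consistent (max_nodes gadget) (prefix_start b) sigma
    (@play A gadget (choose c) (prefix_start b)).
  apply/positional_consistent => //.
  - exact/play_path/choose_valid.
  - exact/play_source/choose_valid.
  by move=> k _; rewrite sE /play (choose_valid _ _).2.
(* Min owns no node, so every play is consistent with [tau] and its payoff is at most the value of
   [tau]. *)
have cons2 : consistent (min_nodes gadget) (prefix_start b) tau
    (@play A gadget (choose b') (prefix_start b)).
  apply/positional_consistent => //.
  - exact/play_path/choose_valid.
  - exact/play_source/choose_valid.
  by move=> k; rewrite !inE.
apply: le_trans (_ : value_min phi tau (prefix_start b) <= _).
  by apply: ub_le_sup => //; eexists; [exact: cons2|].
by rewrite -eq; apply: ge_inf => //; eexists; [exact: cons1|].
Qed.

End Gadget.

(** Take as prefixes the [w1] at which [x] beats [y] and an arbitrary [w2]. The common choice cannot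
    be [y] because of [w1], so it is [x], which is then best after [w2] too. *)
Lemma below_total (x y : infinite_word A) : regular x -> regular y ->
  ~ below phi x y -> below phi y x.
Proof.
move=> [Q1 [q1 [n1 [l1 x1]]]] [Q2 [q2 [n2 [l2 y1]]]] /not_below[w1 lt1] w2.
pose Q b : finType := if b then Q1 else Q2.
pose q b : Q b := match b return Q b with true => q1 | false => q2 end.
pose n b : Q b -> Q b := match b return Q b -> Q b with true => n1 | false => n2 end.
pose o b : Q b -> A := match b return Q b -> A with true => l1 | false => l2 end.
pose w b := if b then w1 else w2.
pose z b := if b then x else y.
have [|[] h] := @gadget_monotone Q q n o w z; first by case.
  exact: (h false false).
by have := h true true; rewrite leNgt lt1.
Qed.

End Monotone.

(** * Strategy improvement *)

Section Improvement.
Context (A : finType) (R : realType) (phi : infinite_word A -> R).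
Hypothesis phi_bounded : bounded_payoff phi.
Hypothesis phi_continuous : continuous phi.
Hypothesis phi_determined : positionally_determined phi.
Context (G : game_graph A).
Local Notation joint := {ffun node G -> arrow G}.
Local Notation below := (below phi).
Implicit Types (rho : joint) (e : arrow G) (P : nat -> arrow G) (x : node G).

Definition entering rho e : infinite_word A :=
  prepend [:: label e] (value rho (target e)).

Definition improving rho e : bool :=
  `[< if source e \in max_nodes G then ~ below (entering rho e) (value rho (source e))
      else ~ below (value rho (source e)) (entering rho e) >].

Lemma entering_self rho x : entering rho (rho x) = value rho x.
Proof. by rewrite [RHS]value_step. Qed.

Lemma entering_total rho e : ~ below (entering rho e) (value rho (source e)) ->
  below (value rho (source e)) (entering rho e).
Proof.
apply: below_total => //; last exact: regular_value.
exact/regular_prepend1/regular_value.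
Qed.

Lemma entering_total' rho e : ~ below (value rho (source e)) (entering rho e) ->
  below (entering rho e) (value rho (source e)).
Proof.
apply: below_total => //; first exact: regular_value.
exact/regular_prepend1/regular_value.
Qed.

(** Cutting the path after k edges and continuing with the valuation [v] gives words [z k] that move
    monotonically in the preorder and converge to the label of the path; continuity carries the
    comparison to the limit. *)
Lemma path_limit (v : node G -> infinite_word A) P : is_infinite_path P ->
  ((forall k, below (v (source (P k))) (prepend [:: label (P k)] (v (target (P k))))) ->
     below (v (source (P 0%N))) (infinite_label P)) /\
  ((forall k, below (prepend [:: label (P k)] (v (target (P k)))) (v (source (P k)))) ->
     below (infinite_label P) (v (source (P 0%N)))).
Proof.
move=> ip.
pose z k := prepend (mkseq (fun i => label (P i)) k) (v (source (P k))).
have zS k : z k.+1 = prepend (mkseq (fun i => label (P i)) k)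
    (prepend [:: label (P k)] (v (target (P k)))).
  by rewrite /z mkseqS -cats1 prepend_cat (ip k).2.
have agree k i : (i < k)%N -> z k i = infinite_label P i.
  by move=> ik; rewrite /z /prepend (set_nth_default (label (P 0%N))) ?size_mkseq// nth_mkseq.
have [L1 L2] := below_limit phi_continuous (v (source (P 0%N))) agree.
split=> h; [apply: L1|apply: L2]; elim=> [|k IH]; rewrite ?/z ?prepend_nil//.
  apply: below_trans IH _; rewrite -/(z k) -/(z k.+1) zS; exact: below_prepend.
apply: below_trans _ IH; rewrite -/(z k) -/(z k.+1) zS; exact: below_prepend.
Qed.

Lemma below_value rho (v : node G -> infinite_word A) : valid rho ->
  (forall x, below (v x) (prepend [:: label (rho x)] (v (target (rho x))))) ->
  forall x, below (v x) (value rho x).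
Proof.
move=> vr h x; have [L _] := path_limit v (play_path x vr).
rewrite play_source// in L; apply: L => k.
by rewrite [source _](vr _).2; exact: h.
Qed.

Lemma value_below rho (v : node G -> infinite_word A) : valid rho ->
  (forall x, below (prepend [:: label (rho x)] (v (target (rho x)))) (v x)) ->
  forall x, below (value rho x) (v x).
Proof.
move=> vr h x; have [_ L] := path_limit v (play_path x vr).
rewrite play_source// in L; apply: L => k.
by rewrite [source _](vr _).2; exact: h.
Qed.

Lemma use_valid rho e : valid rho -> e \in edges G -> valid (use (@source _ G) rho e).
Proof. by move=> vr eE x; rewrite ffunE; case: eqP => [->|_]. Qed.

Definition strictly_below (v v' : node G -> infinite_word A) : Prop :=
  (forall x, below (v x) (v' x)) /\ exists x, ~ below (v' x) (v x).

Lemma improving_min rho e : valid rho -> e \in edges G ->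
  source e \notin max_nodes G -> improving rho e ->
  strictly_below (value (use (@source _ G) rho e)) (value rho).
Proof.
move=> vr eE se /asboolP; rewrite (negbTE se) => imp.
have vu := use_valid vr eE.
have le : forall x, below (value (use (@source _ G) rho e) x) (value rho x).
  apply: value_below => // x; rewrite ffunE; case: eqP => [->|_].
    exact: entering_total'.
  by rewrite -/(entering rho (rho x)) entering_self.
(* If the value at the source did not strictly drop, the old value would be below the word entering
   through [e]. *)
split=> //; exists (source e) => h; apply: imp; apply: below_trans h _.
rewrite value_step /out /next ffunE eqxx; exact: below_prepend.
Qed.

Definition min_optimal rho : Prop := forall e, e \in edges G ->
  source e \notin max_nodes G -> ~~ improving rho e.

(** [rho'] may do anything at Min's nodes: as [rho] is already a best response there, no edge of Min
    leads below the values of [rho]. *)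
Lemma improving_max rho e rho' : valid rho -> e \in edges G ->
  source e \in max_nodes G -> improving rho e -> min_optimal rho ->
  valid rho' ->
  (forall x, x \in max_nodes G -> rho' x = use (@source _ G) rho e x) ->
  strictly_below (value rho) (value rho').
Proof.
move=> vr eE se /asboolP; rewrite se => imp opt vr' agree.
have le : forall x, below (value rho x) (value rho' x).
  apply: below_value => // x.
  have [xM|xM] := boolP (x \in max_nodes G).
    rewrite agree// ffunE; case: eqP => [->|_].
      exact: entering_total.
    by rewrite -/(entering rho (rho x)) entering_self.
  have [r'E r's] := vr' x.
  have := opt (rho' x) r'E; rewrite r's => /(_ xM) /asboolPn.
  by rewrite r's (negbTE xM) => /contrapT.
split=> //; exists (source e) => h; apply: imp; apply: below_trans _ h.
rewrite [X in below _ X]value_step /out /next agree// ffunE eqxx.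
exact: below_prepend.
Qed.

Lemma no_improving_max rho rho' : valid rho' ->
  (forall x, x \notin max_nodes G -> rho' x = rho x) ->
  (forall x, x \in max_nodes G -> ~~ improving rho (rho' x)) ->
  forall x, below (value rho' x) (value rho x).
Proof.
move=> vr' agree h; apply: value_below => // x.
have [xM|xM] := boolP (x \in max_nodes G).
  have /asboolPn := h x xM.
  by rewrite (vr' x).2 xM => /contrapT.
by rewrite agree// -/(entering rho (rho x)) entering_self.
Qed.

Lemma no_improving_min rho rho' : valid rho' ->
  (forall x, x \in max_nodes G -> rho' x = rho x) ->
  (forall x, x \notin max_nodes G -> ~~ improving rho (rho' x)) ->
  forall x, below (value rho x) (value rho' x).
Proof.
move=> vr' agree h; apply: below_value => // x.
have [xM|xM] := boolP (x \in max_nodes G); last first.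
  have /asboolPn := h x xM.
  by rewrite (vr' x).2 (negbTE xM) => /contrapT.
by rewrite agree// -/(entering rho (rho x)) entering_self.
Qed.

Definition fixed_strategy rho : strategy G := fun s p => rho (path_target s p).

(** Both values are the payoff of the play of [rho]. Against a fixed side, no edge of a deviating
    path compares the wrong way, so [path_limit] with the empty prefix bounds its payoff. *)
Lemma equilibrium rho : valid rho ->
  (forall e, e \in edges G -> ~~ improving rho e) ->
  positional_equilibrium phi (fixed_strategy rho) (fixed_strategy rho).
Proof.
move=> vr noimp.
have strat U : is_strategy U (fixed_strategy rho) /\ positional U (fixed_strategy rho).
  by split=> [s p _ _|s p s' p' _ _ _ e]; [exact: vr | rewrite /fixed_strategy e].
split; [exact: strat | exact: strat | move=> s].
have [M bM] := phi_bounded.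
have lbd (S : set (nat -> arrow G)) : has_lbound [set phi (infinite_label P) | P in S].
  by exists (- M) => _ [P _ <-]; have := bM (infinite_label P); rewrite ler_norml => /andP[].
have ubd (S : set (nat -> arrow G)) : has_ubound [set phi (infinite_label P) | P in S].
  by exists M => _ [P _ <-]; have := bM (infinite_label P); rewrite ler_norml => /andP[].
have cons U : consistent U s (fixed_strategy rho) (play rho s).
  apply/positional_consistent; [exact: play_path|exact: play_source|exact: (strat U).2|].
  by move=> k _; rewrite /fixed_strategy /= [source _](vr _).2.
have own U P : consistent U s (fixed_strategy rho) P ->
    [/\ is_infinite_path P, source (P 0%N) = s &
      forall k, source (P k) \in U -> P k = rho (source (P k))].
  move=> c; have [ip s0 _] := c; split=> //.
  by apply/(positional_consistent ip s0 (strat U).2).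
transitivity (phi (value rho s)).
  apply/eqP; rewrite eq_le; apply/andP; split.
    by apply: ge_inf => //; exists (play rho s); first exact: cons.
  apply: lb_le_inf; first by exists (phi (value rho s)), (play rho s); first exact: cons.
  move=> _ [P /own[ip s0 oP] <-].
  have [L _] := path_limit (value rho) ip; rewrite s0 in L.
  have := L _ [::]; rewrite !prepend_nil; apply => k.
  have [kM|kM] := boolP (source (P k) \in max_nodes G).
    by rewrite -/(entering rho (P k)) {2}(oP k kM) entering_self.
  by have /asboolPn := noimp _ (ip k).1; rewrite (negbTE kM) => /contrapT.
apply/esym/eqP; rewrite eq_le; apply/andP; split; last first.
  by apply: ub_le_sup => //; exists (play rho s); first exact: cons.
apply: ge_sup; first by exists (phi (value rho s)), (play rho s); first exact: cons.
move=> _ [P /own[ip s0 oP] <-].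
have [_ L] := path_limit (value rho) ip; rewrite s0 in L.
have := L _ [::]; rewrite !prepend_nil; apply => k.
have [kM|kM] := boolP (source (P k) \in max_nodes G).
  by have /asboolPn := noimp _ (ip k).1; rewrite kM => /contrapT.
have kM' : source (P k) \in min_nodes G by rewrite inE.
by rewrite -/(entering rho (P k)) {1}(oP k kM') entering_self.
Qed.

Definition is_strat rho : bool := strat_in (@source _ G) (edges G) rho.

Lemma is_stratP rho : reflect (valid rho) (is_strat rho).
Proof. exact: strat_inP. Qed.

(** A numerical potential for the preorder on strategies: it counts, over all nodes, the reference
    values of strategies that the value of [rho] is not below, so it grows when [rho] improves. *)
Definition rank rho : nat := #|[pred t : node G * (joint * node G) | is_strat t.2.1 &&
   `[< ~ below (value rho t.1) (value t.2.1 t.2.2) >]]|.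

Definition rank_max : nat := #|{: node G * (joint * node G)}|.

Lemma rank_le_max rho : (rank rho <= rank_max)%N.
Proof. exact: max_card. Qed.

Lemma rank_le rho rho' : (forall x, below (value rho x) (value rho' x)) ->
  (rank rho <= rank rho')%N.
Proof.
move=> le; apply/subset_leq_card/fintype.subsetP => t; rewrite !inE => /andP[st /asboolP h].
by apply/andP; split=> //; apply/asboolP => h'; apply: h; apply: below_trans (le _) h'.
Qed.

Lemma rank_lt rho rho' : valid rho -> strictly_below (value rho) (value rho') ->
  (rank rho < rank rho')%N.
Proof.
move=> vr [le [x nle]]; apply/proper_card/fintype.properP; split.
  apply/fintype.subsetP => t; rewrite !inE => /andP[st /asboolP h].
  by apply/andP; split=> //; apply/asboolP => h'; apply: h; apply: below_trans (le _) h'.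
(* The old value at [x] is a reference value that the new one has strictly passed. *)
exists (x, (rho, x)); rewrite unfold_in /=; first by apply/andP; split; [exact/is_stratP|exact/asboolP].
by rewrite negb_and; apply/orP; right; apply/asboolPn => h; apply: h.
Qed.

End Improvement.

(** * The potentials and improvement tests of the two players *)

Section Levels.
Context (A : finType) (R : realType) (phi : infinite_word A -> R).
Hypothesis phi_bounded : bounded_payoff phi.
Hypothesis phi_continuous : continuous phi.
Hypothesis phi_determined : positionally_determined phi.
Context (G : game_graph A).
Local Notation joint := {ffun node G -> arrow G}.
Local Notation use := (use (@source _ G)).
Local Notation strat_in := (strat_in (@source _ G)).
Local Notation improving := (improving phi).
Local Notation rank := (rank phi).
Implicit Types (rho sigma zeta : joint) (e : arrow G).

(** Freezing the opponent's edges at [rho] makes the strategies of one player into joint strategies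
    inside a set of edges, as Random Facet expects. *)
Definition choices (b : bool) rho : {set arrow G} :=
  [set e | (e \in edges G) &&
    (((source e \in max_nodes G) == b) || (e == rho (source e)))].

Lemma choices_sub b rho : choices b rho \subset edges G.
Proof. by apply/fintype.subsetP => e; rewrite inE => /andP[]. Qed.

Lemma choices_valid b rho rho' : strat_in (choices b rho) rho' -> valid rho'.
Proof. by move/(strat_in_sub (choices_sub b rho))/is_stratP. Qed.

Lemma choices_other b rho rho' x : strat_in (choices b rho) rho' ->
  (x \in max_nodes G) != b -> rho' x = rho x.
Proof.
move=> /strat_inP/(_ x)[]; rewrite inE => /andP[_ +] rs; rewrite rs.
by move=> /orP[->//|/eqP].
Qed.

Lemma strat_in_choices b rho : valid rho -> strat_in (choices b rho) rho.
Proof.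
by move=> v; apply/strat_inP => x; have [rE rs] := v x; rewrite inE rE rs eqxx orbT.
Qed.

Lemma improving_self rho x : valid rho -> ~~ improving rho (rho x).
Proof.
move=> v; apply/asboolPn; rewrite entering_self (v x).2.
by case: ifP => _ []; exact: below_refl.
Qed.

(** The rank is reversed because the abstract algorithm maximizes. *)
Definition cost_min rho : nat := rank_max G - rank rho.

Lemma cost_min_lt rho0 rho e : strat_in (choices false rho0) rho ->
  e \in choices false rho0 -> improving rho e ->
  (cost_min rho < cost_min (use rho e))%N.
Proof.
move=> vr eH imp; have v := choices_valid vr.
have [eE eH'] : e \in edges G /\ ((source e \in max_nodes G) == false) || (e == rho0 (source e)).
  by apply/andP; rewrite inE in eH.
have sM : source e \notin max_nodes G.
  (* At a node of Max the only edge available is the current one, which never improves. *)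
  apply/negP => sM; rewrite sM /= in eH'.
  have := improving_self (source e) v.
  by rewrite (choices_other vr) ?sM// -(eqP eH') imp.
have := rank_lt (use_valid v eE) (improving_min phi_bounded phi_continuous phi_determined v eE sM imp).
by have := rank_le_max phi rho; rewrite /cost_min; lia.
Qed.

Lemma cost_min_opt rho0 (H : {set arrow G}) rho : H \subset choices false rho0 ->
  strat_in H rho ->
  (forall e, e \in H -> rho (source e) != e -> ~~ improving rho e) ->
  forall zeta, strat_in H zeta -> (cost_min zeta <= cost_min rho)%N.
Proof.
move=> Hs vr noimp zeta vz; apply: leq_sub2l; apply: rank_le.
have vr' := strat_in_sub Hs vr; have vz' := strat_in_sub Hs vz.
apply: (no_improving_min phi_continuous) => [|x xM|x xM].
- exact: choices_valid vz'.
- by rewrite (choices_other vr') ?(choices_other vz') ?xM.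
- have [zH zs] := strat_inP _ _ _ vz x.
  have [<-|ne] := eqVneq (rho x) (zeta x).
    exact/improving_self/choices_valid/vr'.
  by apply: noimp => //; rewrite zs.
Qed.

Definition agree rho sigma : bool :=
  [forall x, (x \in max_nodes G) ==> (rho x == sigma x)].

Lemma agreeP rho sigma :
  reflect (forall x, x \in max_nodes G -> rho x = sigma x) (agree rho sigma).
Proof.
by apply: (iffP forallP) => h x; [move=> xM; apply/eqP; have := h x; rewrite xM
  | apply/implyP => /h ->].
Qed.

(** The least rank over Min's replies to [sigma], expressed through a maximum of complements. *)
Definition cost_max sigma : nat :=
  rank_max G - \max_(zeta | is_strat zeta && agree zeta sigma) (rank_max G - rank zeta).

Definition responsive rho sigma : Prop :=
  [/\ valid rho, agree rho sigma & min_optimal phi rho].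

Lemma cost_maxE rho sigma : responsive rho sigma -> cost_max sigma = rank rho.
Proof.
move=> [v ag opt]; rewrite /cost_max.
have -> : \max_(zeta | is_strat zeta && agree zeta sigma) (rank_max G - rank zeta) =
    (rank_max G - rank rho)%N.
  apply/eqP; rewrite eqn_leq; apply/andP; split; last first.
    apply: (leq_bigmax_cond (F := fun zeta => rank_max G - rank zeta)%N).
    by rewrite ag andbT; apply/is_stratP.
  apply/bigmax_leqP => zeta /andP[/is_stratP vz agz]; apply/leq_sub2l/rank_le.
  apply: (no_improving_min phi_continuous) => // [x xM|x xM].
    by rewrite (agreeP _ _ agz)// (agreeP _ _ ag).
  have [zE zs] := vz x; apply: opt => //; by rewrite zs.
by have := rank_le_max phi rho; lia.
Qed.

(** A reply of least rank is optimal, since an improving switch of Min would lower the rank. *)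
Lemma ex_responsive sigma : valid sigma -> exists rho, responsive rho sigma.
Proof.
move=> v; pose P rho := is_strat rho && agree rho sigma.
have Ps : P sigma by apply/andP; split; [exact/is_stratP|exact/agreeP].
case: (arg_minnP (@rank G) Ps) => rho /andP[/is_stratP vr ag] mn.
exists rho; split=> // e eE sM; apply/negP => imp.
have lt := rank_lt (use_valid vr eE) (improving_min phi_bounded phi_continuous phi_determined vr eE sM imp).
have : P (use rho e).
  apply/andP; split; first exact/is_stratP/use_valid.
  apply/agreeP => x xM; rewrite ffunE; case: eqP => [xe|_]; last exact: (agreeP _ _ ag).
  by rewrite -xe xM in sM.
by move=> /mn; rewrite leqNgt lt.
Qed.

Definition improving_response sigma e : bool :=
  (source e \in max_nodes G) && `[< exists rho, responsive rho sigma /\ improving rho e >].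

(** Any two best responses to [sigma] have equivalent values at every node, so the test gives the
    same answer with either of them. *)
Lemma improving_responseE rho sigma e : responsive rho sigma ->
  source e \in max_nodes G -> improving_response sigma e = improving rho e.
Proof.
move=> r sM; rewrite /improving_response sM /=; apply/asboolP/idP; last by move=> i; exists rho.
move=> [rho' [r' /asboolP i]]; apply/asboolP; move: i; rewrite sM => i h; apply: i.
have eqv rho1 rho2 : responsive rho1 sigma -> responsive rho2 sigma ->
    forall x, below phi (value rho1 x) (value rho2 x).
  move=> [v1 ag1 opt1] [v2 ag2 opt2]; apply: (no_improving_min phi_continuous) => // x xM.
    by rewrite (agreeP _ _ ag1)// (agreeP _ _ ag2).
  by have [zE zs] := v2 x; apply: opt1 => //; rewrite zs.
apply: below_trans (eqv _ _ r r' _); apply: below_trans _ h.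
exact/below_prepend/eqv.
Qed.

Lemma cost_max_lt rho0 sigma e : strat_in (choices true rho0) sigma ->
  e \in choices true rho0 -> improving_response sigma e ->
  (cost_max sigma < cost_max (use sigma e))%N.
Proof.
move=> vs eH imp; have v := choices_valid vs.
have /andP[sM /asboolP[rho [r i]]] := imp.
have eE : e \in edges G by rewrite inE in eH; case/andP: eH.
rewrite (cost_maxE r); have [rho' r'] := ex_responsive (use_valid v eE).
rewrite (cost_maxE r'); have [vr agr optr] := r; have [vr' agr' _] := r'.
apply: rank_lt => //; apply: (improving_max phi_bounded phi_continuous phi_determined vr eE) => //.
move=> x xM; rewrite (agreeP _ _ agr')// !ffunE; case: eqP => // _.
by rewrite (agreeP _ _ agr).
Qed.

Lemma cost_max_opt rho0 (H : {set arrow G}) sigma : H \subset choices true rho0 ->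
  strat_in H sigma ->
  (forall e, e \in H -> sigma (source e) != e -> ~~ improving_response sigma e) ->
  forall zeta, strat_in H zeta -> (cost_max zeta <= cost_max sigma)%N.
Proof.
move=> Hs vs noimp zeta vz.
have v := choices_valid (strat_in_sub Hs vs).
have v' := choices_valid (strat_in_sub Hs vz).
have [rho r] := ex_responsive v; have [rho' r'] := ex_responsive v'.
have [vr agr optr] := r; have [vr' agr' optr'] := r'.
rewrite (cost_maxE r) (cost_maxE r').
(* The mixture sits between the two ranks: [rho'] answers [zeta] at least as well as Min's part of
   [rho] does, and the edges of [zeta] do not improve on [rho] for Max. *)
pose mix : joint := [ffun x => if x \in max_nodes G then zeta x else rho x].
have vm : valid mix by move=> x; rewrite ffunE; case: ifP.
apply: (@leq_trans (rank mix)); apply: rank_le.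
  apply: (no_improving_min phi_continuous) => // x xM.
    by rewrite ffunE xM (agreeP _ _ agr').
  by have [mE ms] := vm x; apply: optr' => //; rewrite ms.
apply: (no_improving_max phi_continuous) => // x xM; rewrite ffunE ?(negbTE xM)// xM.
have [zH zs] := strat_inP _ _ _ vz x.
rewrite -(improving_responseE r) ?zs//.
have [e|ne] := eqVneq (sigma x) (zeta x); last by apply: noimp => //; rewrite zs.
rewrite -e (improving_responseE r) ?(v x).2//.
by rewrite -(agreeP _ _ agr _ xM) improving_self.
Qed.

End Levels.

(** * Oracle answers for ultimately periodic words *)

Section Oracle.
Context (A : finType) (R : realType) (phi : infinite_word A -> R).
Context (G : game_graph A).
Implicit Types (rho : {ffun node G -> arrow G}).

Lemma cycle_word_neq0 rho x w : cycle_word rho x w ->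
  exists v : nonempty_word A, w = word_of v /\ (size w <= order_of G)%N.
Proof.
move=> [p [/andP[p0 pN] _ wE]].
have sw : size w = p by rewrite wE size_mkseq.
case: w sw {wE} => [|a u] sw; first by rewrite -sw in p0.
by exists (a, u); rewrite sw.
Qed.

Lemma cycle_word_value rho x (v : nonempty_word A) : cycle_word rho x (word_of v) ->
  prepend (stem rho x) (omega_power v) = value rho x.
Proof.
move=> [p [/andP[p0 _] per wE]]; set b := iter (order_of G) _ _ in per wE.
apply/funext => i; rewrite /prepend size_mkseq.
have [lt|ge] := ltnP i (order_of G); first by rewrite nth_mkseq.
rewrite nth_default ?size_mkseq// /omega_power wE size_mkseq nth_mkseq ?ltn_mod//.
rewrite /value -[in RHS](subnK ge) iterD -/b; congr (out rho _).
rewrite [in RHS](divn_eq (i - order_of G) p) addnC iterD; congr (iter _ _ _).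
by elim: (_ %/ _)%N => [|k IH]; rewrite ?mul0n// mulSn iterD -IH per.
Qed.

Lemma tree_of_nat_inj : injective tree_of_nat.
Proof. by elim=> [|n IH] [|k] //= [/IH ->]. Qed.

Lemma tree_of_word_inj : injective (@tree_of_word A).
Proof.
elim=> [|a u IH] [|b w] //= [/tree_of_nat_inj ab /IH ->].
by congr (_ :: _); apply/enum_rank_inj/val_inj.
Qed.

Lemma payoff_oracleE (u a : seq A) (v b : nonempty_word A) :
  payoff_oracle phi (tree_of_word u) (tree_of_word (word_of v))
    (tree_of_word a) (tree_of_word (word_of b)) =
  `[< ~ below phi (prepend u (omega_power v)) (prepend a (omega_power b)) >].
Proof.
apply/asboolP/asboolP => [[u' [v' [a' [b' [+ + + +]]]]]|/not_below[w h]].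
  move=> /tree_of_word_inj -> /tree_of_word_inj vv /tree_of_word_inj -> /tree_of_word_inj bb.
  have -> : v = v' by case: v v' vv => [? ?] [? ?] /= [-> ->].
  have -> : b = b' by case: b b' bb => [? ?] [? ?] /= [-> ->].
  by move=> [w h]; apply/not_below; exists w; rewrite -!prepend_cat.
exists u, v, a, b; split=> //; exists w; by rewrite !prepend_cat.
Qed.

Definition short_query (l : nat) (q : tree * tree * tree * tree) : Prop :=
  exists (u : seq A) (v : nonempty_word A) (a : seq A) (b : nonempty_word A),
    q = (tree_of_word u, tree_of_word (word_of v), tree_of_word a,
         tree_of_word (word_of b)) /\
    [/\ (size u <= l)%N, (size (word_of v) <= l)%N,
        (size a <= l)%N & (size (word_of b) <= l)%N].

Lemma payoff_oracle_decides :
  oracle_decides (payoff_oracle phi) (short_query (2 * order_of G)) (G := G)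
    (@improving _ _ phi G).
Proof.
move=> rho e w w' cw cw'.
have [v [wE szw]] := cycle_word_neq0 cw; have [v' [wE' szw']] := cycle_word_neq0 cw'.
rewrite {}wE in cw szw *; rewrite {}wE' in cw' szw' *.
(* The longest query word is a stem preceded by one label, of length N + 1, which is at most 2N as
   there is a node. *)
have N0 : (0 < order_of G)%N by apply/card_gt0P; exists (source e).
have szu x : (size (stem rho x) <= 2 * order_of G)%N.
  by rewrite size_mkseq; lia.
have szu' : (size (label e :: stem rho (target e)) <= 2 * order_of G)%N.
  by rewrite /= size_mkseq; lia.
have {}szw : (size (word_of v) <= 2 * order_of G)%N by lia.
have {}szw' : (size (word_of v') <= 2 * order_of G)%N by lia.
have eE : prepend (label e :: stem rho (target e)) (omega_power v') = entering rho e.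
  by rewrite prepend_cons cycle_word_value.
rewrite /improving; case: (source e \in _) => /=.
  split; first by exists (label e :: stem rho (target e)), v', (stem rho (source e)), v.
  by rewrite payoff_oracleE eE cycle_word_value.
split; first by exists (stem rho (source e)), v, (label e :: stem rho (target e)), v'.
by rewrite payoff_oracleE eE cycle_word_value.
Qed.

End Oracle.

(** * The expected running time of the program *)

Section Run.
Context (A : finType) (R : realType) (phi : infinite_word A -> R).
Hypothesis phi_bounded : bounded_payoff phi.
Hypothesis phi_continuous : continuous phi.
Hypothesis phi_determined : positionally_determined phi.
Context (G : game_graph A) (post : store -> Prop).
Local Notation joint := {ffun node G -> arrow G}.
Local Notation use := (use (@source _ G)).
Local Notation strat_in := (strat_in (@source _ G)).
Local Notation unused := (unused (@source _ G)).
Local Notation improving := (@improving _ _ phi G).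
Local Notation N := (order_of G).
Local Notation m := #|edges G|.
Local Notation query_ok := (short_query A (2 * N)).
Local Notation O := (payoff_oracle phi).
Local Notation good := (good O query_ok post).
Local Notation triple := (triple O query_ok).
Implicit Types (rho sigma : joint) (e : arrow G) (P L Q : seq (arrow G)).
Implicit Types (H : {set arrow G}) (r : R) (k : seq cmd) (s : store).

Definition scan_time : nat := m * (300 * N ^ 2 + 400 * N + 300) + 10.

Lemma unused_size H sigma P : H \subset edges G -> unused H sigma P -> (size P <= m)%N.
Proof.
move=> Hs [uP mP]; rewrite -(card_uniqP uP); apply/subset_leq_card/fintype.subsetP => e.
by rewrite mP => /andP[/(fintype.subsetP Hs)].
Qed.

Section Level.
Context (tail : seq cmd) (inv : joint -> store -> Prop) (H0 : {set arrow G}).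
Hypothesis inv_stable : forall sigma s s',
  same_but (modified shuffle) s s' -> inv sigma s -> inv sigma s'.
Hypothesis H0_sub : H0 \subset edges G.

Definition shuffling sigma P L (c : config) : Prop := exists s,
  [/\ c = (shuffle :: tail, s), inv sigma s,
      s vPool = tree_of_arrows P, s vStack = tree_of_arrows L &
      unused H0 sigma (P ++ L)].

Definition scanning sigma L (c : config) : Prop := exists s,
  [/\ c = (tail, s), inv sigma s, s vPool = Nil, s vStack = tree_of_arrows L &
      unused H0 sigma L].

Lemma shuffling_nil sigma L c r (B : R) : 1 <= B -> shuffling sigma [::] L c ->
  (forall c', scanning sigma L c' -> good c' r) -> good c (B + r).
Proof.
move=> B1 [s [-> i p l u]] h; apply: (@good_le _ _ _ _ _ (1 + r)); first by rewrite lerD2r.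
by apply: shuffle_done => //; apply: h; exists s.
Qed.

Lemma shuffling_cons sigma P L c (cost : arrow G -> R) (B : R) :
  (200 * m + 20)%:R <= B -> uniq P -> P != [::] -> shuffling sigma P L c ->
  (forall e Q c', e \in P -> perm_eq (e :: Q) P -> shuffling sigma Q (e :: L) c' ->
    good c' (cost e)) ->
  exists w : arrow G -> R, [/\ forall e, e \in P -> 0 <= w e,
    \sum_(e <- P) w e = 1,
    forall j e, (2 ^ j <= size P)%N -> e \in P -> w e <= (2 ^+ j)^-1 &
    good c (B + \sum_(e <- P) w e * cost e)].
Proof.
move=> lB uP Pn [s [-> i p l u]] h.
have [e Y s' eP pY p' l' sb|w [w0 w1 wj g]] :=
  @shuffle_good O query_ok A G R post P L s tail cost uP Pn p l.
  apply: (h e Y) => //; exists s'; split=> //; first exact: inv_stable sb i.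
  by apply: unused_perm u; rewrite -cat_rcons perm_cat2r perm_sym perm_rcons.
exists w; split=> //; apply: good_le g; rewrite lerD2r (le_trans _ lB)// ler_nat.
by rewrite leq_add2r leq_mul2l (leq_trans _ (unused_size H0_sub u))// size_cat leq_addr.
Qed.

End Level.

(** Identifies the edge found by the program's scan with the first improving edge of the abstract
    analysis. *)
Lemma split_unique (T : Type) (a : pred T) (p q p' q' : seq T) (e e' : T) :
  p ++ e :: q = p' ++ e' :: q' -> ~~ has a p -> a e -> ~~ has a p' -> a e' ->
  [/\ p = p', e = e' & q = q'].
Proof.
elim: p p' => [|x p IH] [|x' p'] //= [].
- by move=> -> ->.
- by move=> -> _ _ ae; rewrite ae.
- by move=> <- _ + _ _ ae'; rewrite ae'.
- move=> -> /IH h; rewrite !negb_or => /andP[_ np] ae /andP[_ np'] ae'.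
  by have [-> -> ->] := h np ae np' ae'.
Qed.

Lemma enter_improve evaluate k s r : truthy (s vLoop) ->
  good (shuffle :: block [:: evaluate; scan] :: improve evaluate :: k, s) r ->
  good (improve evaluate :: k, s) (2 + r).
Proof.
move=> tl g; apply: (@good_le _ _ _ _ _ (1 + (1 + r))); first lra.
by apply: good_while_true => //; apply: good_block_cons.
Qed.

Lemma leave_improve evaluate k s r : s vLoop = Nil -> good (k, s) r ->
  good (improve evaluate :: k, s) (1 + r).
Proof. by move=> tl g; apply: good_while_false; rewrite //= tl. Qed.

Definition reserve (b : bool) rho P : Prop :=
  uniq P /\ forall e, (e \in P) =
    [&& e \in edges G, (source e \in max_nodes G) == b & rho (source e) != e].

Lemma reserve_unused b rho0 rho P : strat_in (choices b rho0) rho ->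
  unused (choices b rho0) rho P <-> reserve b rho P.
Proof.
move=> v; rewrite /unused /reserve.
have E e : (e \in choices b rho0) && (rho (source e) != e) =
    [&& e \in edges G, (source e \in max_nodes G) == b & rho (source e) != e].
  rewrite inE -andbA; congr (_ && _).
  have [//|ne] := boolP ((source e \in max_nodes G) == b).
  rewrite (choices_other v ne) [rho0 _ == e]eq_sym /=.
  by case: eqP.
by split=> -[uP mP]; split=> // e; rewrite mP E.
Qed.

Lemma reserve_same b rho rho' P :
  (forall x, (x \in max_nodes G) == b -> rho' x = rho x) ->
  reserve b rho P -> reserve b rho' P.
Proof.
move=> h [uP mP]; split=> // e; rewrite mP; congr (_ && _).
by have [/h ->|//] := boolP ((source e \in max_nodes G) == b).
Qed.

Lemma scan_good rho L k s r : valid rho -> s vPool = Nil ->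
  s vStack = tree_of_arrows L -> s vRho = tree_of_joint rho ->
  s vFlags = tree_of_flags G -> (size L <= m)%N ->
  (forall s', scan_found improving rho [::] L s' \/ scan_exhausted improving rho [::] L s' ->
     same_but (modified scan) s s' -> good (k, s') r) ->
  good (scan :: k, s) (scan_time%:R + r).
Proof.
move=> v sp sl sr sf szL h.
apply: (triple_good (triple_le _ (scan_triple (@payoff_oracle_decides A R phi G) (P := [::]) sp sl sr sf))) => //.
by rewrite /scan_time leq_add2r leq_mul2r szL orbT.
Qed.

Context (facet : nat).
Hypothesis facet_gt0 : (0 < facet)%N.

(** The bound of [random_facet] in units of [B], made uniform: the hidden dimension is at most N and
    the pool has at most m edges. *)
Definition steps : R := (facet.+1%:R / facet%:R) ^+ N * facet_growth R facet m.

Lemma facet_growth_mono (i j : nat) : (i <= j)%N ->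
  facet_growth R facet i <= facet_growth R facet j.
Proof.
move=> le; rewrite /facet_growth ler_pM ?exprn_ge0//.
  by apply: ler_weXn2l; [rewrite ler1n | rewrite leq_min geq_minr (leq_trans (geq_minl _ _))].
by rewrite lerXn2r ?nnegrE// ler_nat.
Qed.

Lemma steps_ge (X : {set node G}) j : (j <= m)%N ->
  (facet.+1%:R / facet%:R) ^+ #|X| * facet_growth R facet j <= steps.
Proof.
have x1 : 1 <= facet.+1%:R / facet%:R :> R by rewrite ler_pdivlMr ?ltr0n// mul1r ler_nat.
move=> le; apply: ler_pM.
- by apply: exprn_ge0; apply: le_trans x1.
- by apply: le_trans (facet_growth_ge1 _ _ _).
- by apply: ler_weXn2l => //; exact: max_card.
- exact: facet_growth_mono.
Qed.

Lemma steps_ge1 : 1 <= steps.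
Proof.
have x1 : 1 <= facet.+1%:R / facet%:R :> R by rewrite ler_pdivlMr ?ltr0n// mul1r ler_nat.
by rewrite mulr_ege1// ?exprn_ege1//; exact: facet_growth_ge1.
Qed.

Definition round_min : R := (scan_time + 200 * m + 40)%:R.

(** The extra [round_min] pays for the last, unsuccessful scan, which [random_facet] leaves to the
    continuation; the 2 pays for entering the loop. *)
Lemma improve_min rho P k s r : valid rho ->
  s vFlags = tree_of_flags G -> s vRho = tree_of_joint rho ->
  s vPool = tree_of_arrows P -> s vStack = Nil -> truthy (s vLoop) ->
  reserve false rho P ->
  (forall rho' P' s', valid rho' -> 
    (forall x, x \in max_nodes G -> rho' x = rho x) -> min_optimal phi rho' ->
    s' vFlags = tree_of_flags G -> s' vRho = tree_of_joint rho' ->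
    s' vPool = tree_of_arrows P' -> s' vStack = Nil -> s' vSave = s vSave ->
    reserve false rho' P' -> good (k, s') r) ->
  good (improve Skip :: k, s) (2 + (steps * round_min + (round_min + r))).
Proof.
move=> vr sf sr sp sl lp rP h; apply: enter_improve => //.
pose H := choices false rho.
pose tail := [:: block [:: Skip; scan], improve Skip & k].
pose inv (rho' : joint) s' := [/\ strat_in H rho', s' vFlags = tree_of_flags G,
  s' vRho = tree_of_joint rho' & s' vSave = s vSave].
have Hs : H \subset edges G by exact: choices_sub.
have vH : strat_in H rho by exact: strat_in_choices.
have inv_st rho' s1 s2 : same_but (modified shuffle) s1 s2 -> inv rho' s1 -> inv rho' s2.
  by move=> sb [? ? ? ?]; split=> //; rewrite sb.
have uP : unused H rho P by apply/reserve_unused.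
have round1 : 0 <= round_min by [].
have scanS rho' L c r' : scanning tail inv H rho' L c ->
    (forall s1, scan_found improving rho' [::] L s1 \/ scan_exhausted improving rho' [::] L s1 ->
      s1 vFlags = tree_of_flags G -> s1 vSave = s vSave ->
      good (improve Skip :: k, s1) r') ->
    good c (scan_time%:R + 10 + r').
  move=> [s1 [-> [i1 i2 i3 i4] p1 l1 u1]] g1.
  apply: (@good_le _ _ _ _ _ (1 + (1 + (1 + (scan_time%:R + (1 + r')))))); first lra.
  apply: good_block_cons; apply: good_skip.
  apply: good_block_cons; apply: (scan_good (rho := rho') (L := L)) => //.
  - exact: choices_valid i1.
  - exact: unused_size u1.
  by move=> s2 fe sb; apply: good_block_nil; apply: g1; rewrite ?sb.
have sh : shuffling tail inv H rho P [::] (shuffle :: tail, s).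
  by exists s; split=> //; rewrite cats0.
have main := @random_facet R _ _ (@source _ G) H (cost_min phi (G := G)) improving
  (@cost_min_lt _ _ _ phi_bounded phi_continuous phi_determined G rho)
  (@cost_min_opt _ _ _ phi_continuous G rho)
  config good round_min facet (shuffling tail inv H) (scanning tail inv H)
  (@good_le _ _ _ _) round1 facet_gt0 _ _ _ H rho P [::] (shuffle :: tail, s) (round_min + r)
  (fintype.subxx _) vH uP sh.
apply: good_le; last apply: main.
- by rewrite lerD2r ler_wpM2r// steps_ge// (unused_size Hs uP).
- move=> rho' L c r' sh' g'; apply: shuffling_nil sh' g'.
  by rewrite /round_min ler1n addn_gt0 orbT.
- move=> rho' P' L c cost; apply: shuffling_cons => //.
  by rewrite /round_min ler_nat; lia.
- move=> rho' p e L c r' sc np ie g'.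
  apply: (@good_le _ _ _ _ _ (scan_time%:R + 10 + (2 + r'))).
    have : (scan_time + 12)%:R <= round_min by rewrite ler_nat; lia.
    rewrite natrD; lra.
  have [s0 [_ [i1 _ _ _] _ _ u0]] := sc.
  apply: scanS sc _ => s1 + f1 v1 => -[|[]]; last by rewrite has_cat /= ie orbT.
  move=> [p' [e' [L' [E np' ie' [a1 a2 a3 a4]]]]].
  have [pE eE LE] := split_unique E np ie np' ie'.
  rewrite -eE in a1 a2; rewrite -pE in a2; rewrite -LE in a3.
  apply: enter_improve => //; apply: g'; exists s1.
  have uE : unused H rho' (e :: (p ++ L)).
    by apply: unused_perm u0; rewrite -cat1s perm_catCA.
  have eH : e \in H by have := uE.2 e; rewrite inE eqxx => /esym/andP[].
  split=> //.
    by split=> //; exact: strat_in_use.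
  apply: unused_perm (unused_use i1 uE).
  by rewrite cat_cons perm_cons perm_cat2r perm_sym perm_rev.
- move=> rho' P' c' vr' uP' np; rewrite cats0 => sc.
  apply: (@good_le _ _ _ _ _ (scan_time%:R + 10 + (1 + r))).
    have : (scan_time + 11)%:R <= round_min by rewrite ler_nat; lia.
    by rewrite natrD; lra.
  have v' := choices_valid vr'.
  apply: scanS sc _ => s1 + f1 v1 => -[[p' [e' [L' [E _ ie' _]]]]|[_ a1 a2 a3 a4]].
    by move: np; rewrite E has_cat /= ie' orbT.
  apply: leave_improve => //; apply: (h rho' (rev P')) => //.
  + by move=> x xM; apply: choices_other vr' _; rewrite xM.
  + move=> e eE sM; have [<-|ne] := eqVneq (rho' (source e)) e.
      exact: improving_self.
    move: np => /hasPn; apply; rewrite uP'.2 ne andbT inE eE /=.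
    by rewrite (negbTE sM).
  + by apply/(reserve_unused _ vr'); apply: unused_perm uP'; rewrite perm_sym perm_rev.
Qed.

Definition response_time : R := steps * round_min + round_min + 18.

Lemma best_response_good rho Q k s r : valid rho ->
  s vFlags = tree_of_flags G -> s vRho = tree_of_joint rho ->
  s vMinPool = tree_of_arrows Q -> reserve false rho Q ->
  (forall rho' Q' s', valid rho' ->
    (forall x, x \in max_nodes G -> rho' x = rho x) -> min_optimal phi rho' ->
    s' vFlags = tree_of_flags G -> s' vRho = tree_of_joint rho' ->
    s' vMinPool = tree_of_arrows Q' -> reserve false rho' Q' ->
    s' vPool = Nil -> s' vStack = s vStack -> good (k, s') r) ->
  good (best_response :: k, s) (response_time + r).
Proof.
move=> vr sf sr sq rQ h.
pose c0 (x : R) := 1 + (1 + x).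
apply: (@good_le _ _ _ _ _ (c0 (c0 (c0 (c0 (1 + (2 + (steps * round_min +
  (round_min + c0 (c0 (c0 (1 + r)))))))))))).
  by rewrite /c0 /response_time; lra.
do 4 (apply: good_block_cons; apply: good_assign).
apply: good_block_cons; apply: (improve_min (rho := rho) (P := Q)) => //.
move=> rho' Q' s' v' ag opt f' r' p' t' sv' rs'.
do 3 (apply: good_block_cons; apply: good_assign).
by apply: good_block_nil; apply: (h rho' Q').
Qed.

Definition round_max : R := response_time + (scan_time + 200 * m + 40)%:R.

Lemma response_time_ge0 : 0 <= response_time.
Proof.
have s0 : 0 <= steps by apply: le_trans steps_ge1.
by rewrite !addr_ge0// mulr_ge0.
Qed.

(** The strategy [sigma] of the analysis keeps Min's original edges, while the store holds a joint
    strategy that agrees with [sigma] only at Max's nodes: each best response starts from Min's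
    previous one. Both are switched along the same edge. *)
Lemma improve_max rho P Q k s r : valid rho ->
  s vFlags = tree_of_flags G -> s vRho = tree_of_joint rho ->
  s vPool = tree_of_arrows P -> s vStack = Nil -> truthy (s vLoop) ->
  reserve true rho P -> s vMinPool = tree_of_arrows Q -> reserve false rho Q ->
  (forall rho' s', valid rho' -> (forall e, e \in edges G -> ~~ improving rho' e) ->
    s' vRho = tree_of_joint rho' -> good (k, s') r) ->
  good (improve best_response :: k, s) (2 + (steps * round_max + (round_max + r))).
Proof.
move=> vr sf sr sp sl lp rP sq rQ h; apply: enter_improve => //.
pose H := choices true rho.
pose tail := [:: block [:: best_response; scan], improve best_response & k].
pose inv sigma s' := strat_in H sigma /\ exists rho' Q',
  [/\ valid rho', agree rho' sigma, s' vFlags = tree_of_flags G,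
    s' vRho = tree_of_joint rho' & s' vMinPool = tree_of_arrows Q' /\
    reserve false rho' Q'].
have Hs : H \subset edges G by exact: choices_sub.
have vH : strat_in H rho by exact: strat_in_choices.
have inv_st sigma s1 s2 : same_but (modified shuffle) s1 s2 -> inv sigma s1 -> inv sigma s2.
  move=> sb [v [rho' [Q' [v' ag f' r' [q' rs']]]]]; split=> //.
  by exists rho', Q'; split=> //; rewrite sb.
have uP : unused H rho P by apply/reserve_unused.
have resp0 := response_time_ge0.
have round0 : 0 <= round_max by apply: addr_ge0 resp0 (ler0n _ _).
have sourceM sigma L e : strat_in H sigma -> unused H sigma L -> e \in L ->
    source e \in max_nodes G.
  by move=> v /(reserve_unused _ v) [_ ->] /and3P[_ /eqP].
have scanS sigma L c r' : scanning tail inv H sigma L c ->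
    (forall rho' Q' s1, responsive phi rho' sigma ->
      scan_found improving rho' [::] L s1 \/ scan_exhausted improving rho' [::] L s1 ->
      s1 vFlags = tree_of_flags G -> s1 vMinPool = tree_of_arrows Q' ->
      reserve false rho' Q' -> good (improve best_response :: k, s1) r') ->
    good c (response_time + (scan_time%:R + 10 + r')).
  move=> [s1 [-> [v [rho1 [Q1 [v1 ag1 f1 r1 [q1 rs1]]]]] p1 l1 u1]] g1.
  apply: (@good_le _ _ _ _ _ (1 + (response_time + (1 + (scan_time%:R + (1 + r')))))).
    by lra.
  apply: good_block_cons; apply: (best_response_good (rho := rho1) (Q := Q1)) => //.
  move=> rho2 Q2 s2 v2 ag2 opt2 f2 r2 q2 rs2 p2 l2.
  apply: good_block_cons; apply: (scan_good (rho := rho2) (L := L)) => //.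
  - by rewrite l2.
  - exact: unused_size u1.
  move=> s3 fe sb; apply: good_block_nil; apply: (g1 rho2 Q2) => //; rewrite ?sb//.
  split=> //; apply/agreeP => x xM; rewrite ag2//; exact: (agreeP _ _ ag1).
have sh : shuffling tail inv H rho P [::] (shuffle :: tail, s).
  exists s; split=> //; last by rewrite cats0.
  by split=> //; exists rho, Q; split=> //; exact/agreeP.
have main := @random_facet R _ _ (@source _ G) H (cost_max phi (G := G))
  (improving_response phi (G := G))
  (@cost_max_lt _ _ _ phi_bounded phi_continuous phi_determined G rho)
  (@cost_max_opt _ _ _ phi_bounded phi_continuous phi_determined G rho)
  config good round_max facet (shuffling tail inv H) (scanning tail inv H)
  (@good_le _ _ _ _) round0 facet_gt0 _ _ _ H rho P [::] (shuffle :: tail, s) (round_max + r)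
  (fintype.subxx _) vH uP sh.
have roundE : response_time + (scan_time + 12)%:R <= round_max.
  by rewrite lerD2l ler_nat; lia.
apply: good_le; last apply: main.
- by rewrite lerD2r ler_wpM2r// steps_ge// (unused_size Hs uP).
- move=> sigma L c r' sh' g'; apply: shuffling_nil sh' g'.
  by apply: ler_wpDl => //; rewrite ler1n addn_gt0 orbT.
- move=> sigma P' L c cost; apply: shuffling_cons => //.
  by apply: ler_wpDl => //; rewrite ler_nat; lia.
- move=> sigma p e L c r' sc np ie g'.
  apply: (@good_le _ _ _ _ _ (response_time + (scan_time%:R + 10 + (2 + r')))).
    by move: roundE; rewrite natrD; lra.
  have [s0 [_ [i1 _] _ _ u0]] := sc.
  have impE rho1 : responsive phi rho1 sigma -> {in p ++ e :: L,
      improving_response phi sigma =1 improving rho1}.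
    by move=> r1 e1 eL; apply: (improving_responseE phi_continuous r1); exact: sourceM i1 u0 eL.
  apply: scanS sc _ => rho1 Q1 s1 r1 + f1 q1 rs1.
  have np1 : ~~ has (improving rho1) p.
    rewrite -(eq_in_has (a1 := improving_response phi sigma))// => e1 e1p.
    by apply: impE r1 _ _; rewrite mem_cat e1p.
  have ie1 : improving rho1 e by rewrite -(impE _ r1)// mem_cat inE eqxx orbT.
  move=> -[|[]]; last by rewrite has_cat /= ie1 orbT.
  move=> [p' [e' [L' [E np' ie' [a1 a2 a3 a4]]]]].
  have [pE eE LE] := split_unique E np1 ie1 np' ie'.
  rewrite -eE in a1 a2; rewrite -pE in a2; rewrite -LE in a3.
  apply: enter_improve => //; apply: g'; exists s1.
  have uE : unused H sigma (e :: (p ++ L)).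
    by apply: unused_perm u0; rewrite -cat1s perm_catCA.
  have eH : e \in H by have := uE.2 e; rewrite inE eqxx => /esym/andP[].
  have eM : source e \in max_nodes G by apply: sourceM i1 uE _; rewrite inE eqxx.
  have [v1 ag1 _] := r1.
  have eG : e \in edges G by exact: (fintype.subsetP Hs).
  split=> //.
  + split; first exact: strat_in_use.
    exists (use rho1 e), Q1; split=> //.
    * exact: use_valid.
    * apply/agreeP => x xM; rewrite !ffunE; case: eqP => // _.
      exact: (agreeP _ _ ag1).
    * split=> //; apply: reserve_same rs1 => x xM; rewrite ffunE.
      by case: (x =P source e) => // xe; rewrite xe eM in xM.
  + by rewrite a2 (agreeP _ _ ag1).
  apply: unused_perm (unused_use i1 uE).
  by rewrite cat_cons perm_cons perm_cat2r perm_sym perm_rev.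
- move=> sigma P' c' vs uP' np; rewrite cats0 => sc.
  apply: (@good_le _ _ _ _ _ (response_time + (scan_time%:R + 10 + (1 + r)))).
    by move: roundE; rewrite natrD; lra.
  apply: scanS sc _ => rho1 Q1 s1 r1 fe f1 q1 rs1.
  have np1 : ~~ has (improving rho1) P'.
    rewrite -(eq_in_has (a1 := improving_response phi sigma))// => e1 e1p.
    by apply: (improving_responseE phi_continuous r1); exact: sourceM vs uP' e1p.
  have [v1 ag1 opt1] := r1.
  case: fe => [[p' [e' [L' [E _ ie' _]]]]|[_ a1 a2 a3 a4]].
    by move: np1; rewrite E has_cat /= ie' orbT.
  apply: leave_improve => //; apply: (h rho1) => // e eE.
  have [eM|eM] := boolP (source e \in max_nodes G); last exact: opt1.
  have [<-|ne] := eqVneq (rho1 (source e)) e; first exact: improving_self.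
  move: np1 => /hasPn; apply; rewrite uP'.2 -(agreeP _ _ ag1 _ eM) ne andbT inE eE /=.
  by rewrite eM.
Qed.

End Run.

(** * The initial strategies and pools *)

Section Initialization.
Context (O : oracle) (query_ok : tree * tree * tree * tree -> Prop).
Context (A : finType) (G : game_graph A).
Local Notation triple := (triple O query_ok).
Local Notation N := (order_of G).
Local Notation m := #|edges G|.
Local Notation joint := {ffun node G -> arrow G}.
Local Notation partial := {ffun node G -> option (arrow G)}.
Implicit Types (g : partial) (e : arrow G) (P Q done : seq (arrow G)).

(** An edge is encoded by a pair, never by [Nil], so the truth test of the language tells whether a
    slot is filled. *)
Definition slot (oe : option (arrow G)) : tree := oapp (@tree_of_arrow A G) Nil oe.

Definition reserved b done g P : Prop := uniq P /\ forall e,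
  (e \in P) = [&& e \in done, (source e \in max_nodes G) == b & g (source e) != Some e].

Definition assigned done g : Prop :=
  (forall x e, g x = Some e -> e \in done /\ source e = x) /\
  (forall e, e \in done -> g (source e)).

Lemma reserved_skip b done g e e0 P : e \notin done -> assigned done g ->
  g (source e) = Some e0 -> reserved b done g P ->
  reserved b (rcons done e) g
    (if (source e \in max_nodes G) == b then e :: P else P).
Proof.
move=> eD [gD Dg] ge [uP mP].
have eP : e \notin P by rewrite mP negb_and eD.
have e0e : e0 != e by apply: contraNneq eD => <-; have [] := gD _ _ ge.
split; first by case: ifP => //= _; rewrite uP eP.
move=> e'; rewrite mem_rcons inE; have [->|ne] := eqVneq e' e.
  rewrite ge -[Some e0 == Some e]/(e0 == e) e0e andbT /=.
  by case: ifP => _; rewrite ?inE ?eqxx// (negbTE eP).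
by case: ifP => _; rewrite ?inE ?(negbTE ne)/= mP.
Qed.

Lemma reserved_assign b done g e P : e \notin done -> assigned done g ->
  ~~ g (source e) -> reserved b done g P ->
  reserved b (rcons done e) [ffun x => if x == source e then Some e else g x] P.
Proof.
move=> eD [gD Dg] ge [uP mP]; split=> // e'; rewrite mP mem_rcons inE !ffunE.
have [->|ne] := eqVneq e' e; first by rewrite !eqxx (negbTE eD) !andbF.
have [/= eD'|//] := boolP (e' \in done); case: (source e' =P source e) => // se.
by have := Dg _ eD'; rewrite se (negbTE ge).
Qed.

Lemma assigned_skip done g e : g (source e) -> assigned done g ->
  assigned (rcons done e) g.
Proof.
move=> ge [gD Dg]; split=> [x e0 /gD[? ?]|e0]; first by rewrite mem_rcons inE orbC; split=> //; apply/orP; left.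
by rewrite mem_rcons inE => /orP[/eqP->|/Dg].
Qed.

Lemma assigned_assign done g e : assigned done g ->
  assigned (rcons done e) [ffun x => if x == source e then Some e else g x].
Proof.
move=> [gD Dg]; split=> [x e0|e0].
  rewrite ffunE mem_rcons inE; case: eqP => [-> [<-]|_ /gD[eD es]]; first by rewrite eqxx.
  by rewrite eD orbT.
by rewrite mem_rcons inE ffunE => /orP[/eqP->|/Dg gs]; rewrite ?eqxx//; case: ifP.
Qed.

Definition init_time : nat := m * (60 * N + 120) + 10 * N + 20.

Lemma initialize_triple s :
  s vIO = tree_of_game G -> s vRho = Nil -> s vPool = Nil -> s vMinPool = Nil ->
  triple s initialize init_time (fun s' => exists (rho : joint) P Q,
    [/\ valid rho, s' vFlags = tree_of_flags G, s' vRho = tree_of_joint rho,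
      s' vPool = tree_of_arrows P /\ reserve true rho P &
      s' vMinPool = tree_of_arrows Q /\ reserve false rho Q]).
Proof.
move=> si sr sp sq; eapply triple_le; last first.
eapply block_assign; eapply block_assign; eapply block_call.
  apply: (foreach_triple (t := 1) (enc := fun x => tree_of_bool (x \in max_nodes G))
    (xs := enum (node G)) (I := fun ys s' => (size ys <= N)%N /\
      s' vRho = tree_of_seq (nseq (N - size ys) Nil))) => //.
  - move=> x ys s' _ [/= le r]; apply: triple_assign; split; first exact: ltnW.
    by rewrite /update /= r -(subnSK le).
  - by rewrite /update /= si.
  - by rewrite size_enum_nodes /update /= subnn sr.
move=> s1 [_ [_ r1]] sb1.
rewrite subn0 in r1.
have f1 : s1 vFlags = tree_of_flags G by rewrite sb1// /update /= si.
eapply block_assign; eapply (@block_last _ _ _ _ (m * (50 * N + 100 + 7)).+1).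
- set s2 := update _ _ _.
  have uE : uniq (enum (edges G)) by exact: enum_uniq.
  pose I ys s' := exists done g P Q, [/\ enum (edges G) = done ++ ys,
    s' vRho = tree_of_seq [seq slot (g x) | x <- enum (node G)],
    assigned done g,
    s' vPool = tree_of_arrows P /\ reserved true done g P &
    s' vMinPool = tree_of_arrows Q /\ reserved false done g Q].
  apply: triple_weaken.
    rewrite cardE; apply: (foreach_triple (t := 50 * N + 100)
       (enc := @tree_of_arrow A G) (xs := enum (edges G)) (I := I)) => //.
    + move=> e ys s' sb [done [g [P [Q [De r' as' [p' rp] [q' rq]]]]]].
      have eD : e \notin done.
        by move: uE; rewrite De cat_uniq /= negb_or => /and3P[_ /andP[]].
      have De' : enum (edges G) = rcons done e ++ ys by rewrite cat_rcons.
      have f' : s' vFlags = tree_of_flags G by rewrite sb// /s2 /update /= f1.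
      eapply triple_le; last first.
      eapply block_assign; eapply block_assign; eapply block_call.
        by apply: (@seek_triple O query_ok _ (enum_rank (source e)) _) => //; first exact: r'; exact: enum_rank_size.
      move=> s3 [l3 a3] sb3; eapply (@block_last _ _ _ _ (32 * N + 60)).
      apply: (@triple_le _ _ _ _ (32 * N + 59).+1); first by lia.
      apply: triple_if; rewrite /= l3 (hd_drop_enum (fun x => slot (g x))).
      case ge : (g (source e)) => [e0|] /=.
        eapply triple_le; last first.
        eapply block_assign; eapply block_assign; eapply block_call.
          apply: (@seek_triple O query_ok _ (enum_rank (source e)) _).
          - by rewrite /update /= sb3.
          - by rewrite /update /= sb3// /update /= f'.
          - exact: enum_rank_size.
        move=> s4 [l4 _] sb4; eapply (@block_last _ _ _ _ 2).
        have e4 : s4 vEdge = tree_of_arrow e by rewrite sb4// /update /= sb3.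
        have p4 : s4 vPool = tree_of_arrows P by rewrite sb4// /update /= sb3.
        have q4 : s4 vMinPool = tree_of_arrows Q by rewrite sb4// /update /= sb3.
        have r4 : s4 vRho = tree_of_seq [seq slot (g x) | x <- enum (node G)].
          by rewrite sb4// /update /= sb3.
        have as4 : assigned (rcons done e) g by apply: assigned_skip as'; rewrite ge.
        have rp4 := reserved_skip eD as' ge rp; have rq4 := reserved_skip eD as' ge rq.
        apply: triple_if; rewrite /= l4 (hd_drop_enum (fun x => tree_of_bool (x \in max_nodes G))).
        case: (boolP (source e \in _)) rp4 rq4 => eM /= rp4 rq4; apply: triple_assign.
          exists (rcons done e), g, (e :: P), Q; split=> //; split=> //.
          by rewrite /update /= e4 p4.
        exists (rcons done e), g, P, (e :: Q); split=> //; split=> //.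
        by rewrite /update /= e4 q4.
        by have := enum_rank_lt (source e); lia.
      apply: triple_le (triple_weaken (replace_found_triple O query_ok l3 a3) _); first by lia.
      move=> s4 r4 sb4.
      exists (rcons done e), [ffun x => if x == source e then Some e else g x], P, Q.
      have nge : ~~ g (source e) by rewrite ge.
      split=> //.
      * rewrite r4; congr tree_of_seq; apply: eq_map => x; rewrite ffunE.
        by case: ifP => // _; rewrite sb3.
      * exact: assigned_assign.
      * by split; [rewrite sb4// sb3 | exact: reserved_assign].
      * by split; [rewrite sb4// sb3 | exact: reserved_assign].
      by have := enum_rank_lt (source e); lia.
    + by rewrite /s2 /update /= sb1// /update /= si.
    + exists [::], [ffun=> None], [::], [::]; split=> //.
      * rewrite /s2 /update /= r1 -size_enum_nodes; congr tree_of_seq.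
        by elim: (enum (node G)) => //= x xs <-; rewrite ffunE.
      * by split=> // x e; rewrite ffunE.
      * by split; [rewrite /s2 /update /= sb1// /update /= sp | split].
      * by split; [rewrite /s2 /update /= sb1// /update /= sq | split].
  move=> s3 [_ [done [g [P [Q [De r3 [gD Dg] [p3 [uP mP]] [q3 [uQ mQ]]]]]]]] sb3.
  rewrite cats0 in De.
  have mD e : (e \in done) = (e \in edges G) by rewrite -De mem_enum.
  (* No node is a deadlock, so after all edges have been read every slot is filled. *)
  have [d dE] : exists d : node G -> arrow G, forall x, g x = Some (d x).
    suff : forall x, exists e, g x = Some e by move=> /boolp.choice[d dE]; exists d.
    move=> x; have [a [t eE]] := no_deadlock x.
    have := Dg (x, a, t); rewrite mD => /(_ eE); rewrite /source /=.
    by case: (g x) => // e _; exists e.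
  exists [ffun x => d x], P, Q.
  have gE e : (g (source e) != Some e) = (d (source e) != e) by rewrite dE.
  split=> //.
  + by move=> x; rewrite ffunE; have [] := gD _ _ (dE x); rewrite mD.
  + by rewrite sb3.
  + by rewrite r3; congr tree_of_seq; apply: eq_map => x; rewrite dE ffunE.
  + by split=> //; split=> // e; rewrite mP mD gE ffunE.
  + by split=> //; split=> // e; rewrite mQ mD gE ffunE.
- rewrite size_enum_nodes /init_time; nia.
Qed.

End Initialization.

Section Synthesis.
Context (A : finType) (R : realType) (phi : infinite_word A -> R).
Hypothesis phi_bounded : bounded_payoff phi.
Hypothesis phi_continuous : continuous phi.
Hypothesis phi_determined : positionally_determined phi.
Context (G : game_graph A) (facet : nat).
Hypothesis facet_gt0 : (0 < facet)%N.

Definition optimal_output (s : store) : Prop :=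
  exists rho : {ffun node G -> arrow G}, [/\ valid rho,
    forall e, e \in edges G -> ~~ improving phi rho e &
    s vIO = tree_of_joint rho].

Theorem synthesis_good :
  good (payoff_oracle phi) (short_query A (2 * order_of G)) optimal_output
    (start synthesis_program (tree_of_game G))
    ((init_time G)%:R + (steps R G facet + 1) * round_max R G facet + 12).
Proof.
have [s1 [t1 [ex1 le1 [rho [P [Q [v f r [p rp] [q rq]]]]]]]] :=
  @initialize_triple (payoff_oracle phi) (short_query A (2 * order_of G)) A G
    (start synthesis_program (tree_of_game G)).2 erefl erefl erefl erefl.
have l1 : s1 vStack = Nil by rewrite (exec_same ex1).
apply: good_le; last first.
apply: good_block_cons; apply: exec_good ex1 _.
apply: good_block_cons; apply: good_assign; apply: good_block_cons.
apply: (improve_max phi_bounded phi_continuous phi_determined facet_gt0 (rho := rho) (P := P) (Q := Q)) => //.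
move=> rho' s' v' noimp r'.
apply: good_block_cons; apply: good_assign; apply: good_block_nil.
apply: (@good_halt _ _ _ _ _ 0) => //; first by exists rho'.
have : t1%:R <= (init_time G)%:R :> R by rewrite ler_nat.
by rewrite mulrDl mul1r; lra.
Qed.

End Synthesis.

(** * From the recurrence to the subexponential bound *)

Section Bound.
Context (R : realType).

(** Uses 1 + 1/s <= e^(1/s), and bounds the exponent min(m, 4s) by 4s, which removes m from the
    first power. *)
Lemma steps_le_expR (A : finType) (G : game_graph A) (s : nat) :
  (0 < s)%N -> let n := #|node G| in let m := #|edges G| in
  steps R G s <= expR (n%:R / s%:R) * (s.+1%:R ^+ (4 * s) * m.+1%:R ^+ (4 * s).+1).
Proof.
move=> s0 /=; rewrite /steps; apply: ler_pM.
- by rewrite exprn_ge0// divr_ge0.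
- by apply: le_trans (facet_growth_ge1 _ _ _).
- rewrite mulrC [_^-1 * _]mulrC -/(_ / _) [expR _](_ : _ = expR (s%:R^-1) ^+ #|node G|); last first.
    by rewrite -expRM_natl.
  rewrite mulrC; apply: lerXn2r; rewrite ?nnegrE ?divr_ge0 ?expR_ge0//.
  apply: le_trans (expR_ge1Dx _); rewrite -natr1 mulrC mulrDl mul1r mulfV//.
  by rewrite gt_eqF ?ltr0n.
- rewrite /facet_growth ler_wpM2r ?exprn_ge0//.
  by apply: ler_weXn2l; [rewrite ler1n | exact: geq_minr].
Qed.

Lemma natr_succ_le_expR (m j : nat) : (1 < m)%N ->
  m.+1%:R ^+ j <= expR (2 * j%:R * ln (m%:R : R)).
Proof.
move=> m1; have m0 : 0 < m%:R :> R by rewrite ltr0n; lia.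
rewrite -mulrA mulrCA expRM_natl; apply: lerXn2r; rewrite ?nnegrE ?expR_ge0//.
rewrite mulr_natl mulr2n expRD lnK ?posrE// -natrM ler_nat; nia.
Qed.

Lemma poly_bound (n m : nat) : (n <= m)%N ->
  (m * (60 * n + 120) + 10 * n + 20 +
     6 * (m * (300 * n ^ 2 + 400 * n + 300) + 10 + 200 * m + 40) + 48
    <= 80 * 100 * m.+1 ^ 3)%N.
Proof.
move=> nm.
have n2 : (n ^ 2 <= m ^ 2)%N by rewrite leq_sqr.
have h1 : (m * n ^ 2 <= m * m ^ 2)%N by rewrite leq_mul2l n2 orbT.
have h2 : (m * n <= m * m)%N by rewrite leq_mul2l nm orbT.
have -> : (m.+1 ^ 3 = m * m ^ 2 + 3 * (m * m) + 3 * m + 1)%N by rewrite -addn1; lia.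
by move: h1 h2; move: (m ^ 2)%N (n ^ 2)%N => a b h1 h2; lia.
Qed.

(** With [q] the cost of a round of Min, bounding 1 and [S] by [S ^+ 2] collects 6 = 1 + 3 + 2
    copies of [q] and 48 = 18 + 18 + 12. *)
Lemma total_le (S : R) (i q : nat) : 1 <= S ->
  i%:R + (S + 1) * (S * q%:R + q%:R + 18 + q%:R) + 12 <=
  (i + 6 * q + 48)%:R * S ^+ 2.
Proof.
move=> S1; have q0 : 0 <= q%:R :> R by []; have i0 : 0 <= i%:R :> R by [].
rewrite [(_ + 48)%:R]natrD [(i + _)%:R]natrD natrM expr2; set a := q%:R in q0 *; set b := i%:R in i0 *.
have S2 : S <= S * S by nra.
have h1 : b <= b * (S * S) by nra.
have h2 : a * S <= a * (S * S) by nra.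
have h3 : a <= a * S by nra.
nra.
Qed.

Lemma order_le_edges (A : finType) (G : game_graph A) : (#|node G| <= #|edges G|)%N.
Proof.
have [d dE] : exists d : node G -> arrow G, forall x, d x \in edges G /\ source (d x) = x.
  suff : forall x, exists e : arrow G, e \in edges G /\ source e = x.
    by move=> /boolp.choice[d dE]; exists d.
  by move=> x; have [a [t eE]] := no_deadlock x; exists (x, a, t).
have inj : injective d by move=> x y /(congr1 (@source _ G)); rewrite (dE x).2 (dE y).2.
rewrite -(card_codom inj); apply/subset_leq_card/fintype.subsetP => e /codomP[x ->].
exact: (dE x).1.
Qed.

Lemma one_le_expR (x : R) : 0 <= x -> 1 <= expR x.
Proof. by rewrite -expR0 ler_expR. Qed.

(** The product is the value of the bound for s = 1 with m at most 1, where the logarithm vanishes;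
    the summand 100 serves as the constant in the exponent for larger m. *)
Definition constant : R :=
  (80 * 100)%:R * 2 ^+ 3 * (expR 1 * (2 ^+ 4 * 2 ^+ 5)) ^+ 2 + 100.

Lemma constant_ge : 100 <= constant /\ (80 * 100)%:R <= constant.
Proof.
have e1 : 1 <= (expR 1 * (2 ^+ 4 * 2 ^+ 5) : R) ^+ 2.
  have e2 j : 1 <= 2 ^+ j :> R by rewrite exprn_ege1// ler1n.
  by rewrite exprn_ege1// mulr_ege1 ?one_le_expR// mulr_ege1.
have c0 : 0 <= (80 * 100)%:R :> R by exact: ler0n.
have h0 : 1 <= 2 ^+ 3 * (expR 1 * (2 ^+ 4 * 2 ^+ 5)) ^+ 2 :> R.
  by rewrite mulr_ege1// exprn_ege1// ler1n.
rewrite /constant -mulrA; move: (_%:R) c0 (2 ^+ 3 * _) h0 => c c0 z z1; split; first by nra.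
nra.
Qed.

Lemma exponent_le (L Q sL K : R) : 100 * (L + Q) <= K -> 0 <= Q -> 0 <= L ->
  sL <= Q + L ->
  2 * (3 * L) + (Q + (2 * (12 * sL + L) + (Q + 2 * (12 * sL + L)))) <= K.
Proof. lra. Qed.

Lemma running_time_bound (A : finType) (G : game_graph A) :
  exists2 s, (0 < s)%N &
  (init_time G)%:R + (steps R G s + 1) * round_max R G s + 12 <=
    subexp_bound constant #|node G| #|edges G|.
Proof.
have nm := order_le_edges G; set n := #|node G| in nm *; set m := #|edges G| in nm *.
have total s : (0 < s)%N ->
    (init_time G)%:R + (steps R G s + 1) * round_max R G s + 12 <=
    (80 * 100)%:R * m.+1%:R ^+ 3 * (expR (n%:R / s%:R) *
       (s.+1%:R ^+ (4 * s) * m.+1%:R ^+ (4 * s).+1)) ^+ 2.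
  move=> s0; apply: le_trans (total_le _ _ (steps_ge1 R G s0)) _.
  have S0 : 0 <= steps R G s by apply: le_trans (steps_ge1 R G s0).
  apply: ler_pM; [exact: ler0n | by rewrite exprn_ge0 | |].
    by rewrite -natrX -natrM ler_nat; exact: poly_bound.
  apply: lerXn2r; rewrite ?nnegrE//; last exact: steps_le_expR.
have [C1 C2] := constant_ge.
have C0 : 0 <= constant by apply: le_trans C1.
rewrite /subexp_bound.
have [m1|m1] := leqP m 1.
  exists 1%N => //; apply: le_trans (total 1%N isT) _.
  have m2 : m.+1%:R <= 2 :> R by rewrite (ler_nat _ _ 2).
  have L0 : 0 <= ln (m%:R : R).
    by case: (m) m1 => [|[|//]] _; rewrite ?ln1// ln0.
  apply: (@le_trans _ _ constant); last first.
    by rewrite ler_peMr// one_le_expR// mulr_ge0// addr_ge0// sqrtr_ge0.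
  rewrite /constant; apply: ler_wpDr => //; apply: ler_pM.
  - by rewrite mulr_ge0// exprn_ge0.
  - by rewrite exprn_ge0// !mulr_ge0 ?expR_ge0 ?exprn_ge0.
  - by apply: ler_wpM2l => //; apply: lerXn2r; rewrite ?nnegrE.
  apply: lerXn2r; rewrite ?nnegrE ?mulr_ge0 ?expR_ge0 ?exprn_ge0//.
  apply: ler_pM; rewrite ?expR_ge0 ?mulr_ge0 ?exprn_ge0//.
    by rewrite ler_expR divr1 lern1 (leq_trans nm).
  by rewrite muln1; apply: ler_wpM2l; rewrite ?exprn_ge0//; apply: lerXn2r; rewrite ?nnegrE.
have m0 : 0 < m%:R :> R by rewrite ltr0n; lia.
set L := ln (m%:R : R).
(* From ln x <= x - 1 at x = 1/m. A lower bound on the logarithm is needed to keep [q], hence [s],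
   polynomial in m. *)
have L2 : 1 / 2 <= L.
  have := @le_ln1Dx R ((m%:R)^-1 - 1).
  have -> : 1 + ((m%:R)^-1 - 1) = (m%:R)^-1 :> R by rewrite addrC subrK.
  rewrite lnV ?posrE// -/L.
  have mi : (m%:R)^-1 <= 1 / 2 :> R.
    by rewrite mul1r lef_pV2 ?posrE// (ler_nat _ 2).
  have mi0 : 0 < (m%:R)^-1 :> R by rewrite invr_gt0.
  by move=> /(_ ltac:(lra)); lra.
have L0 : 0 < L by lra.
(* This balances the exponent n / s against s ln m: both become about sqrt(n ln m). Rounding up
   gives s >= q. *)
set q := Num.sqrt (n%:R / L).
have q0 : 0 <= q by exact: sqrtr_ge0.
have q2 : q ^+ 2 = n%:R / L by rewrite sqr_sqrtr// divr_ge0// ltW.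
have qL : q * L = Num.sqrt (n%:R * L).
  have qL0 : 0 <= q * L by rewrite mulr_ge0// ltW.
  rewrite -[LHS]ger0_norm// -sqrtr_sqr exprMn q2; congr Num.sqrt.
  by rewrite expr2 mulrA divfK// gt_eqF.
have s12 j : (12 * j + 1 = 2 * (4 * j) + (4 * j).+1)%N by lia.
have sR j : (12 * j + 1)%:R = 12 * j%:R + 1 :> R by rewrite natrD natrM.
pose s := (Num.truncn q).+1.
have /andP[sq qs] := truncn_itv q0; rewrite -/s in qs.
exists s => //; apply: le_trans (total s isT) _.
have s1 : s%:R <= q + 1 by rewrite /s -natr1 lerD2r.
have s0 : 0 < s%:R :> R by rewrite ltr0n.
(* q^2 = n / L <= 2m <= m^2, so powers of s + 1 are also powers of m + 1, up to a factor 2 in the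
   exponent. *)
have sm : s.+1%:R <= m.+1%:R ^+ 2 :> R.
  have qm : q <= m%:R.
    rewrite -(@ler_pXn2r _ 2)// ?nnegrE// q2 ler_pdivrMr//.
    have : n%:R <= m%:R :> R by rewrite ler_nat.
    have : 2 <= m%:R :> R by rewrite (ler_nat _ 2).
    by move: (m%:R : R) (n%:R : R) => a b; nra.
  have m2 : 2 <= m%:R :> R by rewrite (ler_nat _ 2).
  rewrite -natr1 -[m.+1%:R]natr1 expr2; move: qm s1 m2.
  by move: (m%:R : R) (s%:R : R) => a b; nra.
have h1 : expR (n%:R / s%:R) <= expR (q * L).
  rewrite ler_expR ler_pdivrMr//.
  have -> : n%:R = q ^+ 2 * L by rewrite q2 divfK// gt_eqF.
  rewrite expr2 -!mulrA ler_wpM2l// mulrC ler_wpM2l ?ltW//.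
have h2 : s.+1%:R ^+ (4 * s) * m.+1%:R ^+ (4 * s).+1 <=
    expR (2 * (12 * s + 1)%:R * L).
  apply: le_trans (natr_succ_le_expR _ m1).
  rewrite s12 exprD ler_wpM2r ?exprn_ge0// [leRHS]exprM.
  by apply: lerXn2r; rewrite ?nnegrE ?exprn_ge0.
have h3 : m.+1%:R ^+ 3 <= expR (2 * 3 * L) by exact: (natr_succ_le_expR 3 m1).
apply: (@le_trans _ _ ((80 * 100)%:R * expR (2 * 3 * L) *
    (expR (q * L) * expR (2 * (12 * s + 1)%:R * L)) ^+ 2)).
  have p0 : 0 <= s.+1%:R ^+ (4 * s) * m.+1%:R ^+ (4 * s).+1 :> R.
    by rewrite mulr_ge0// exprn_ge0.
  apply: ler_pM.
  - by rewrite mulr_ge0// exprn_ge0.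
  - by rewrite exprn_ge0// mulr_ge0// expR_ge0.
  - by rewrite ler_wpM2l.
  apply: lerXn2r; rewrite ?nnegrE.
  - by rewrite mulr_ge0// expR_ge0.
  - by rewrite mulr_ge0 ?expR_ge0.
  by apply: ler_pM; rewrite ?expR_ge0.
rewrite expr2 -!mulrA -!expRD; apply: ler_pM; rewrite ?expR_ge0// ler_expR -qL.
have : s%:R * L <= (q + 1) * L by rewrite ler_wpM2r// ltW.
rewrite mulrDl mul1r.
have : 0 <= q * L by rewrite mulr_ge0// ltW.
have : 100 * (L + q * L) <= constant * (L + q * L).
  by rewrite ler_wpM2r// addr_ge0 ?mulr_ge0// ltW.
move=> h5 h6 h7; rewrite sR.
have -> : (12 * s%:R + 1) * L = 12 * (s%:R * L) + L by rewrite mulrDl mul1r mulrA.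
exact: exponent_le h5 h6 (ltW L0) h7.
Qed.

End Bound.

Theorem theorem8p2 (R : realType) (A : finType) (phi : infinite_word A -> R)
    (phi_bounded : bounded_payoff phi)
    (phi_continuous : continuous phi)
    (phi_determined : positionally_determined phi) :
  exists (prog : cmd) (C : R) (K : nat), forall G : game_graph A,
    let O := payoff_oracle phi in
    let c0 := start prog (tree_of_game G) in
    let n := #|node G| in
    let m := #|edges G| in
    [/\ synthesizes phi prog G,
        (expected_time R O c0 <= (subexp_bound C n m)%:E)%E,
        queries_bounded A O c0 (K * n) &
        (expected_queries R O c0 <= (subexp_bound C n m)%:E)%E].
Proof.
exists synthesis_program, (constant R), 2%N => G O c0 n m.
(* The parameter [s] depends on the game but occurs only in the analysis; the program is the same
   for all games. *)
have [s s0 le] := running_time_bound R G.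
have g := good_le le (synthesis_good phi_bounded phi_continuous phi_determined G s0).
split.
- move=> c rc nrun; have [r gr] := good_reachable g rc.
  have [_ _ _ /(_ nrun) [rho [v noimp out0]]] := good_step gr.
  exists (fixed_strategy rho), (fixed_strategy rho); split.
    exact: equilibrium.
  rewrite out0; congr tree_of_seq; apply: eq_map => x.
  by rewrite /fixed_strategy; case: ifP.
- exact: expected_visits_le g.
- move=> c du dv da db rc qE; have [r gr] := good_reachable g rc.
  have [_ _ /(_ _ qE) [u [v [a [b [[-> -> -> ->] sz]]]]] _] := good_step gr.
  by exists u, v, a, b.
- exact: expected_visits_le (@querying_running) g.
Qed.
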